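(* Let $\zeta$ be an extremal number and let $\epsilon>0$. Then: (i) the inequality $|Q(\zeta)|\le H(Q)^{-3-\epsilon}$ has only finitely many solutions $Q\in\mathbb{Z}[T]$ that are irreducible of degree exactly three; in particular $|\zeta-\alpha|\le H(\alpha)^{-4-\epsilon}$ has only finitely many solutions in algebraic numbers $\alpha$ of degree exactly three; (ii) the inequalities $|Q(\zeta)|\le H(Q)^{-3+\epsilon}$ and $|\zeta-\alpha|\le H(\alpha)^{-4+\epsilon}$ have solutions in irreducible polynomials $Q\in\mathbb{Z}[T]$ of degree exactly three and in algebraic numbers $\alpha$ of degree exactly three, respectively, of arbitrarily large heights $H(Q)$ and $H(\alpha)$; (iii) there are arbitrarily large $X$ such that the system $H(Q)\le X$, $|Q(\zeta)|\le X^{-\sqrt5-\epsilon}$ has no solution $Q\in\mathbb{Z}[T]$ that is irreducible of degree exactly three; in particular, for arbitrarily large $X$ the system $H(\alpha)\le X$, $|\zeta-\alpha|\le H(\alpha)^{-1}X^{-\sqrt5-\epsilon}$ has no solution in algebraic numbers $\alpha$ of degree exactly three.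
   Context: For $P(T)=a_nT^n+\cdots+a_0\in\mathbb{Z}[T]$ let $H(P)=\max_j|a_j|$. For an algebraic number $\alpha$, $H(\alpha)=H(P)$ where $P\in\mathbb{Z}[T]$ is the irreducible minimal polynomial of $\alpha$ over $\mathbb{Z}$ with coprime coefficients. For real $\zeta$, $\widehat{w}_2(\zeta)$ is the supremum of $\eta$ such that for all sufficiently large $X$ there is $P\in\mathbb{Z}[T]$ of degree at most $2$ with $H(P)\le X$ and $0<|P(\zeta)|\le X^{-\eta}$. For every transcendental real $\zeta$ one has $\widehat{w}_2(\zeta)\le(3+\sqrt5)/2$; a real transcendental number $\zeta$ is called an extremal number if $\widehat{w}_2(\zeta)=(3+\sqrt5)/2$. *)

(* Defs.v *)
From HB Require Import structures.
From mathcomp Require Import all_boot all_order all_algebra.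
From mathcomp Require Import all_classical all_reals all_analysis.
From mathcomp Require Import complex.

Set Implicit Arguments.
Unset Strict Implicit.
Unset Printing Implicit Defensive.

Import Order.TTheory GRing.Theory Num.Theory.
Import numFieldNormedType.Exports.

Local Open Scope classical_set_scope.
Local Open Scope ring_scope.

Definition height (P : {poly int}) : nat := (\max_(i < size P) `|(P`_i)%R|)%N.

Definition evalZ (F : nzRingType) (P : {poly int}) (x : F) : F :=
  (map_poly intr P).[x].

(* Irreducible element of the ring Z[T]. The library's irreducible_poly at
   coefficient ring int uses pseudo-division, hence means irreducible in Q[T],
   and does not exclude constant non-unit factors. *)
Definition irreducibleZ (P : {poly int}) : Prop :=
  [/\ P != 0, P \isn't a GRing.unit &
      forall A B : {poly int}, P = A * B ->
        A \is a GRing.unit \/ B \is a GRing.unit].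

Definition transcendental (R : realType) (zeta : R) : Prop :=
  ~ algebraicOver (ratr : rat -> R) zeta.

Definition algebraic (R : realType) (alpha : R[i]) : Prop :=
  algebraicOver (ratr : rat -> R[i]) alpha.

(* zcontents P is the gcd of the coefficients of P, with the sign of the
   leading coefficient: zcontents P = 1 says that the coefficients are coprime
   and selects, of the two opposite candidates, the one with positive leading
   coefficient. *)
Definition is_minpolyZ (R : realType) (alpha : R[i]) (P : {poly int}) : Prop :=
  [/\ irreducibleZ P, zcontents P = 1 & evalZ P alpha = 0].

(* The zero polynomial when alpha is not algebraic. *)
Definition minpolyZ (R : realType) (alpha : R[i]) : {poly int} :=
  xget 0 [set P | is_minpolyZ alpha P].

Definition alg_height (R : realType) (alpha : R[i]) : nat :=
  height (minpolyZ alpha).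

Definition alg_degree (R : realType) (alpha : R[i]) : nat :=
  (size (minpolyZ alpha)).-1.

Definition cubic_poly (Q : {poly int}) : Prop :=
  irreducibleZ Q /\ size Q = 4%N.

Definition cubic_number (R : realType) (alpha : R[i]) : Prop :=
  algebraic alpha /\ alg_degree alpha = 3%N.

(* |zeta - alpha| as an element of R; the norm of R[i] takes values in R[i]. *)
Definition cdist (R : realType) (zeta : R) (alpha : R[i]) : R :=
  ComplexField.Normc.normc (zeta%:C%C - alpha).

Definition what2 (R : realType) (zeta : R) : \bar R :=
  ereal_sup [set eta%:E | eta in [set eta : R |
    \forall X \near +oo, exists P : {poly int},
      [/\ (size P <= 3)%N, (height P)%:R <= X &
          0 < `|evalZ P zeta| <= X `^ (- eta)]]].

Definition extremal (R : realType) (zeta : R) : Prop :=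
  transcendental zeta /\ what2 zeta = ((3 + Num.sqrt 5) / 2)%:E.

Lemma evalZM (F : comNzRingType) (P Q : {poly int}) (x : F) :
  evalZ (P * Q) x = evalZ P x * evalZ Q x.
Proof. by rewrite /evalZ rmorphM hornerM. Qed.

Lemma unitZ (P : {poly int}) :
  size P = 1%N -> zcontents P \is a GRing.unit -> P \is a GRing.unit.
Proof.
move=> s1 u; rewrite poly_unitE s1 eqxx /=.
move/eqP: s1 => /size_poly1P [c c0 E].
move: u; rewrite E coefC /=.
by rewrite -[c%:P]alg_polyC zcontentsZ zcontents_monic ?monic1 // mulr1.
Qed.

Lemma zc_unit (P A B : {poly int}) : zcontents P = 1 -> P = A * B ->
  zcontents A \is a GRing.unit /\ zcontents B \is a GRing.unit.
Proof.
move=> c1 E; move: c1; rewrite E zcontentsM => c1.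
have : zcontents A * zcontents B \is a GRing.unit by rewrite c1 unitr1.
by rewrite unitrM => /andP.
Qed.

Lemma minpolyZ_unique (R : realType) (a : R[i]) P P' :
  is_minpolyZ a P -> is_minpolyZ a P' -> P = P'.
Proof.
have key Q (G : {poly int}) : is_minpolyZ a Q ->
    size G != 1%N -> G %| Q -> Q = zprimitive G.
  move=> [[Q0 _ irr] c1 _] sG /dvdpP_int [r E].
  have [u|u] := irr _ _ E.
    by move: u; rewrite poly_unitE size_zprimitive (negbTE sG).
  have G0 : G != 0 by apply: contraNneq Q0 => G0; rewrite E G0 zprimitive0 mul0r.
  have := c1; rewrite E zcontentsM zcontents_primitive G0 mul1r.
  move: u; rewrite poly_unitE => /andP[/size_poly1P [c _ ->] _].
  rewrite -[c%:P]alg_polyC zcontentsZ zcontents_monic ?monic1 // mulr1 => ->.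
  by rewrite scale1r mulr1.
move=> mP mP'.
have sG : size (gcdp P P') != 1%N.
  apply/negP => /Bezout_coprimepP [[u v] /= ].
  rewrite -size_poly_eq1 => /size_poly1P [c c0 E].
  have : evalZ (u * P + v * P') a = 0.
    rewrite /evalZ rmorphD hornerD -!/(evalZ _ _) !evalZM.
    by case: mP mP' => _ _ -> [_ _ ->]; rewrite !mulr0 addr0.
  rewrite E /evalZ map_polyC hornerC /= => /eqP.
  by rewrite intr_eq0 (negbTE c0).
exact: etrans (key P _ mP sG (dvdp_gcdl _ _))
  (esym (key P' _ mP' sG (dvdp_gcdr _ _))).
Qed.

Lemma minpolyZ_exists (R : realType) (a : R[i]) :
  algebraic a -> is_minpolyZ a (minpolyZ a).
Proof.
move=> [p p0 rp]; apply: (@xgetPex _ 0 [set P | is_minpolyZ a P]).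
have ex : exists n, `[< exists P : {poly int}, [/\ P != 0, evalZ P a = 0 & size P = n] >].
  have [q [b b0 E]] := rat_poly_scale p.
  exists (size q); apply/asboolP; exists q; split=> //.
    by apply: contraNneq p0 => q0; rewrite E q0 rmorph0 scaler0.
  have : map_poly ratr (b%:~R *: p) = map_poly intr q :> {poly R[i]}.
    rewrite E scalerA divff ?intr_eq0 // scale1r -map_poly_comp.
    by apply: eq_map_poly => z /=; rewrite ratr_int.
  rewrite /evalZ => <-; rewrite map_polyZ hornerZ.
  by move/eqP: rp => ->; rewrite mulr0.
case: (ex_minnP ex) => n /asboolP [P0 [nz0 e0 s0]] min.
pose P := zprimitive P0.
have nz : P != 0 by rewrite zprimitive_eq0.
have e : evalZ P a = 0.
  move/eqP: e0; rewrite [P0]zpolyEprim -/P /evalZ map_polyZ hornerZ mulf_eq0.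
  by rewrite intr_eq0 zcontents_eq0 (negbTE nz0) => /eqP.
have c : zcontents P = 1 by rewrite zcontents_primitive nz0.
have sP : size P = n by rewrite size_zprimitive.
exists P; split=> //; split=> //.
  rewrite poly_unitE; apply/negP => /andP[/size_poly1P [d d0 E] _].
  by move/eqP: e; rewrite E /evalZ map_polyC hornerC intr_eq0 (negbTE d0).
have half A B : P = A * B -> evalZ A a = 0 -> B \is a GRing.unit.
  move=> E eA; have [uA uB] := zc_unit c E.
  have A0 : A != 0 by apply: contraNneq nz => A0; rewrite E A0 mul0r.
  have B0 : B != 0 by apply: contraNneq nz => B0; rewrite E B0 mulr0.
  apply: unitZ => //.
  have : (n <= size A)%N by apply: min; apply/asboolP; exists A.
  have := sP; rewrite E size_mul // => <-.
  have : (0 < size B)%N by rewrite size_poly_gt0.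
  have : (0 < size A)%N by rewrite size_poly_gt0.
  case: (size A) (size B) => [|k] [|[|l]] //= _ _.
  by rewrite -[k.+1]addn1 leq_add2l.
move=> A B E; move/eqP: e; rewrite E evalZM mulf_eq0 => /orP[/eqP eA|/eqP eB].
  by right; apply: half E eA.
by left; apply: half eB; rewrite mulrC.
Qed.

(* Main.v *)
Require Import Defs.
From HB Require Import structures.
From mathcomp Require Import all_boot all_order all_algebra.
From mathcomp Require Import all_classical all_reals all_analysis.
From mathcomp Require Import complex ring lra zify.

Set Implicit Arguments.
Unset Strict Implicit.
Unset Printing Implicit Defensive.

Import Order.TTheory GRing.Theory Num.Theory.

Local Open Scope classical_set_scope.
Local Open Scope ring_scope.

(* Write g for the golden ratio. The records P_i of |P(zeta)| among quadratic P of
   growing height satisfy |P_i(zeta)| <= H(P_(i+1))^(-g^2 + o(1)). Nonvanishing of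
   Res(P_i, P_(i+1)) and, for some i, of the determinant of three consecutive P_i
   then forces the latter indices to give a subsequence Q_k such that, up to o(1)
   in the exponents, H(Q_(k+1)) = H(Q_k)^g and |Q_k(zeta)| is the inverse of
   H(Q_k) H(Q_(k+1))^2. So D = Res(Q_k, Q_(k+1)) is a nonzero integer of size
   H(Q_k)^o(1), and Q_k, T Q_k, Q_(k+1), T Q_(k+1) almost form a basis of the integer
   polynomials S of degree at most 3: D S = A Q_k + B Q_(k+1), where Cramer's rule
   bounds the linear polynomials A and B.

   - Expanding A Q_k in terms of Q_(k+1) and Q_(k+2) in this way gives a descent which
     shows |A(zeta)| >= H(A)^(-1 - o(1)) for linear A.
   - If S is an irreducible cubic, then A and B are nonzero. If H(S) is below
     H(Q_(k+1)) and |S(zeta)| below H(Q_(k+1))^(-sqrt 5), then H(B) < 1: this is (iii).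
     If H(S) is between H(Q_(k+1)) and H(Q_(k+2)), then A(zeta) Q_k(zeta) dominates
     S(zeta), which gives (i).
   - For (ii) take S = A Q_k + Q_(k+1), where A is linear, H(A) is about
     H(Q_(k+1)) / H(Q_k) and |A(zeta)| about 1 / H(A). A quadratic factor of S would be
     a rational combination of Q_k and Q_(k+1), which is incompatible with
     the definition of S.

   Sizes are compared through the logarithms [lnh] of heights and [lnv] of values. *)

(** * Heights and Taylor coefficients *)

(** The determinants in use do not change under the translation of T by zeta. They can therefore be
    computed from Taylor coefficients at zeta, where the constant terms are tiny values, while they
    remain integers: each is 0 or at least 1 in absolute value.

    No limit is taken: o(1) is a fixed [d], and the whole sequence Q_k is chosen for that [d]. Since
    [M], a lower bound for all [lnh (Q k)], is chosen after [d], every absolute constant is absorbed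
    into [d * lnh (Q k)]. With [d * lnh (Q k)] treated as an atom, the estimates become linear
    inequalities between the log-heights of a few consecutive Q_k.

    The delicate point is the bound for linear forms, which has to hold for all heights with an
    additive constant that is harmless for the sequence at hand. The descent yields a constant
    depending on its own sequence, so it is run on an auxiliary sequence, and the sequence used for
    cubics is chosen afterwards, beyond that constant. *)

Section ExponentialBounds.
Variable R : realType.
Implicit Types a b c d e f : R.

Lemma le_expRM a b e f : `|a| <= expR e -> `|b| <= expR f ->
  `|a * b| <= expR (e + f).
Proof. by move=> ha hb; rewrite normrM expRD ler_pM. Qed.

Lemma le_expRW a e f : `|a| <= expR e -> e <= f -> `|a| <= expR f.
Proof. by move=> ha hef; rewrite (le_trans ha)// ler_expR. Qed.

(** A sum costs a factor 2, and 2 is at most [expR 1]. In this form bounds for polynomial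
    expressions are linear in the exponents. *)
Lemma le_expRD a b e : `|a| <= expR e -> `|b| <= expR e ->
  `|a + b| <= expR (e + 1).
Proof.
move=> ha hb; rewrite (le_trans (ler_normD _ _))// expRD.
have h1 := expR_ge1Dx (1 : R); have h0 := expR_gt0 e.
by nra.
Qed.

Lemma le_expRB a b e : `|a| <= expR e -> `|b| <= expR e ->
  `|a - b| <= expR (e + 1).
Proof. by move=> ha hb; apply: le_expRD => //; rewrite normrN. Qed.

Lemma expR_ln_norm a : a != 0 -> expR (ln `|a|) = `|a|.
Proof. by move=> a0; rewrite lnK// posrE normr_gt0. Qed.

Lemma int_small_eq0 (z : int) e : `|z%:~R : R| <= expR e -> e < 0 -> z = 0.
Proof.
move=> hz he; apply/eqP; apply: contraTT (hz) => z0.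
rewrite -ltNge; apply: (@lt_le_trans _ _ 1); first by rewrite expR_lt1.
by rewrite -intr_norm -[1]/(1%:~R) ler_int -gtz0_ge1 normr_gt0.
Qed.

Lemma int_norm_ge1 (z : int) : z != 0 -> 1 <= `|z%:~R : R|.
Proof. by move=> z0; rewrite -intr_norm -[1]/(1%:~R) ler_int -gtz0_ge1 normr_gt0. Qed.

End ExponentialBounds.

Section Height.
Implicit Types P Q : {poly int}.

Lemma coef_le_height P i : (absz (P`_i)%R <= height P)%N.
Proof.
case: (ltnP i (size P)) => hi; last by rewrite nth_default.
exact: (@leq_bigmax _ (fun j : 'I_(size P) => absz (P`_j)%R) (Ordinal hi)).
Qed.

Lemma height_leP P n : (height P <= n)%N <-> forall i, (absz (P`_i)%R <= n)%N.
Proof.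
split=> [h i|h]; first exact: leq_trans (coef_le_height P i) h.
by apply/bigmax_leqP => i _.
Qed.

Lemma height_gt0 P : P != 0 -> (0 < height P)%N.
Proof.
move=> P0; apply: leq_trans (coef_le_height P (size P).-1).
by rewrite absz_gt0 -lead_coefE lead_coef_eq0.
Qed.

Lemma height_eq0 P : (height P == 0%N) = (P == 0).
Proof.
apply/eqP/eqP => [h|->]; last by apply/eqP; rewrite -leqn0; apply/height_leP => i; rewrite coef0.
by apply/eqP; apply: contraTT (leqnn 0) => /height_gt0; rewrite h.
Qed.

Lemma height_ex P : exists i, height P = absz (P`_i)%R.
Proof.
case: (posnP (size P)) => [s0|s0].
  exists 0%N; rewrite nth_default ?s0//; apply/eqP; rewrite height_eq0.
  by rewrite -size_poly_eq0 s0.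
have s1 : (0 < #|'I_(size P)|)%N by rewrite card_ord.
have [i hi] := bigop.eq_bigmax (fun j : 'I_(size P) => absz (P`_j)%R) s1.
by exists i.
Qed.

End Height.

Section Taylor.
Variables (R : realType) (zeta : R).
Implicit Types A B P Q S : {poly int}.

Definition coefR (P : {poly int}) (i : nat) : R := (P`_i)%:~R.

(* For S of degree at most 3, the coefficients of S(T + zeta). *)
Definition taylor0 S :=
  coefR S 0 + coefR S 1 * zeta + coefR S 2 * zeta ^+ 2 + coefR S 3 * zeta ^+ 3.
Definition taylor1 S := coefR S 1 + 2 * coefR S 2 * zeta + 3 * coefR S 3 * zeta ^+ 2.
Definition taylor2 S := coefR S 2 + 3 * coefR S 3 * zeta.
Definition taylor3 S := coefR S 3.

Lemma evalZ_tc0 S : (size S <= 4)%N -> evalZ S zeta = taylor0 S.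
Proof.
move=> s; rewrite /evalZ (@horner_coef_wide _ 4); last first.
  by rewrite (leq_trans (size_poly _ _)).
rewrite !big_ord_recl big_ord0 /= !coef_map /taylor0 /coefR /bump /=.
by ring.
Qed.

(** The logarithm of a common bound for the maps from height to Taylor coefficients in degree at
    most 3: the value, for instance, is at most 1 + z + z^2 + z^3 times the height, where z =
    |zeta|. The factor 10 is generous. *)
Definition taylor_const : R := ln (10 * (1 + `|zeta|) ^+ 3).

Lemma taylor_const_ge1 : 1 <= expR taylor_const.
Proof.
rewrite /taylor_const lnK; last first.
  by rewrite posrE mulr_gt0// exprn_gt0// ltr_pwDl.
have h : 1 <= (1 + `|zeta|) ^+ 3 by rewrite exprn_ege1// lerDl.
by lra.
Qed.

Lemma taylor_const_ge0 : 0 <= taylor_const.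
Proof. by have := taylor_const_ge1; rewrite leNgt expR_lt1 -leNgt. Qed.

Lemma coefR_le S i : `|coefR S i| <= (height S)%:R.
Proof.
by rewrite /coefR -intr_norm -abszE -pmulrn ler_nat coef_le_height.
Qed.

Lemma taylor_le S (h : R) : (height S)%:R <= expR h ->
  [/\ `|taylor0 S| <= expR (taylor_const + h), `|taylor1 S| <= expR (taylor_const + h),
      `|taylor2 S| <= expR (taylor_const + h) & `|taylor3 S| <= expR (taylor_const + h)].
Proof.
move=> hS.
have c i : `|coefR S i| <= expR h := le_trans (coefR_le S i) hS.
have h0 := expR_gt0 h.
set z := `|zeta|; have z0 : 0 <= z := normr_ge0 _.
have cz n i k : `|n%:R * coefR S i * zeta ^+ k| <= n%:R * expR h * z ^+ k.
  by rewrite !normrM normrX normr_nat !ler_wpM2r ?exprn_ge0// ler_wpM2l.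
have tri (x y e f : R) : `|x| <= e -> `|y| <= f -> `|x + y| <= e + f.
  by move=> hx hy; rewrite (le_trans (ler_normD _ _))// lerD.
have K (e : R) : e <= 10 * (1 + z) ^+ 3 * expR h -> e <= expR (taylor_const + h).
  rewrite expRD /taylor_const lnK// posrE mulr_gt0// exprn_gt0// ltr_pwDl//.
have z2 : 0 <= z ^+ 2 by rewrite exprn_ge0.
have z3 : 0 <= z ^+ 3 by rewrite exprn_ge0.
have hz := mulr_ge0 z0 (ltW h0).
have hz2 := mulr_ge0 z2 (ltW h0).
have hz3 := mulr_ge0 z3 (ltW h0).
split; rewrite /taylor0 /taylor1 /taylor2 /taylor3.
- have -> : coefR S 0 + coefR S 1 * zeta + coefR S 2 * zeta ^+ 2 + coefR S 3 * zeta ^+ 3 =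
    1%:R * coefR S 0 * zeta ^+ 0 + 1%:R * coefR S 1 * zeta ^+ 1 +
    1%:R * coefR S 2 * zeta ^+ 2 + 1%:R * coefR S 3 * zeta ^+ 3 by ring.
  apply: le_trans (tri _ _ _ _ (tri _ _ _ _ (tri _ _ _ _ (cz _ _ _) (cz _ _ _)) (cz _ _ _)) (cz _ _ _)) _.
  by apply: K; lra.
- have -> : coefR S 1 + 2 * coefR S 2 * zeta + 3 * coefR S 3 * zeta ^+ 2 =
    1%:R * coefR S 1 * zeta ^+ 0 + 2%:R * coefR S 2 * zeta ^+ 1 +
    3%:R * coefR S 3 * zeta ^+ 2 by ring.
  apply: le_trans (tri _ _ _ _ (tri _ _ _ _ (cz _ _ _) (cz _ _ _)) (cz _ _ _)) _.
  by apply: K; lra.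
- have -> : coefR S 2 + 3 * coefR S 3 * zeta =
    1%:R * coefR S 2 * zeta ^+ 0 + 3%:R * coefR S 3 * zeta ^+ 1 by ring.
  apply: le_trans (tri _ _ _ _ (cz _ _ _) (cz _ _ _)) _.
  by apply: K; lra.
- by apply: le_trans (c 3) _; apply: K; lra.
Qed.

End Taylor.

(** * Resultants and Cramer's rule *)

Section Resultants.
Implicit Types A B P Q S : {poly int}.

Definition wedge P Q (i j : nat) : int := P`_i * Q`_j - P`_j * Q`_i.

(* The resultant of P and Q as polynomials of formal degree 2. *)
Definition res22 P Q : int :=
  wedge P Q 0 2 ^+ 2 - wedge P Q 0 1 * wedge P Q 1 2.

(** The resultant of a linear [A] and of [P] in formal degree 2: the square of the leading
    coefficient of [A] times the value of [P] at the root of [A]. *)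
Definition res12 A P : int :=
  A`_0 ^+ 2 * P`_2 - A`_0 * A`_1 * P`_1 + A`_1 ^+ 2 * P`_0.

Definition det3 P Q S : int :=
  P`_0 * wedge Q S 1 2 - P`_1 * wedge Q S 0 2 + P`_2 * wedge Q S 0 1.

Lemma res22C P Q : res22 Q P = res22 P Q.
Proof. by rewrite /res22 /wedge; ring. Qed.

Lemma poly_linE A : (size A <= 2)%N -> A = (A`_0)%:P + (A`_1)%:P * 'X.
Proof.
move=> s; apply/polyP => -[|[|i]].
- by rewrite coefD coefMX coefC /= addr0.
- by rewrite coefD coefMX !coefC /= add0r.
- by rewrite coefD coefMX !coefC /= add0r nth_default// (leq_trans s).
Qed.

Lemma poly_quadE P : (size P <= 3)%N ->
  P = (P`_0)%:P + (P`_1)%:P * 'X + (P`_2)%:P * 'X^2.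
Proof.
move=> s; apply/polyP => i.
rewrite !coefD coefMX coefMXn !coefC.
case: i => [|[|[|i]]] /=; rewrite ?addr0 ?add0r ?subr0//.
by rewrite nth_default// (leq_trans s).
Qed.

Lemma poly_cubE P : (size P <= 4)%N ->
  P = (P`_0)%:P + (P`_1)%:P * 'X + (P`_2)%:P * 'X^2 + (P`_3)%:P * 'X^3.
Proof.
move=> s; apply/polyP => i.
rewrite !coefD coefMX !coefMXn !coefC.
case: i => [|[|[|[|i]]]] /=; rewrite ?addr0 ?add0r ?subr0//.
by rewrite nth_default// (leq_trans s).
Qed.

Lemma size_lin (a b : int) : (size (a%:P + b%:P * 'X)%R <= 2)%N.
Proof.
rewrite (leq_trans (size_polyD _ _))// geq_max (leq_trans (size_polyC_leq1 _))//=.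
by rewrite (leq_trans (size_polyMleq _ _))// size_polyX addn2 /= ltnS size_polyC_leq1.
Qed.

Lemma coef_lin (a b : int) :
  ((a%:P + b%:P * 'X)`_0 = a) * ((a%:P + b%:P * 'X)`_1 = b).
Proof. by split; rewrite coefD coefMX !coefC /= ?addr0 ?add0r. Qed.

Lemma coef_mul_lin A P : (size A <= 2)%N -> (size P <= 3)%N ->
  [/\ (A * P)`_0 = A`_0 * P`_0, (A * P)`_1 = A`_0 * P`_1 + A`_1 * P`_0,
      (A * P)`_2 = A`_0 * P`_2 + A`_1 * P`_1 & (A * P)`_3 = A`_1 * P`_2].
Proof.
move=> sA sP.
have A2 : A`_2 = 0 by rewrite nth_default.
have A3 : A`_3 = 0 by rewrite nth_default// (leq_trans sA).
have P3 : P`_3 = 0 by rewrite nth_default.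
by split; rewrite coefM !big_ord_recl big_ord0 /= /bump /= ?A2 ?A3 ?P3 ?(subnn, subn0); ring.
Qed.

Lemma size_mul_lin A P m n : (size A <= m.+1)%N -> (size P <= n.+1)%N ->
  (size (A * P)%R <= (m + n).+1)%N.
Proof. by move=> sA sP; rewrite (leq_trans (size_polyMleq _ _))//; lia. Qed.

Section Cramer.
Variable F : comNzRingType.
Implicit Types p q s : F.

Definition minor3 (x1 x2 x3 y1 y2 y3 z1 z2 z3 : F) : F :=
  x1 * (y2 * z3 - y3 * z2) - x2 * (y1 * z3 - y3 * z1) + x3 * (y1 * z2 - y2 * z1).

(* Cofactors of the Sylvester system  D S = (a0 + a1 T) P + (b0 + b1 T) Q :
   [cramer1] gives b1 and [cramer0] gives b0, both expanded along the column of
   the constant coefficients. *)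
Definition cramer1 p0 p1 p2 q0 q1 q2 s0 s1 s2 s3 : F :=
  p0 * minor3 p0 p1 p2 q1 q2 0 s1 s2 s3
  + q0 * minor3 p1 p2 0 p0 p1 p2 s1 s2 s3
  - s0 * minor3 p1 p2 0 p0 p1 p2 q1 q2 0.

Definition cramer0 p0 p1 p2 q0 q1 q2 s0 s1 s2 s3 : F :=
  p0 * minor3 p0 p1 p2 s1 s2 s3 q0 q1 q2
  + s0 * minor3 p1 p2 0 p0 p1 p2 q0 q1 q2.

(** [res22] over any commutative ring, so that it can be evaluated at real Taylor coefficients as
    well as at integer ones. *)
Definition disc22 p0 p1 p2 q0 q1 q2 : F :=
  (p0 * q2 - p2 * q0) ^+ 2 - (p0 * q1 - p1 * q0) * (p1 * q2 - p2 * q1).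

Lemma cramerP p0 p1 p2 q0 q1 q2 a0 a1 b0 b1 :
  let s0 := a0 * p0 + b0 * q0 in
  let s1 := a0 * p1 + a1 * p0 + (b0 * q1 + b1 * q0) in
  let s2 := a0 * p2 + a1 * p1 + (b0 * q2 + b1 * q1) in
  let s3 := a1 * p2 + b1 * q2 in
  cramer1 p0 p1 p2 q0 q1 q2 s0 s1 s2 s3 = disc22 p0 p1 p2 q0 q1 q2 * b1 /\
  cramer0 p0 p1 p2 q0 q1 q2 s0 s1 s2 s3 = disc22 p0 p1 p2 q0 q1 q2 * b0.
Proof.
by split; rewrite /cramer0 /cramer1 /minor3 /disc22; ring.
Qed.

End Cramer.

Lemma sylvester_solve P Q S :
  (size P <= 3)%N -> (size Q <= 3)%N -> (size S <= 4)%N ->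
  exists A B : {poly int}, [/\ (size A <= 2)%N, (size B <= 2)%N &
    res22 P Q *: S = A * P + B * Q].
Proof.
move=> sP sQ sS.
pose B := (cramer0 P`_0 P`_1 P`_2 Q`_0 Q`_1 Q`_2 S`_0 S`_1 S`_2 S`_3)%:P +
  (cramer1 P`_0 P`_1 P`_2 Q`_0 Q`_1 Q`_2 S`_0 S`_1 S`_2 S`_3)%:P * 'X.
(* The resultant is symmetric, so [A] arises from [B] by exchanging [P] and [Q]. *)
pose A := (cramer0 Q`_0 Q`_1 Q`_2 P`_0 P`_1 P`_2 S`_0 S`_1 S`_2 S`_3)%:P +
  (cramer1 Q`_0 Q`_1 Q`_2 P`_0 P`_1 P`_2 S`_0 S`_1 S`_2 S`_3)%:P * 'X.
exists A, B; split; [exact: size_lin|exact: size_lin|].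
rewrite -mul_polyC [X in _ * X](poly_cubE sS) [in X in _ = X + _](poly_quadE sP).
rewrite [in X in _ = _ + X](poly_quadE sQ) /A /B.
rewrite /res22 /wedge /cramer0 /cramer1 /minor3.
ring.
Qed.

Lemma sylvester_coef P Q S A B :
  (size P <= 3)%N -> (size Q <= 3)%N -> (size A <= 2)%N -> (size B <= 2)%N ->
  S = A * P + B * Q ->
  [/\ S`_0 = A`_0 * P`_0 + B`_0 * Q`_0,
      S`_1 = A`_0 * P`_1 + A`_1 * P`_0 + (B`_0 * Q`_1 + B`_1 * Q`_0),
      S`_2 = A`_0 * P`_2 + A`_1 * P`_1 + (B`_0 * Q`_2 + B`_1 * Q`_1) &
      S`_3 = A`_1 * P`_2 + B`_1 * Q`_2].
Proof.
move=> sP sQ sA sB ->; rewrite !coefD.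
have [-> -> -> ->] := coef_mul_lin sA sP.
by have [-> -> -> ->] := coef_mul_lin sB sQ.
Qed.

Lemma sylvester_inj P Q A B :
  (size P <= 3)%N -> (size Q <= 3)%N -> (size A <= 2)%N -> (size B <= 2)%N ->
  res22 P Q != 0 -> A * P + B * Q = 0 -> A = 0 /\ B = 0.
Proof.
have key P' Q' A' B' :
  (size P' <= 3)%N -> (size Q' <= 3)%N -> (size A' <= 2)%N -> (size B' <= 2)%N ->
  res22 P' Q' != 0 -> A' * P' + B' * Q' = 0 -> B' = 0.
  move=> sP sQ sA sB D0 /esym E.
  have [e0 e1 e2 e3] := sylvester_coef sP sQ sA sB E.
  have := cramerP P'`_0 P'`_1 P'`_2 Q'`_0 Q'`_1 Q'`_2 A'`_0 A'`_1 B'`_0 B'`_1.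
  rewrite /= -e0 -e1 -e2 -e3 !coef0 -[disc22 _ _ _ _ _ _]/(res22 P' Q').
  rewrite {1}/cramer1 {1}/cramer0 /minor3 => -[b1 b0].
  rewrite (poly_linE sB).
  have -> : B'`_1 = 0.
    by apply: (mulfI D0); rewrite -b1; ring.
  have -> : B'`_0 = 0.
    by apply: (mulfI D0); rewrite -b0; ring.
  by rewrite mul0r addr0.
move=> sP sQ sA sB D0 E; split; last exact: key sP sQ sA sB D0 E.
by apply: key sQ sP sB sA _ _; [rewrite res22C|rewrite addrC].
Qed.

(** The coefficients of T and T^2 agree identically; the constant coefficients differ by
    [det3 P Q S]. *)
Lemma det3_combine (P Q S : {poly int}) :
  (size P <= 3)%N -> (size Q <= 3)%N -> (size S <= 3)%N -> det3 P Q S = 0 ->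
  wedge Q S 1 2 *: P = wedge P S 1 2 *: Q + wedge Q P 1 2 *: S.
Proof.
move=> sP sQ sS d0; apply/polyP => -[|[|[|k]]]; rewrite coefD !coefZ.
- apply/eqP; rewrite -subr_eq0; apply/eqP; rewrite -[RHS]d0.
  by rewrite /det3 /wedge; ring.
- by rewrite /wedge; ring.
- by rewrite /wedge; ring.
- by rewrite !nth_default ?mulr0 ?addr0// (leq_trans sP, leq_trans sQ, leq_trans sS).
Qed.

End Resultants.

Section TaylorBounds.
Variables (R : realType) (zeta : R).
Implicit Types A B P Q S : {poly int}.

Local Notation cf := (@coefR R).
Local Notation tc0 := (taylor0 zeta).
Local Notation tc1 := (taylor1 zeta).
Local Notation tc2 := (taylor2 zeta).
Local Notation tc3 := (@taylor3 R).
Local Notation kappa := (taylor_const zeta).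

Lemma coefR_eq0 P n i : (size P <= n)%N -> (n <= i)%N -> cf P i = 0.
Proof. by move=> s ni; rewrite /cf nth_default// (leq_trans s). Qed.

Lemma taylor_lin A : (size A <= 2)%N ->
  [/\ tc0 A = cf A 0 + cf A 1 * zeta, tc1 A = cf A 1, tc2 A = 0 & tc3 A = 0].
Proof.
move=> s; rewrite /taylor0 /taylor1 /taylor2 /taylor3.
by rewrite (@coefR_eq0 A 2 2)// (@coefR_eq0 A 2 3)//; split; ring.
Qed.

Lemma taylor_quad P : (size P <= 3)%N ->
  [/\ tc0 P = cf P 0 + cf P 1 * zeta + cf P 2 * zeta ^+ 2,
      tc1 P = cf P 1 + 2 * cf P 2 * zeta, tc2 P = cf P 2 & tc3 P = 0].
Proof.
move=> s; rewrite /taylor0 /taylor1 /taylor2 /taylor3.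
by rewrite (@coefR_eq0 P 3 3)//; split; ring.
Qed.

Lemma taylor_mul A P : (size A <= 2)%N -> (size P <= 3)%N ->
  [/\ tc0 (A * P) = tc0 A * tc0 P,
      tc1 (A * P) = tc0 A * tc1 P + tc1 A * tc0 P,
      tc2 (A * P) = tc0 A * tc2 P + tc1 A * tc1 P &
      tc3 (A * P) = tc1 A * tc2 P].
Proof.
move=> sA sP.
have [-> -> _ _] := taylor_lin sA; have [-> -> -> _] := taylor_quad sP.
have [e0 e1 e2 e3] := coef_mul_lin sA sP.
rewrite /taylor0 /taylor1 /taylor2 /taylor3 /coefR e0 e1 e2 e3.
by rewrite !(intrD, intrM); split; ring.
Qed.

Lemma taylorD P Q : [/\ tc0 (P + Q) = tc0 P + tc0 Q, tc1 (P + Q) = tc1 P + tc1 Q,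
  tc2 (P + Q) = tc2 P + tc2 Q & tc3 (P + Q) = tc3 P + tc3 Q].
Proof.
rewrite /taylor0 /taylor1 /taylor2 /taylor3 /coefR !coefD !intrD.
by split; ring.
Qed.

Lemma taylorZ (n : int) P : [/\ tc0 (n *: P) = n%:~R * tc0 P,
  tc1 (n *: P) = n%:~R * tc1 P, tc2 (n *: P) = n%:~R * tc2 P &
  tc3 (n *: P) = n%:~R * tc3 P].
Proof.
rewrite /taylor0 /taylor1 /taylor2 /taylor3 /coefR !coefZ !intrM.
by split; ring.
Qed.

(** Invariance of the resultant under translation by zeta. The same principle gives [wedge12_tc],
    [det3_tc] and [res12_tc]. *)
Lemma res22_tc P Q : (size P <= 3)%N -> (size Q <= 3)%N ->
  (res22 P Q)%:~R = disc22 (tc0 P) (tc1 P) (tc2 P) (tc0 Q) (tc1 Q) (tc2 Q).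
Proof.
move=> sP sQ.
have [-> -> -> _] := taylor_quad sP; have [-> -> -> _] := taylor_quad sQ.
by rewrite /res22 /wedge /disc22 /coefR !(rmorphB, rmorphM, rmorphXn) /=; ring.
Qed.

Lemma wedge12_tc P Q : (size P <= 3)%N -> (size Q <= 3)%N ->
  (wedge P Q 1 2)%:~R = tc1 P * tc2 Q - tc2 P * tc1 Q.
Proof.
move=> sP sQ.
have [_ -> -> _] := taylor_quad sP; have [_ -> -> _] := taylor_quad sQ.
by rewrite /wedge /coefR !(rmorphB, rmorphM) /=; ring.
Qed.

Lemma det3_tc P Q S : (size P <= 3)%N -> (size Q <= 3)%N -> (size S <= 3)%N ->
  (det3 P Q S)%:~R = minor3 (tc0 P) (tc1 P) (tc2 P) (tc0 Q) (tc1 Q) (tc2 Q)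
    (tc0 S) (tc1 S) (tc2 S).
Proof.
move=> sP sQ sS.
have [-> -> -> _] := taylor_quad sP; have [-> -> -> _] := taylor_quad sQ.
have [-> -> -> _] := taylor_quad sS.
by rewrite /det3 /wedge /minor3 /coefR !(rmorphB, rmorphM, rmorphD) /=; ring.
Qed.

Lemma res12_tc A P : (size A <= 2)%N -> (size P <= 3)%N ->
  (res12 A P)%:~R =
    tc0 A ^+ 2 * tc2 P - tc0 A * tc1 A * tc1 P + tc1 A ^+ 2 * tc0 P.
Proof.
move=> sA sP.
have [-> -> _ _] := taylor_lin sA; have [-> -> -> _] := taylor_quad sP.
by rewrite /res12 /coefR !(rmorphB, rmorphM, rmorphD, rmorphXn) /=; ring.
Qed.

Lemma minor3_le (x1 x2 x3 y1 y2 y3 z1 z2 z3 x y z : R) :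
  `|x1| <= expR x -> `|x2| <= expR x -> `|x3| <= expR x ->
  `|y1| <= expR y -> `|y2| <= expR y -> `|y3| <= expR y ->
  `|z1| <= expR z -> `|z2| <= expR z -> `|z3| <= expR z ->
  `|minor3 x1 x2 x3 y1 y2 y3 z1 z2 z3| <= expR (x + y + z + 3).
Proof.
move=> hx1 hx2 hx3 hy1 hy2 hy3 hz1 hz2 hz3.
have m a b c d : `|a| <= expR y -> `|b| <= expR z -> `|c| <= expR y ->
    `|d| <= expR z -> `|a * b - c * d| <= expR (y + z + 1).
  by move=> *; apply: le_expRB; apply: le_expRM.
have t u a b c d : `|u| <= expR x -> `|a| <= expR y -> `|b| <= expR z ->
    `|c| <= expR y -> `|d| <= expR z ->
    `|u * (a * b - c * d)| <= expR (x + (y + z + 1)).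
  by move=> *; apply: le_expRM => //; apply: m.
rewrite /minor3; apply: le_expRW (_ : x + (y + z + 1) + 1 + 1 <= _); last by lra.
apply: le_expRD; first by apply: le_expRB; apply: t.
by apply: (@le_expRW _ _ (x + (y + z + 1))); [apply: t|lra].
Qed.

Lemma norm0_le_expR (e : R) : `|0 : R| <= expR e.
Proof. by rewrite normr0 expR_ge0. Qed.

Lemma wedge_tc_le P Q (u v a b e : R) :
  (height P)%:R <= expR u -> (height Q)%:R <= expR v ->
  `|tc0 P| <= expR a -> `|tc0 Q| <= expR b -> a + v <= e -> b + u <= e ->
  [/\ `|tc0 P * tc1 Q - tc1 P * tc0 Q| <= expR (kappa + e + 1),
      `|tc0 P * tc2 Q - tc2 P * tc0 Q| <= expR (kappa + e + 1) &
      `|tc1 P * tc2 Q - tc2 P * tc1 Q| <= expR (2 * kappa + u + v + 1)].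
Proof.
move=> hP hQ p0 q0 ave bue.
have [_ p1 p2 _] := taylor_le zeta hP; have [_ q1 q2 _] := taylor_le zeta hQ.
have l x y c d : `|x| <= expR c -> `|y| <= expR d -> c + d <= kappa + e ->
  `|x * y| <= expR (kappa + e).
  by move=> hx hy; apply: le_expRW; apply: le_expRM.
split.
- by apply: le_expRB; [apply: l p0 q1 _|apply: l p1 q0 _]; lra.
- by apply: le_expRB; [apply: l p0 q2 _|apply: l p2 q0 _]; lra.
- apply: le_expRB.
    by apply: le_expRW (le_expRM p1 q2) _; lra.
  by apply: le_expRW (le_expRM p2 q1) _; lra.
Qed.

Lemma res22_le P Q (u v a b e : R) : (size P <= 3)%N -> (size Q <= 3)%N ->
  (height P)%:R <= expR u -> (height Q)%:R <= expR v ->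
  `|tc0 P| <= expR a -> `|tc0 Q| <= expR b -> a + v <= e -> b + u <= e ->
  e <= u + v ->
  `|(res22 P Q)%:~R : R| <= expR (3 * kappa + e + u + v + 3).
Proof.
move=> sP sQ hP hQ p0 q0 ave bue euv.
have [w01 w02 w12] := wedge_tc_le hP hQ p0 q0 ave bue.
have k0 := taylor_const_ge0 zeta.
rewrite (res22_tc sP sQ) /disc22 expr2.
apply: le_expRW (_ : 3 * kappa + e + u + v + 2 + 1 <= _); last by lra.
apply: le_expRB.
  by apply: le_expRW (le_expRM w02 w02) _; lra.
by apply: le_expRW (le_expRM w01 w12) _; lra.
Qed.

(** The resultant is w02^2 - w01 w12. When w02^2 is tiny, the product has to account for a nonzero
    integer; as w01 is small too, w12 cannot be small. *)
Lemma res22_neq0_wedge P Q (u v a b e w : R) :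
  (size P <= 3)%N -> (size Q <= 3)%N -> res22 P Q != 0 ->
  (height P)%:R <= expR u -> (height Q)%:R <= expR v ->
  `|tc0 P| <= expR a -> `|tc0 Q| <= expR b -> a + v <= e -> b + u <= e ->
  `|(wedge P Q 1 2)%:~R : R| <= expR w ->
  2 * (kappa + e + 1) + 1 < 0 -> 0 <= kappa + e + 1 + w + 1.
Proof.
move=> sP sQ D0 hP hQ p0 q0 ave bue hw small.
have [w01 w02 _] := wedge_tc_le hP hQ p0 q0 ave bue.
rewrite leNgt; apply/negP => contra.
have /int_small_eq0 : `|(res22 P Q)%:~R : R| <=
    expR (Num.max (2 * (kappa + e + 1)) (kappa + e + 1 + w) + 1).
  rewrite (res22_tc sP sQ) /disc22 expr2; apply: le_expRB.
    by apply: le_expRW (le_expRM w02 w02) _; rewrite le_max; apply/orP; left; lra.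
  rewrite -(wedge12_tc sP sQ).
  by apply: le_expRW (le_expRM w01 hw) _; rewrite le_max; apply/orP; right.
move=> H; move: D0; rewrite H ?eqxx// -ltrBrDr gt_max.
by apply/andP; split; lra.
Qed.

(** In w02^2 - w01 w12, the hypothesis [small1] disposes of w02^2 and [small2] of the part of w01
    containing [tc0 Q]. What remains is [tc0 P * tc1 Q] times w12, and this bounds the derivative of
    [Q] at zeta from below. *)
Lemma res22_neq0_tc1 P Q (u v a b g : R) :
  (size P <= 3)%N -> (size Q <= 3)%N -> res22 P Q != 0 ->
  (height P)%:R <= expR u -> (height Q)%:R <= expR v ->
  `|tc0 P| <= expR a -> `|tc0 Q| <= expR b -> b + u <= a + v ->
  `|tc1 Q| <= expR g ->
  2 * (kappa + a + v + 1) + 1 < 0 -> 3 * kappa + b + 2 * u + v + 3 < 0 ->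
  0 <= 2 * kappa + a + g + u + v + 3.
Proof.
move=> sP sQ D0 hP hQ p0 q0 bue hg small1 small2.
have [w01 w02 w12] := wedge_tc_le hP hQ p0 q0 (lexx _) bue.
have [_ p1 _ _] := taylor_le zeta hP.
rewrite leNgt; apply/negP => contra.
pose E := Num.max (a + g) (kappa + u + b).
have h01 : `|tc0 P * tc1 Q - tc1 P * tc0 Q| <= expR (E + 1).
  apply: le_expRB.
    by apply: le_expRW (le_expRM p0 hg) _; rewrite le_max lexx.
  by apply: le_expRW (le_expRM p1 q0) _; rewrite le_max lexx orbT.
pose F := Num.max (2 * (kappa + a + v + 1)) (E + (2 * kappa + u + v + 2)).
have /int_small_eq0 : `|(res22 P Q)%:~R : R| <= expR (F + 1).
  rewrite (res22_tc sP sQ) /disc22 expr2; apply: le_expRB.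
    by apply: le_expRW (le_expRM w02 w02) _; rewrite le_max; apply/orP; left; lra.
  by apply: le_expRW (le_expRM h01 w12) _; rewrite le_max; apply/orP; right; lra.
move=> H; move: D0; rewrite H ?eqxx// -ltrBrDr gt_max; apply/andP; split; first by lra.
by rewrite -ltrBrDr gt_max; apply/andP; split; lra.
Qed.

Lemma det3_eq0 P Q S (u v w a b c e : R) :
  (size P <= 3)%N -> (size Q <= 3)%N -> (size S <= 3)%N ->
  (height P)%:R <= expR u -> (height Q)%:R <= expR v -> (height S)%:R <= expR w ->
  `|tc0 P| <= expR a -> `|tc0 Q| <= expR b -> `|tc0 S| <= expR c ->
  a + v + w <= e -> b + u + w <= e -> c + u + v <= e ->
  2 * kappa + e + 3 < 0 -> det3 P Q S = 0.
Proof.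
move=> sP sQ sS hP hQ hS p0 q0 s0 e1 e2 e3 small.
have [_ p1 p2 _] := taylor_le zeta hP; have [_ q1 q2 _] := taylor_le zeta hQ.
have [_ s1 s2 _] := taylor_le zeta hS.
apply: (@int_small_eq0 R _ (2 * kappa + e + 1 + 1 + 1)); last by lra.
have -> : (det3 P Q S)%:~R = tc0 P * (tc1 Q * tc2 S - tc2 Q * tc1 S)
    - tc0 Q * (tc1 P * tc2 S - tc2 P * tc1 S)
    + tc0 S * (tc1 P * tc2 Q - tc2 P * tc1 Q).
  by rewrite det3_tc// /minor3; ring.
have t x y1 y2 z1 z2 cx cy cz : `|x| <= expR cx ->
    `|y1| <= expR (kappa + cy) -> `|z2| <= expR (kappa + cz) ->
    `|y2| <= expR (kappa + cy) -> `|z1| <= expR (kappa + cz) ->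
    cx + cy + cz <= e ->
    `|x * (y1 * z2 - y2 * z1)| <= expR (2 * kappa + e + 1).
  move=> hx hy1 hz2 hy2 hz1 he.
  apply: (@le_expRW _ _ (cx + (kappa + cy + (kappa + cz) + 1))); last by lra.
  by apply: le_expRM => //; apply: le_expRB; apply: le_expRM.
apply: le_expRD.
  by apply: le_expRB; [apply: t p0 q1 s2 q2 s1 _|apply: t q0 p1 s2 p2 s1 _]; lra.
by apply: (@le_expRW _ _ (2 * kappa + e + 1)); [apply: t s0 p1 q2 p2 q1 _|]; lra.
Qed.

Lemma res12_eq0 A P (h u a c e : R) : (size A <= 2)%N -> (size P <= 3)%N ->
  (height A)%:R <= expR h -> (height P)%:R <= expR u ->
  `|tc0 A| <= expR a -> `|tc0 P| <= expR c -> a + h + u <= e -> 2 * h + c <= e ->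
  2 * kappa + e + 2 < 0 -> res12 A P = 0.
Proof.
move=> sA sP hA hP a0 p0 e1 e2 small.
have [A0 A1 _ _] := taylor_le zeta hA; have [_ p1 p2 _] := taylor_le zeta hP.
apply: (@int_small_eq0 R _ (2 * kappa + e + 1 + 1)); last by lra.
rewrite res12_tc// !expr2; apply: le_expRD; first apply: le_expRB.
- by apply: le_expRW (le_expRM (le_expRM a0 A0) p2) _; lra.
- by apply: le_expRW (le_expRM (le_expRM a0 A1) p1) _; lra.
- by apply: le_expRW (le_expRM (le_expRM A1 A1) p0) _; lra.
Qed.

End TaylorBounds.

(** * Sizes of the Cramer cofactors *)

Section SylvesterBounds.
Variables (R : realType) (zeta : R).
Implicit Types A B P Q S : {poly int}.

Local Notation cf := (@coefR R).
Local Notation tc0 := (taylor0 zeta).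
Local Notation tc1 := (taylor1 zeta).
Local Notation tc2 := (taylor2 zeta).
Local Notation tc3 := (@taylor3 R).
Local Notation kappa := (taylor_const zeta).

Lemma zeta_le : `|zeta| <= expR kappa.
Proof.
rewrite /taylor_const lnK; last first.
  by rewrite posrE mulr_gt0// exprn_gt0// ltr_pwDl.
have z0 : 0 <= `|zeta| := normr_ge0 _.
have := exprn_ge0 2 z0; have := exprn_ge0 3 z0; lra.
Qed.

Lemma lin_height_le B (e : R) : (size B <= 2)%N ->
  `|tc0 B| <= expR e -> `|tc1 B| <= expR e ->
  (height B)%:R <= expR (kappa + e + 1).
Proof.
move=> sB b0 b1; have k0 := taylor_const_ge0 zeta.
have [i hi] := height_ex B.
have -> : (height B)%:R = `|cf B i| by rewrite hi /coefR -intr_norm -abszE -pmulrn.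
have [E0 E1 _ _] := taylor_lin zeta sB.
case: i {hi} => [|[|i]].
- have -> : cf B 0 = tc0 B - tc1 B * zeta by rewrite E0 E1; ring.
  apply: le_expRB; first by apply: le_expRW b0 _; lra.
  by apply: le_expRW (le_expRM b1 zeta_le) _; lra.
- by rewrite -E1; apply: le_expRW b1 _; lra.
- by rewrite (coefR_eq0 _ sB)// norm0_le_expR.
Qed.

(** The cofactors are linear in [S], so the factor [res22 P Q] in front of [S] cancels against the
    determinant of the system. *)
Lemma sylvester_tc P Q S A B :
  (size P <= 3)%N -> (size Q <= 3)%N -> (size A <= 2)%N -> (size B <= 2)%N ->
  res22 P Q != 0 -> res22 P Q *: S = A * P + B * Q ->
  tc1 B = cramer1 (tc0 P) (tc1 P) (tc2 P) (tc0 Q) (tc1 Q) (tc2 Q)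
            (tc0 S) (tc1 S) (tc2 S) (tc3 S) /\
  tc0 B = cramer0 (tc0 P) (tc1 P) (tc2 P) (tc0 Q) (tc1 Q) (tc2 Q)
            (tc0 S) (tc1 S) (tc2 S) (tc3 S).
Proof.
move=> sP sQ sA sB D0 E.
have D0R : (res22 P Q)%:~R != 0 :> R by rewrite intr_eq0.
have [a0 a1 a2 a3] := taylor_mul zeta sA sP; have [b0 b1 b2 b3] := taylor_mul zeta sB sQ.
have [z0 z1 z2 z3] := taylorZ zeta (res22 P Q) S.
have [d0 d1 d2 d3] := taylorD zeta (A * P) (B * Q).
have [c1 c0] := cramerP (tc0 P) (tc1 P) (tc2 P) (tc0 Q) (tc1 Q) (tc2 Q)
  (tc0 A) (tc1 A) (tc0 B) (tc1 B).
move: c0 c1; rewrite -a0 -a1 -a2 -a3 -b0 -b1 -b2 -b3 -d0 -d1 -d2 -d3 -E z0 z1 z2 z3.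
rewrite -(res22_tc zeta sP sQ) => c0 c1.
split; apply: (mulfI D0R); rewrite -?c0 -?c1 /cramer0 /cramer1 /minor3; ring.
Qed.

(** Apart from the term with [tc0 S], every term of [cramer0] has two small factors: [tc0 P], and
    one of [tc0 P], [tc0 Q], [tc1 S]. This is what makes the bound for the value sharper than the
    one for the height in [sylvester_height_le], where one small factor is used. *)
Lemma sylvester_tc0_le P Q S A B (u v h a b s t e : R) :
  (size P <= 3)%N -> (size Q <= 3)%N -> (size A <= 2)%N -> (size B <= 2)%N ->
  res22 P Q != 0 -> res22 P Q *: S = A * P + B * Q ->
  (height P)%:R <= expR u -> (height Q)%:R <= expR v -> (height S)%:R <= expR h ->
  `|tc0 P| <= expR a -> `|tc0 Q| <= expR b -> `|tc0 S| <= expR s ->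
  `|tc1 S| <= expR t ->
  s + 2 * u + v <= e -> 2 * a + h + v <= e -> a + u + v + t <= e ->
  a + b + u + h <= e ->
  `|tc0 B| <= expR (3 * kappa + e + 5).
Proof.
move=> sP sQ sA sB D0 E hP hQ hS p0 q0 s0 s1 e1 e2 e3 e4.
have k0 := taylor_const_ge0 zeta.
have [_ ->] := sylvester_tc sP sQ sA sB D0 E.
have [p0' p1 p2 _] := taylor_le zeta hP; have [q0' q1 q2 _] := taylor_le zeta hQ.
have [_ _ s2 s3] := taylor_le zeta hS.
rewrite /cramer0; apply: (@le_expRW _ _ (3 * kappa + e + 4 + 1)); last by lra.
apply: le_expRD; last first.
  have m := minor3_le p1 p2 (norm0_le_expR _) p0' p1 p2 q0' q1 q2.
  by apply: le_expRW (le_expRM s0 m) _; lra.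
set x := tc0 P; set F := 2 * kappa + e - a.
have -> : minor3 x (tc1 P) (tc2 P) (tc1 S) (tc2 S) (tc3 S) (tc0 Q) (tc1 Q) (tc2 Q)
  = (x * (tc2 S * tc2 Q) - x * (tc3 S * tc1 Q))
    - (tc1 P * (tc1 S * tc2 Q) - tc1 P * (tc3 S * tc0 Q))
    + (tc2 P * (tc1 S * tc1 Q) - tc2 P * (tc2 S * tc0 Q)).
  by rewrite /minor3; ring.
have t3 y1 y2 y3 c1 c2 c3 : `|y1| <= expR c1 -> `|y2| <= expR c2 ->
    `|y3| <= expR c3 -> c1 + (c2 + c3) <= F -> `|y1 * (y2 * y3)| <= expR F.
  by move=> *; apply: le_expRW (le_expRM _ (le_expRM _ _)) _; eassumption.
have m1 : `|x * (tc2 S * tc2 Q) - x * (tc3 S * tc1 Q)| <= expR (F + 1).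
  by apply: le_expRB; [apply: t3 p0 s2 q2 _|apply: t3 p0 s3 q1 _]; rewrite /F; lra.
have m2 : `|tc1 P * (tc1 S * tc2 Q) - tc1 P * (tc3 S * tc0 Q)| <= expR (F + 1).
  by apply: le_expRB; [apply: t3 p1 s1 q2 _|apply: t3 p1 s3 q0 _]; rewrite /F; lra.
have m3 : `|tc2 P * (tc1 S * tc1 Q) - tc2 P * (tc2 S * tc0 Q)| <= expR (F + 1).
  by apply: le_expRB; [apply: t3 p2 s1 q1 _|apply: t3 p2 s2 q0 _]; rewrite /F; lra.
have m4 := le_expRD (le_expRB m1 m2) (le_expRW m3 (_ : F + 1 <= F + 1 + 1)).
apply: le_expRW (le_expRM p0 (m4 _)) _; rewrite /F; lra.
Qed.

Lemma sylvester_height_le P Q S A B (u v h a b s e : R) :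
  (size P <= 3)%N -> (size Q <= 3)%N -> (size A <= 2)%N -> (size B <= 2)%N ->
  res22 P Q != 0 -> res22 P Q *: S = A * P + B * Q ->
  (height P)%:R <= expR u -> (height Q)%:R <= expR v -> (height S)%:R <= expR h ->
  `|tc0 P| <= expR a -> `|tc0 Q| <= expR b -> `|tc0 S| <= expR s ->
  s + 2 * u + v <= e -> a + u + v + h <= e -> b + 2 * u + h <= e ->
  (height B)%:R <= expR (4 * kappa + e + 6).
Proof.
move=> sP sQ sA sB D0 E hP hQ hS p0 q0 s0 e1 e2 e3.
have k0 := taylor_const_ge0 zeta.
have [E1 E0] := sylvester_tc sP sQ sA sB D0 E.
have [p0' p1 p2 _] := taylor_le zeta hP; have [q0' q1 q2 _] := taylor_le zeta hQ.
have [_ s1 s2 s3] := taylor_le zeta hS.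
have n0 (x : R) := norm0_le_expR x.
have b1 : `|tc1 B| <= expR (3 * kappa + e + 5).
  rewrite E1 /cramer1; apply: (@le_expRW _ _ (3 * kappa + e + 3 + 1 + 1)); last by lra.
  have m1 := minor3_le p0' p1 p2 q1 q2 (n0 _) s1 s2 s3.
  have m2 := minor3_le p1 p2 (n0 _) p0' p1 p2 s1 s2 s3.
  have m3 := minor3_le p1 p2 (n0 _) p0' p1 p2 q1 q2 (n0 _).
  apply: le_expRB; first apply: le_expRD.
  - by apply: le_expRW (le_expRM p0 m1) _; lra.
  - by apply: le_expRW (le_expRM q0 m2) _; lra.
  - by apply: le_expRW (le_expRM s0 m3) _; lra.
have b0 : `|tc0 B| <= expR (3 * kappa + e + 5).
  rewrite E0 /cramer0; apply: (@le_expRW _ _ (3 * kappa + e + 4 + 1)); last by lra.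
  have m1 := minor3_le p0' p1 p2 s1 s2 s3 q0' q1 q2.
  have m2 := minor3_le p1 p2 (n0 _) p0' p1 p2 q0' q1 q2.
  apply: le_expRD; first by apply: le_expRW (le_expRM p0 m1) _; lra.
  by apply: le_expRW (le_expRM s0 m2) _; lra.
by apply: le_trans (lin_height_le sB b0 b1) _; rewrite ler_expR; lra.
Qed.

Lemma height_mul_lin A P : (size A <= 2)%N -> (size P <= 3)%N ->
  (height A * height P <= 3 * height (A * P))%N.
Proof.
move=> sA sP.
have [c0 c1 c2 c3] := coef_mul_lin sA sP.
set H := height (A * P).
have hH i : `|(A * P)`_i| <= H%:Z by rewrite -abszE lez_nat coef_le_height.
(* Division from the top coefficient down, in the case where the leading coefficient of the linear
   factor dominates; each step adds one [H]. The other case is the same for the reversed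
   polynomials. *)
have key (a0 a1 p0 p1 p2 : int) : `|a0| <= `|a1| -> `|a1 * p2| <= H%:Z ->
    `|a0 * p2 + a1 * p1| <= H%:Z -> `|a0 * p1 + a1 * p0| <= H%:Z ->
    [/\ `|a1 * p0| <= (3 * H)%N%:Z, `|a1 * p1| <= (3 * H)%N%:Z
      & `|a1 * p2| <= (3 * H)%N%:Z].
  move=> le01 h2 h1 h0.
  have k1 : `|a1 * p1| <= 2 * H%:Z.
    have := ler_normB (a0 * p2 + a1 * p1) (a0 * p2).
    have -> : a0 * p2 + a1 * p1 - a0 * p2 = a1 * p1 by ring.
    have : `|a0 * p2| <= `|a1 * p2| by rewrite !normrM ler_wpM2r.
    by lia.
  have k0 : `|a1 * p0| <= 3 * H%:Z.
    have := ler_normB (a0 * p1 + a1 * p0) (a0 * p1).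
    have -> : a0 * p1 + a1 * p0 - a0 * p1 = a1 * p0 by ring.
    have : `|a0 * p1| <= `|a1 * p1| by rewrite !normrM ler_wpM2r.
    by lia.
  by split; lia.
have [i hi] := height_ex A; have [j hj] := height_ex P.
have [m hm [E0 E1 E2]] : exists2 m : int, (height A <= absz m)%N &
    [/\ `|m * P`_0| <= (3 * H)%N%:Z, `|m * P`_1| <= (3 * H)%N%:Z
      & `|m * P`_2| <= (3 * H)%N%:Z].
  have hA : (height A <= maxn (absz (A`_0)%R) (absz (A`_1)%R))%N.
    apply/height_leP => -[|[|k]]; rewrite ?leq_maxl ?leq_maxr//.
    by rewrite nth_default// (leq_trans sA).
  case: (lerP `|A`_0| `|A`_1|) => le01.
    exists A`_1; first by lia.
    apply: (key A`_0) => //; first by rewrite -c3.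
      by rewrite -c2.
    by rewrite -c1.
  exists A`_0; first by lia.
  have [||||h0 h1 h2] := key A`_1 A`_0 P`_2 P`_1 P`_0 => //.
  - exact: ltW.
  - by rewrite -c0.
  - by rewrite addrC -c1.
  - by rewrite addrC -c2.
rewrite (leq_trans (leq_mul hm (leqnn _)))// hj -abszM -lez_nat abszE.
case: j {hj} => [|[|[|j]]]//.
by rewrite nth_default ?(leq_trans sP)// mulr0.
Qed.

End SylvesterBounds.

(** * Minimal quadratic polynomials *)

Section LogSizes.
Variables (R : realType) (zeta : R).
Implicit Types A B P Q S : {poly int}.

Local Notation tc0 := (taylor0 zeta).

Definition lnh P : R := ln (height P)%:R.
Definition lnv P : R := ln `|tc0 P|.

Lemma evalZ_neq0 P : transcendental zeta -> P != 0 -> evalZ P zeta != 0.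
Proof.
move=> tr P0; apply/eqP => E; apply: tr; exists (map_poly intr P).
  by rewrite map_poly_eq0_id0 ?intr_eq0 ?lead_coef_eq0.
rewrite /root -map_poly_comp (_ : map_poly _ P = map_poly intr P) ?[_.[_]]E//.
by apply: eq_map_poly => z /=; rewrite ratr_int.
Qed.

Lemma tc0_neq0 P : transcendental zeta -> (size P <= 4)%N -> P != 0 -> tc0 P != 0.
Proof. by move=> tr s P0; rewrite -evalZ_tc0// evalZ_neq0. Qed.

Lemma lnhK P : P != 0 -> expR (lnh P) = (height P)%:R.
Proof. by move=> P0; rewrite lnK// posrE ltr0n height_gt0. Qed.

Lemma lnh_ge0 P : P != 0 -> 0 <= lnh P.
Proof. by move=> P0; rewrite ln_ge0// ler1n height_gt0. Qed.

Lemma lnvK P : transcendental zeta -> (size P <= 4)%N -> P != 0 ->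
  expR (lnv P) = `|tc0 P|.
Proof. by move=> tr s P0; rewrite expR_ln_norm// tc0_neq0. Qed.

Lemma finite_height d n :
  finite_set [set P : {poly int} | (size P <= d)%N /\ (height P <= n)%N].
Proof.
pose F (f : {ffun 'I_d -> 'I_(2 * n).+1}) : {poly int} :=
  \poly_(i < d) (if insub i is Some j then (f j : nat)%:Z - n%:Z else 0).
apply: (@sub_finite_set _ _ (F @` setT)); last first.
  by apply: finite_image; apply: finite_finset.
move=> P /= [sP hP].
exists [ffun j : 'I_d => inord (absz (P`_j + n%:Z))]; first by [].
apply/polyP => i; rewrite coef_poly; case: ltnP => hi; last first.
  by rewrite nth_default// (leq_trans sP).
have {hP} /height_leP /(_ i) hPi := hP.
have hPn : `|P`_i| <= n%:Z by rewrite -abszE lez_nat.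
have [lo hi'] := andP (etrans (esym (ler_norml _ _)) hPn).
have ge0 : 0 <= P`_i + n%:Z by rewrite -lerBlDr sub0r.
rewrite insubT ffunE /= inordK ?gez0_abs ?addrK//.
rewrite ltnS -lez_nat gez0_abs//.
by rewrite mul2n -addnn PoszD lerD2r.
Qed.

Lemma seq_minimum (T : eqType) (f : T -> R) (s : seq T) x : x \in s ->
  exists2 y, y \in s & forall z, z \in s -> f y <= f z.
Proof.
elim: s x => //= a s IH x _; case: s IH => [|b s] IH.
  by exists a; rewrite ?mem_head// => z; rewrite inE => /eqP ->.
have [y ys hy] := IH b (mem_head _ _).
case: (leP (f a) (f y)) => h.
  exists a; first exact: mem_head.
  by move=> z; rewrite inE => /orP[/eqP ->//|/hy]; apply: le_trans.
exists y; first by rewrite inE ys orbT.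
by move=> z; rewrite inE => /orP[/eqP ->|/hy]//; apply: ltW.
Qed.

Lemma exists_minimizer n : (0 < n)%N -> exists P : {poly int},
  [/\ P != 0, (size P <= 3)%N, (height P <= n)%N &
    forall S : {poly int}, S != 0 -> (size S <= 3)%N -> (height S <= n)%N ->
      `|tc0 P| <= `|tc0 S|].
Proof.
move=> n0.
have /finite_seqP[s Es] := finite_setIl [set P : {poly int} | P != 0] (finite_height 3 n).
have mem P : P \in s = [&& (size P <= 3)%N, (height P <= n)%N & P != 0].
  apply/idP/idP => [Ps|/and3P[h1 h2 h3]].
    have : [set` s] P by [].
    by rewrite -Es /= => -[[-> ->] ->].
  have : [set` s] P by rewrite -Es.
  by [].
have s1 : (1 : {poly int}) \in s.
  rewrite mem size_poly1 oner_neq0 andbT /=; apply/height_leP => i.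
  by rewrite coef1; case: (i == 0).
have [P + hP] := seq_minimum (fun P => `|tc0 P|) s1.
rewrite mem => /and3P[h1 h2 h3]; exists P; split=> // S S0 sS hS.
by apply: hP; rewrite mem sS hS.
Qed.

(** The minimal polynomials in the sense of Davenport and Schmidt: consecutive records of the value
    at zeta, ordered by height. *)
Definition minimal_seq (P : nat -> {poly int}) : Prop := forall i,
  [/\ P i != 0, (size (P i) <= 3)%N, (height (P i) < height (P i.+1))%N,
      `|tc0 (P i.+1)| < `|tc0 (P i)| &
      forall S : {poly int}, S != 0 -> (size S <= 3)%N ->
        (height S < height (P i.+1))%N -> `|tc0 (P i)| <= `|tc0 S|].

Lemma exists_minimal_seq : transcendental zeta ->
  (forall e : R, 0 < e -> exists S : {poly int},
     [/\ S != 0, (size S <= 3)%N & `|tc0 S| < e]) ->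
  exists P : nat -> {poly int}, minimal_seq P.
Proof.
move=> tr small.
pose good (P : {poly int}) := [/\ P != 0, (size P <= 3)%N &
  forall S : {poly int}, S != 0 -> (size S <= 3)%N ->
    (height S <= height P)%N -> `|tc0 P| <= `|tc0 S|].
have next P : good P -> exists P', [/\ good P', (height P < height P')%N,
    `|tc0 P'| < `|tc0 P| & forall S : {poly int}, S != 0 -> (size S <= 3)%N ->
        (height S < height P')%N -> `|tc0 P| <= `|tc0 S|].
  move=> [P0 sP minP].
  pose better n := `[< exists S : {poly int},
    [/\ S != 0, (size S <= 3)%N, height S = n & `|tc0 S| < `|tc0 P|] >].
  have ex : exists n, better n.
    have [|S [S0 sS hS]] := small `|tc0 P|.
      by rewrite normr_gt0 tc0_neq0// (leq_trans sP).
    by exists (height S); apply/asboolP; exists S.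
  (* [n] is the least height at which the record is broken. The next term is the best polynomial up
     to that height, not just any polynomial that breaks the record. *)
  case: (ex_minnP ex) => n /asboolP[S [S0 sS hSn hS]] min_n.
  have n0 : (0 < n)%N by rewrite -hSn height_gt0.
  have [P' [P'0 sP' hP' minP']] := exists_minimizer n0.
  have ltP' : `|tc0 P'| < `|tc0 P|.
    by apply: le_lt_trans hS; apply: minP' => //; rewrite hSn.
  have EP' : height P' = n.
    apply/eqP; rewrite eqn_leq hP'; apply: min_n; apply/asboolP.
    by exists P'.
  exists P'; split=> //; first by split=> // T T0 sT; rewrite EP'; apply: minP'.
    rewrite ltnNge; apply/negP => le; have := minP _ P'0 sP' le.
    by rewrite leNgt ltP'.
  move=> T T0 sT; rewrite EP' => ltT; rewrite leNgt; apply/negP => lt.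
  suff : (n <= height T)%N by rewrite leqNgt ltT.
  by apply: min_n; apply/asboolP; exists T.
have [P0 [h1 h2 h3 h4]] := exists_minimizer (ltn0Sn 0).
have gP0 : good P0 by split=> // S S0 sS hS; apply: h4 => //; apply: leq_trans hS h3.
pose T := {P : {poly int} | good P}.
have nextT (x : T) : exists y : T, [/\ (height (sval x) < height (sval y))%N,
    `|tc0 (sval y)| < `|tc0 (sval x)| & forall S : {poly int}, S != 0 ->
     (size S <= 3)%N -> (height S < height (sval y))%N -> `|tc0 (sval x)| <= `|tc0 S|].
  have [P' [gP' ? ? ?]] := next _ (svalP x).
  by exists (exist _ P' gP').
have [f hf] := choice nextT.
exists (fun i => sval (iter i f (exist _ P0 gP0 : T))) => i /=.
have [? ? _] := svalP (iter i f (exist _ P0 gP0 : T)).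
by have [] := hf (iter i f (exist _ P0 gP0 : T)).
Qed.

Lemma minimal_seq_height (P : nat -> {poly int}) : minimal_seq P -> forall i, (i < height (P i))%N.
Proof.
move=> mP; elim=> [|i IH]; first by have [P0 _ _ _ _] := mP 0; rewrite height_gt0.
by have [_ _ h _ _] := mP i; apply: leq_trans h.
Qed.

Lemma minimal_seq_lnh (P : nat -> {poly int}) (M : R) : minimal_seq P ->
  exists N, forall i, (N <= i)%N -> M <= lnh (P i).
Proof.
move=> mP; exists (Num.bound (expR M)) => i hi.
have [P0 _ _ _ _] := mP i.
rewrite -ler_expR lnhK//; apply: (@le_trans _ _ (Num.bound (expR M))%:R).
  by apply/ltW/archi_boundP; rewrite expR_ge0.
by rewrite ler_nat (leq_trans hi)// ltnW// minimal_seq_height.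
Qed.

(* x is the logarithm of the height bound. *)
Definition uniform_exponent (eta : R) := exists M : R, forall x : R, M < x ->
  exists P : {poly int}, [/\ P != 0, (size P <= 3)%N,
    (height P)%:R <= expR x & `|tc0 P| <= expR (- eta * x)].

Lemma what2_uniform_exponent (w eta : R) : what2 zeta = w%:E -> eta < w ->
  uniform_exponent eta.
Proof.
move=> hw hlt.
have : (eta%:E < what2 zeta)%E by rewrite hw lte_fin.
move=> /ereal_sup_gt[_ [eta' [M [_ hM]] <-]]; rewrite lte_fin => lt.
exists (Num.max 0 M) => x; rewrite gt_max => /andP[x0 Mx].
have [|P [sP hP /andP[p0 p1]]] := hM (expR x).
  by apply: (lt_trans Mx); apply: lt_le_trans (expR_ge1Dx x); rewrite ltrDr.
have P0 : P != 0.
  apply: contraTneq p0 => ->; rewrite /evalZ map_polyC.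
  by rewrite hornerC normr0 ltxx.
exists P; split=> //; rewrite -evalZ_tc0 ?(leq_trans sP)//.
apply: (le_trans p1); rewrite -expRM ler_expR mulrC ler_pM2r//.
by rewrite lerN2 ltW.
Qed.

Lemma uniform_exponent_small eta : 0 < eta -> uniform_exponent eta ->
  forall e : R, 0 < e -> exists S : {poly int},
     [/\ S != 0, (size S <= 3)%N & `|tc0 S| < e].
Proof.
move=> eta0 [M hM] e e0.
pose x := Num.max (M + 1) (- (ln e - 1) / eta).
have [|P [P0 sP _ hP]] := hM x.
  by rewrite lt_max ltrDl ltr01.
exists P; split=> //; apply: (le_lt_trans hP).
rewrite -[ltRHS]lnK ?posrE// ltr_expR.
have : - (ln e - 1) / eta <= x by rewrite le_max lexx orbT.
by rewrite ler_pdivrMr// mulrC => h; lra.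
Qed.

Lemma minimal_seq_uniform (P : nat -> {poly int}) eta d : minimal_seq P -> transcendental zeta ->
  0 < eta -> 0 < d -> uniform_exponent eta ->
  exists N, forall i, (N <= i)%N -> lnv (P i) <= - (eta - d) * lnh (P i.+1).
Proof.
move=> mP tr eta0 d0 [M hM].
have [N hN] := minimal_seq_lnh (Num.max (M + 2) (eta / d)) mP.
exists N => i hi; have [Pi0 sPi ltH _ minP] := mP i.
have [Pj0 _ _ _ _] := mP i.+1.
have := hN _ (leq_trans hi (leqnSn i)); rewrite ge_max => /andP[h1].
rewrite ler_pdivrMr// => h2.
(* One less than [lnh (P i.+1)], so that [S] has height strictly below that of [P i.+1] and
   minimality of [P i] applies. The loss [eta] is absorbed by [d * lnh (P i.+1)]. *)
have [|S [S0 sS hS vS]] := hM (lnh (P i.+1) - 1); first by lra.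
have lt : (height S < height (P i.+1))%N.
  rewrite -(ltr_nat R); apply: (le_lt_trans hS); rewrite -lnhK// ltr_expR; lra.
have := le_trans (minP S S0 sS lt) vS.
rewrite -lnvK ?(leq_trans sPi)// ler_expR => h; nra.
Qed.

End LogSizes.

(** * Vanishing resultants and common linear factors *)

Section CommonFactors.
Implicit Types A B P Q S : {poly int}.

(** [V] is the quotient in pseudo-division of [P] by [A], with remainder [res12 A P]; Gauss's lemma
    for the primitive [A] makes the division integral. *)
Lemma res12_dvd A P : size A = 2%N -> (size P <= 3)%N -> zprimitive A = A ->
  res12 A P = 0 -> exists B : {poly int}, P = A * B.
Proof.
move=> sA sP prA r0.
have A1 : A`_1 != 0 by have := lead_coef_eq0 A; rewrite lead_coefE sA /= -size_poly_eq0 sA => ->.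
pose V := (A`_1 * P`_1 - A`_0 * P`_2)%:P + (A`_1 * P`_2)%:P * 'X.
have E : (A`_1 ^+ 2) *: P = A * V.
  have -> : A * V = A * V + (res12 A P)%:P by rewrite r0 addr0.
  rewrite -mul_polyC [in RHS](poly_linE (eq_leq sA)) [in LHS](poly_quadE sP) /V /res12.
  by rewrite !coef_lin; ring.
have : A %| P.
  by rewrite -(dvdpZr _ _ (expf_neq0 2 A1)) E dvdp_mulr.
by move/dvdpP_int => [r]; rewrite prA; exists r.
Qed.

Lemma res22_common_factor P Q : (size P <= 3)%N -> (size Q <= 3)%N ->
  res22 P Q = 0 -> wedge P Q 1 2 != 0 ->
  exists A B C : {poly int}, [/\ size A = 2%N, zprimitive A = A, P = A * B & Q = A * C].
Proof.
move=> sP sQ r0 w0.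
(* The combination of [P] and [Q] in which T^2 cancels. Every common factor divides it, so it is the
   common factor up to a constant. *)
pose U := (wedge P Q 0 2)%:P + (wedge P Q 1 2)%:P * 'X.
have sU : size U = 2%N.
  apply/eqP; rewrite eqn_leq size_lin ltnNge; apply/negP => /size1_polyC E.
  by move: w0; rewrite -(coef_lin (wedge P Q 0 2) (wedge P Q 1 2)).2 -/U E coefC.
have key S : (size S <= 3)%N ->
    S`_0 * wedge P Q 1 2 - S`_1 * wedge P Q 0 2 + S`_2 * wedge P Q 0 1 = 0 ->
    {r | S = zprimitive U * r}.
  move=> sS plu; apply: dvdpP_int.
  pose V := (S`_1 * wedge P Q 1 2 - S`_2 * wedge P Q 0 2)%:P
            + (S`_2 * wedge P Q 1 2)%:P * 'X.
  have E : (wedge P Q 1 2 ^+ 2) *: S = U * V.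
    have -> : U * V = U * V + (S`_2 * res22 P Q + wedge P Q 1 2 *
      (S`_0 * wedge P Q 1 2 - S`_1 * wedge P Q 0 2 + S`_2 * wedge P Q 0 1))%:P.
      by rewrite r0 plu !mulr0 !addr0.
    by rewrite -mul_polyC [in LHS](poly_quadE sS) /V /U /res22; ring.
  by rewrite -(dvdpZr _ _ (expf_neq0 2 w0)) E dvdp_mulr.
have [B EB] : {r | P = zprimitive U * r} by apply: key => //; rewrite /wedge; ring.
have [C EC] : {r | Q = zprimitive U * r} by apply: key => //; rewrite /wedge; ring.
exists (zprimitive U), B, C; split=> //; last exact: zprimitive_id.
by rewrite size_zprimitive.
Qed.

Lemma size_cofactor A B n : size A = 2%N -> A * B != 0 -> (size (A * B)%R <= n.+1)%N ->
  B != 0 /\ (size B <= n)%N.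
Proof.
move=> sA AB0; have [A0 B0] : A != 0 /\ B != 0.
  by move: AB0; rewrite mulf_eq0 negb_or => /andP.
by rewrite size_mul// sA /= => h.
Qed.

End CommonFactors.

Section MinimalSequence.
Variables (R : realType) (zeta : R).
Hypothesis tr : transcendental zeta.
Variable P : nat -> {poly int}.
Hypothesis mP : minimal_seq zeta P.

Local Notation cf := (@coefR R).
Local Notation tc0 := (taylor0 zeta).
Local Notation tc1 := (taylor1 zeta).
Local Notation kappa := (taylor_const zeta).
Local Notation lnv := (lnv zeta).
Local Notation lnh := (@lnh R).

Lemma minimal_seq_neq0 i : P i != 0. Proof. by case: (mP i). Qed.
Lemma minimal_seq_size i : (size (P i) <= 3)%N. Proof. by case: (mP i). Qed.

Lemma height_lnh (S : {poly int}) : S != 0 -> (height S)%:R <= expR (lnh S).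
Proof. by move=> S0; rewrite lnhK. Qed.

Lemma minimal_seq_height_le i : (height (P i))%:R <= expR (lnh (P i)).
Proof. by rewrite lnhK ?minimal_seq_neq0. Qed.

Lemma tc0_le (S : {poly int}) : (size S <= 4)%N -> S != 0 ->
  `|tc0 S| <= expR (lnv S).
Proof. by move=> sS S0; rewrite lnvK. Qed.

Lemma minimal_seq_val_le i : `|tc0 (P i)| <= expR (lnv (P i)).
Proof. by rewrite tc0_le ?minimal_seq_neq0// (leq_trans (minimal_seq_size i)). Qed.

Lemma minimal_seq_lnh_lt i : lnh (P i) < lnh (P i.+1).
Proof.
have [_ _ h _ _] := mP i.
by rewrite ltr_ln ?posrE ?ltr0n ?height_gt0 ?minimal_seq_neq0// ltr_nat.
Qed.

Lemma minimal_seq_lnh_le i j : (i <= j)%N -> lnh (P i) <= lnh (P j).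
Proof.
move=> ij; rewrite -(subnKC ij); elim: (j - i)%N => [|k IH]; first by rewrite addn0.
by rewrite addnS (le_trans IH)// ltW// minimal_seq_lnh_lt.
Qed.

Lemma minimal_seq_lnv_lt i : lnv (P i.+1) < lnv (P i).
Proof.
have [_ _ _ h _] := mP i.
have p j : 0 < `|tc0 (P j)|.
  by rewrite normr_gt0 tc0_neq0 ?minimal_seq_neq0// (leq_trans (minimal_seq_size j)).
by rewrite ltr_ln ?posrE.
Qed.

Lemma lnh_mul (A B : {poly int}) : (size A <= 2)%N -> (size B <= 3)%N ->
  A * B != 0 -> lnh A + lnh B <= lnh (A * B) + 2.
Proof.
move=> sA sB AB0; have [A0 B0] : A != 0 /\ B != 0.
  by move: AB0; rewrite mulf_eq0 negb_or => /andP.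
have := height_mul_lin sA sB; rewrite -(ler_nat R) !natrM => h.
rewrite -ler_expR (expRD (lnh A)) (expRD (lnh (A * B))) !lnhK//.
apply: (le_trans h); rewrite mulrC ler_wpM2l//.
by have := expR_ge1Dx (2 : R); lra.
Qed.

Lemma lnv_mul (A B : {poly int}) : (size A <= 2)%N -> (size B <= 3)%N ->
  A * B != 0 -> lnv (A * B) = lnv A + lnv B.
Proof.
move=> sA sB AB0; have [A0 B0] : A != 0 /\ B != 0.
  by move: AB0; rewrite mulf_eq0 negb_or => /andP.
rewrite {1}/lnv; have [-> _ _ _] := taylor_mul zeta sA sB.
rewrite normrM lnM// posrE normr_gt0 tc0_neq0//.
  by rewrite (leq_trans sA).
by rewrite (leq_trans sB).
Qed.

Lemma lnv_le_lnh (A : {poly int}) : (size A <= 4)%N -> A != 0 ->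
  lnv A <= kappa + lnh A.
Proof.
move=> sA A0; rewrite -ler_expR lnvK//.
by have [|h _ _ _] := @taylor_le R zeta A (lnh A) _; rewrite ?lnhK.
Qed.

(* A quadratic polynomial proportional to P_i with smaller value at zeta has
   smaller height. *)
Lemma minimal_seq_wedge_neq0 i : ~ [/\ wedge (P i) (P i.+1) 0 1 = 0,
  wedge (P i) (P i.+1) 0 2 = 0 & wedge (P i) (P i.+1) 1 2 = 0].
Proof.
move=> [w01 w02 w12].
have [_ _ ltH ltV _] := mP i.
have prop j : tc0 (P i) * cf (P i.+1) j = tc0 (P i.+1) * cf (P i) j.
  have toR k l : wedge (P i) (P i.+1) k l = 0 ->
      cf (P i) k * cf (P i.+1) l = cf (P i) l * cf (P i.+1) k.
    by move=> /eqP; rewrite subr_eq0 /coefR -!intrM => /eqP ->.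
  have e01 := toR _ _ w01; have e02 := toR _ _ w02; have e12 := toR _ _ w12.
  have [-> _ _ _] := taylor_quad zeta (minimal_seq_size i).
  have [-> _ _ _] := taylor_quad zeta (minimal_seq_size i.+1).
  case: j => [|[|[|j]]]; last by rewrite !(@coefR_eq0 R _ 3 j.+3) ?minimal_seq_size// !mulr0.
  - have := congr1 ( *%R zeta) e01; have := congr1 ( *%R (zeta ^+ 2)) e02; lra.
  - have := congr1 ( *%R (zeta ^+ 2)) e12; lra.
  - have := congr1 ( *%R zeta) e12; lra.
have [j hj] := height_ex (P i.+1).
have : `|tc0 (P i)| * (height (P i.+1))%:R <= `|tc0 (P i.+1)| * (height (P i))%:R.
  have -> : (height (P i.+1))%:R = `|cf (P i.+1) j|.
    by rewrite hj /coefR -intr_norm -abszE -pmulrn.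
  by rewrite -normrM prop normrM ler_wpM2l// coefR_le.
apply/negP; rewrite -ltNge; apply: ltr_pM => //; rewrite ?normr_ge0//.
by rewrite ltr_nat.
Qed.

(** A common linear factor [A] of P_i and P_(i+1) would be so small at zeta that it would divide all
    P_n with N <= n <= i. Dividing the fixed P_N, it has a value bounded below independently of i,
    which fails for large i. The descent needs an exponent above 2, and 5/2 lies between 2 and
    g^2. *)
Lemma minimal_seq_coprime : (exists N, forall i, (N <= i)%N ->
    lnv (P i) <= - (5 / 2) * lnh (P i.+1)) ->
  exists N, forall i, (N <= i)%N -> res22 (P i) (P i.+1) != 0.
Proof.
move=> [N1 hN1].
have k0 := taylor_const_ge0 zeta.
have [N2 hN2] := minimal_seq_lnh (6 * kappa + 20) mP.
pose N := maxn N1 N2.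
have big i : (N <= i)%N -> 6 * kappa + 20 <= lnh (P i).
  by move=> h; apply: hN2; apply: leq_trans h; apply: leq_maxr.
have fast i : (N <= i)%N -> lnv (P i) <= - (5 / 2) * lnh (P i.+1).
  by move=> h; apply: hN1; apply: leq_trans h; apply: leq_maxl.
have [N3 hN3] := minimal_seq_lnh (2 * kappa + 6 + lnh (P N) - lnv (P N)) mP.
exists (maxn N N3) => i; rewrite geq_max => /andP[Ni N3i].
apply/eqP => r0.
have bi1 := big _ (leq_trans Ni (leqnSn i)).
have lt1 := minimal_seq_lnh_lt i; have lt2 := minimal_seq_lnv_lt i; have fi := fast _ Ni.
(* If this minor vanishes, then so does the one with indices 0, 2, as the resultant is 0. The third
   minor then equals its Taylor counterpart, which is below 1, and the two polynomials would be
   proportional. *)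
have W0 : wedge (P i) (P i.+1) 1 2 != 0.
  apply/eqP => w12; apply: (@minimal_seq_wedge_neq0 i).
  have w02 : wedge (P i) (P i.+1) 0 2 = 0.
    by move: r0; rewrite /res22 w12 mulr0 subr0 => /eqP; rewrite sqrf_eq0 => /eqP.
  split=> //.
  have [|h _ _] := wedge_tc_le (minimal_seq_height_le i) (minimal_seq_height_le i.+1)
    (minimal_seq_val_le i) (minimal_seq_val_le i.+1)
    (lexx _); first by lra.
  apply: (int_small_eq0 (_ : _ <= expR (kappa + (lnv (P i) + lnh (P i.+1)) + 1))); last by lra.
  suff -> : (wedge (P i) (P i.+1) 0 1)%:~R =
    tc0 (P i) * tc1 (P i.+1) - tc1 (P i) * tc0 (P i.+1) by [].
  have toR k l : wedge (P i) (P i.+1) k l = 0 ->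
      cf (P i) k * cf (P i.+1) l - cf (P i) l * cf (P i.+1) k = 0.
    by move=> E; rewrite /coefR -!intrM -intrB -/(wedge _ _ _ _) E.
  have e02 := toR _ _ w02; have e12 := toR _ _ w12.
  have [-> -> _ _] := taylor_quad zeta (minimal_seq_size i).
  have [-> -> _ _] := taylor_quad zeta (minimal_seq_size i.+1).
  rewrite /wedge intrB !intrM -/(cf _ _).
  have := congr1 ( *%R zeta) e02; have := congr1 ( *%R (zeta ^+ 2)) e12; lra.
have [A [B [C [sA prA EB EC]]]] :=
  res22_common_factor (minimal_seq_size i) (minimal_seq_size i.+1) r0 W0.
have sA2 := eq_leq sA.
have A0 : A != 0 by rewrite -size_poly_eq0 sA.
have factor n (B' : {poly int}) : P n = A * B' -> [/\ B' != 0, (size B' <= 2)%N,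
    lnv (P n) = lnv A + lnv B' & lnh A + lnh B' <= lnh (P n) + 2].
  move=> E; have [|||B0 sB] := @size_cofactor A B' 2; rewrite -?E ?minimal_seq_neq0 ?minimal_seq_size//.
  by split=> //; rewrite E ?lnv_mul ?lnh_mul -?E ?minimal_seq_neq0// (leq_trans sB).
have [B0 sB vB hB] := factor _ _ EB; have [C0 sC vC hC] := factor _ _ EC.
(* The cofactors [B] and [C] are not proportional, so [wedge B C 0 1] is a nonzero integer. It is
   bounded through the values of [B] and [C], that is, those of P_i and P_(i+1) divided by the value
   of [A]. *)
have tiny : lnv A + lnh A <= lnv (P i) + lnh (P i.+1) + kappa + 3.
  rewrite -subr_ge0 leNgt; apply/negP => contra.
  have : wedge B C 0 1 = 0.
    have [_ tB _ _] := @taylor_le R zeta B (lnh B) (height_lnh B0).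
    have [_ tC _ _] := @taylor_le R zeta C (lnh C) (height_lnh C0).
    apply: (int_small_eq0 (_ : _ <= expR (lnv (P i) + lnh (P i.+1) + kappa + 2 - lnv A - lnh A + 1))); last by lra.
    have -> : (wedge B C 0 1)%:~R = tc0 B * tc1 C - tc1 B * tc0 C.
      have [-> -> _ _] := taylor_lin zeta sB; have [-> -> _ _] := taylor_lin zeta sC.
      by rewrite /wedge intrB !intrM -/(cf _ _); ring.
    apply: le_expRB.
      apply: le_expRW (le_expRM (tc0_le (leq_trans sB _) B0) tC) _ => //; lra.
    apply: le_expRW (le_expRM tB (tc0_le (leq_trans sC _) C0)) _ => //; lra.
  move=> BC0; move: W0; have -> : wedge (P i) (P i.+1) 1 2 = A`_1 ^+ 2 * wedge B C 0 1.
    rewrite /wedge EB EC.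
    have [_ -> -> _] := coef_mul_lin sA2 (leq_trans sB (leqnSn 2)).
    have [_ -> -> _] := coef_mul_lin sA2 (leq_trans sC (leqnSn 2)).
    have -> : B`_2 = 0 by rewrite nth_default.
    have -> : C`_2 = 0 by rewrite nth_default.
    by ring.
  by rewrite BC0 mulr0 eqxx.
(* Since [A] divides P_(n+1), its height is at most about that of P_(n+1). Together with [tiny] this
   makes [res12 A (P n)] smaller than 1. *)
have descend k : (N + k <= i)%N -> exists B' : {poly int}, P (i - k) = A * B'.
  elim: k => [|k IH] Nk; first by exists B; rewrite subn0.
  have [|B' E] := IH; first by rewrite (leq_trans _ Nk)// leq_add2l.
  have [_ _ _ hB'] := factor _ _ E.
  have En : (i - k = (i - k.+1).+1)%N by clear -Nk; lia.
  rewrite En in E hB'; set n := (i - k.+1)%N in E hB' *.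
  have Nn : (N <= n)%N by rewrite /n; clear -Nk; lia.
  apply: (res12_dvd sA (minimal_seq_size n) prA).
  have xn1 : lnh (P n.+1) <= lnh (P i.+1) by apply: minimal_seq_lnh_le; rewrite ltnS leq_subr.
  have := minimal_seq_lnh_lt n; have fn := fast _ Nn; have bn := big _ Nn => xn.
  have B'0 : 0 <= lnh B' by apply: lnh_ge0; case: (factor _ _ E).
  apply: (@res12_eq0 R zeta A (P n) (lnh A) (lnh (P n)) (lnv A) (lnv (P n))
    (kappa + 4 - lnh (P n.+1) / 2)); rewrite ?minimal_seq_height_le ?minimal_seq_val_le ?minimal_seq_size ?lnhK//.
  - by apply: tc0_le => //; rewrite sA.
  - by lra.
  - by lra.
  - by lra.
have [|B' E] := descend (i - N)%N; first by rewrite subnKC.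
rewrite subKn// in E.
have [B'0 sB' vB' hB'] := factor _ _ E.
have b1 := lnv_le_lnh (leq_trans sB' _) B'0.
have hA := lnh_ge0 R A0.
have := hN3 _ N3i; have := b1 isT; lra.
Qed.

End MinimalSequence.

Section GoldenRatio.
Variable R : realType.

Definition golden : R := (1 + Num.sqrt 5) / 2.

Lemma golden_sqr : golden * golden = golden + 1.
Proof.
have : Num.sqrt (5 : R) ^+ 2 = 5 by rewrite sqr_sqrtr.
by rewrite /golden expr2 => h; lra.
Qed.

Lemma golden_bounds : 8 / 5 < golden < 13 / 8.
Proof.
have g2 := golden_sqr.
have g0 : 0 < golden.
  by rewrite /golden; have := sqrtr_ge0 (5 : R); lra.
apply/andP; split; rewrite ltNge; apply/negP => c; nra.
Qed.

End GoldenRatio.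

Lemma round_int (a w : int) : w != 0 -> exists n : int, 2 * `|a - n * w| <= `|w|.
Proof.
move=> w0; have E := divz_eq a w.
have r0 := modz_ge0 a w0; have r1 := ltz_mod a w0.
case: (lerP (2 * (a %% w)%Z) `|w|) => h.
  exists (a %/ w)%Z.
  have -> : a - (a %/ w)%Z * w = (a %% w)%Z by rewrite {1}E addrC addKr.
  by rewrite ger0_norm.
exists ((a %/ w)%Z + Num.sg w).
have -> : a - ((a %/ w)%Z + Num.sg w) * w = (a %% w)%Z - `|w|.
  by rewrite {1}E normrEsg; ring.
by rewrite ler0_norm; lia.
Qed.

Lemma wedge_lin (P Q : {poly int}) (a b : int) i j :
  wedge (a *: P + b *: Q) P i j = - b * wedge P Q i j.
Proof. by rewrite /wedge !coefD !coefZ; ring. Qed.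

Lemma res22_lin (P Q : {poly int}) (a b : int) :
  res22 (a *: P + b *: Q) Q = a ^+ 2 * res22 P Q.
Proof. by rewrite /res22 /wedge !coefD !coefZ; ring. Qed.

Lemma height_scale (P : {poly int}) (a : int) : a != 0 -> (height P <= height (a *: P))%N.
Proof.
move=> a0; apply/height_leP => i; apply: leq_trans (coef_le_height _ i).
by rewrite coefZ abszM leq_pmull// absz_gt0.
Qed.

(** * Minimal polynomials that stay in one plane *)

Section Basis.
Variables (R : realType) (zeta : R).
Hypothesis tr : transcendental zeta.
Variable P : nat -> {poly int}.
Hypothesis mP : minimal_seq zeta P.

Local Notation tc0 := (taylor0 zeta).

(** Of the three minors of P_i and P_(i+1) this is the one whose Taylor counterpart contains no
    value at zeta. As long as the polynomials stay in one plane, it measures the index of the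
    lattice spanned by two successive ones. *)
Definition wdg i : int := wedge (P i) (P i.+1) 1 2.

(** Rounding the rational coordinates of P_i with respect to the next two polynomials leaves a
    remainder [T] of height below that of P_(i+2) and of value below that of P_(i+1). Minimality
    forces it to be 0. *)
Lemma minimal_seq_basis i : det3 (P i) (P i.+1) (P i.+2) = 0 -> wdg i.+1 != 0 ->
  exists a b : int, P i = a *: P i.+1 + b *: P i.+2.
Proof.
rewrite /wdg; set Q := P i.+1; set S := P i.+2; move=> d0 W0.
have sP : (size (P i) <= 3)%N := minimal_seq_size mP i.
have sQ : (size Q <= 3)%N := minimal_seq_size mP i.+1.
have sS : (size S <= 3)%N := minimal_seq_size mP i.+2.
set W := wedge Q S 1 2 in W0 *.
have [a ha] := round_int (wedge (P i) S 1 2) W0.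
have [b hb] := round_int (wedge Q (P i) 1 2) W0.
set al := _ - a * W in ha; set be := _ - b * W in hb.
pose T := P i - (a *: Q + b *: S).
have sT : (size T <= 3)%N.
  rewrite (leq_trans (size_polyD _ _))// geq_max sP size_polyN /=.
  rewrite (leq_trans (size_polyD _ _))// geq_max.
  by rewrite !(leq_trans (size_scale_leq _ _)).
have ET : W *: T = al *: Q + be *: S.
  have E0 := det3_combine sP sQ sS d0.
  by rewrite /T scalerBr E0 /al /be -!mul_polyC; ring.
suff T0 : T = 0 by exists a, b; apply/eqP; rewrite -subr_eq0 -/T T0.
apply/eqP; apply: contraT => T0.
have [_ _ ltH ltV minP] := mP i.+1; rewrite -/Q -/S in ltH ltV minP.
have /(minP _ T0 sT) : (height T < height S)%N.
  have [k hk] := height_ex T; rewrite hk.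
  have := congr1 (fun q : {poly int} => q`_k) ET; rewrite coefD !coefZ => Ek.
  have hq : `|Q`_k| <= (height Q)%:Z by rewrite -abszE lez_nat coef_le_height.
  have hs : `|S`_k| <= (height S)%:Z by rewrite -abszE lez_nat coef_le_height.
  have ltH' : (height Q)%:Z < (height S)%:Z by rewrite ltz_nat.
  rewrite -ltz_nat abszE.
  have W1 : 0 < `|W| by rewrite normr_gt0.
  rewrite -(ltr_pM2l W1) -normrM Ek (le_lt_trans (ler_normD _ _))// !normrM.
  have : 2 * `|al| * `|Q`_k| <= `|W| * (height Q)%:Z by apply: ler_pM; rewrite ?mulr_ge0.
  have : 2 * `|be| * `|S`_k| <= `|W| * (height S)%:Z by apply: ler_pM; rewrite ?mulr_ge0.
  have : `|W| * (height Q)%:Z < `|W| * (height S)%:Z by rewrite ltr_pM2l.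
  by clear; lra.
rewrite leNgt => /negP[].
have W1 : 0 < `|W%:~R : R| by rewrite normr_gt0 intr_eq0.
rewrite -(ltr_pM2l W1) -normrM.
have [<- _ _ _] := taylorZ zeta W T; rewrite ET.
have [-> _ _ _] := taylorD zeta (al *: Q) (be *: S).
have [-> _ _ _] := taylorZ zeta al Q; have [-> _ _ _] := taylorZ zeta be S.
rewrite (le_lt_trans (ler_normD _ _))// !normrM.
have toR (z : int) : 2 * `|z| <= `|W| -> 2 * `|z%:~R : R| <= `|W%:~R : R|.
  by move=> h; rewrite -!intr_norm -[2]/(2%:~R) -intrM ler_int.
have : 2 * `|al%:~R| * `|tc0 Q| <= `|W%:~R| * `|tc0 Q| by apply: ler_wpM2r => //; apply: toR.
have : 2 * `|be%:~R| * `|tc0 S| <= `|W%:~R| * `|tc0 S| by apply: ler_wpM2r => //; apply: toR.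
have : `|W%:~R| * `|tc0 S| < `|W%:~R| * `|tc0 Q| by rewrite ltr_pM2l.
by clear; lra.
Qed.

Lemma wdg_le i : det3 (P i) (P i.+1) (P i.+2) = 0 -> wdg i != 0 -> wdg i.+1 != 0 ->
  `|wdg i.+1| <= `|wdg i|.
Proof.
move=> d0 w0 w1; have [a [b E]] := minimal_seq_basis d0 w1.
have Ew : wdg i = - b * wdg i.+1 by rewrite /wdg E wedge_lin.
rewrite Ew normrM normrN ler_peMl//.
by rewrite -gtz0_ge1 normr_gt0; apply: contraNneq w0 => b0; rewrite Ew b0 oppr0 mul0r.
Qed.

End Basis.

(** * The Fibonacci subsequence *)

Section FibonacciSequence.
Variables (R : realType) (zeta : R).
Hypothesis tr : transcendental zeta.

Local Notation kappa := (taylor_const zeta).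
Local Notation lnv := (lnv zeta).
Local Notation lnh := (@lnh R).
Local Notation g := (golden R).

(* Up to a relative error d in the exponents: log-heights satisfy the Fibonacci
   recurrence with ratio the golden ratio, and |Q_k(zeta)| is at most
   1 / (H(Q_k) H(Q_(k+1))^2), which is H(Q_(k+1))^-(3+sqrt 5)/2. *)
Record fib_seq (d M : R) (Q : nat -> {poly int}) : Prop := FibSeq {
  fs_neq0 : forall k, Q k != 0;
  fs_size : forall k, (size (Q k) <= 3)%N;
  fs_big : forall k, M <= lnh (Q k);
  fs_golden : forall k, `|lnh (Q k.+1) - g * lnh (Q k)| <= d * lnh (Q k);
  fs_fib : forall k,
    `|lnh (Q k.+2) - lnh (Q k.+1) - lnh (Q k)| <= d * lnh (Q k);
  fs_val : forall k,
    lnv (Q k) <= - (lnh (Q k) + 2 * lnh (Q k.+1)) + d * lnh (Q k);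
  fs_res : forall k, res22 (Q k) (Q k.+1) != 0 }.

Section Minimal.
Variable P : nat -> {poly int}.
Hypothesis mP : minimal_seq zeta P.
Hypothesis hu : forall eta, eta < g + 1 -> uniform_exponent zeta eta.

Local Notation x i := (lnh (P i)).
Local Notation lnw i := (ln `|(wdg P i)%:~R : R|).

(** The minors containing a value are at most about |P_i(zeta)| H(P_(i+1)), so a nonzero resultant
    makes [wdg P i] at least about the inverse of this. Likewise a nonzero [det3] is at most about
    |P_i(zeta)| H(P_(i+1)) H(P_(i+2)), which bounds H(P_(i+2)) from below. *)
Lemma minimal_seq_asymptotics (d M : R) : 0 < d -> d <= 1 / 100 -> exists N, forall i, (N <= i)%N ->
  [/\ M <= x i /\ lnv (P i) <= - (g + 1 - d) * x i.+1, res22 (P i) (P i.+1) != 0,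
      wdg P i != 0, (g - 2 * d) * x i.+1 <= lnw i <= x i + x i.+1 + d * x i
    & det3 (P i) (P i.+1) (P i.+2) != 0 -> (g - 2 * d) * x i.+1 <= x i.+2].
Proof.
move=> d0 d1; have k0 := taylor_const_ge0 zeta; have /andP[g1 g2] := golden_bounds R.
have rate e : 0 < e -> e < 1 -> exists N, forall i, (N <= i)%N ->
    lnv (P i) <= - (g + 1 - e) * x i.+1.
  move=> e0 e1.
  have [|||N hN] := @minimal_seq_uniform R zeta P (g + 1 - e / 2) (e / 2) mP tr.
  - by lra.
  - by lra.
  - by apply: hu; lra.
  by exists N => i /hN; have -> : g + 1 - e / 2 - e / 2 = g + 1 - e by lra.
have [|N1 hN1] := minimal_seq_coprime tr mP.
  have [||N hN] := rate (1 / 100); [by lra|by lra|].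
  exists N => i /hN => h; have := lnh_ge0 R (minimal_seq_neq0 mP i.+1).
  by set y := lnh (P i.+1) in h *; nra.
have [||N2 hN2] := rate d; [by lra|by lra|].
have [N3 hN3] := minimal_seq_lnh (Num.max M ((2 * kappa + 6) / d)) mP.
exists (maxn N1 (maxn N2 N3)) => i; rewrite !geq_max => /and3P[/hN1 D0 /hN2 li /hN3].
rewrite ge_max ler_pdivrMr// => /andP[Mx dx].
have xy := minimal_seq_lnh_lt mP i; have yz := minimal_seq_lnh_lt mP i.+1.
have vv := minimal_seq_lnv_lt tr mP i.
have vv' := minimal_seq_lnv_lt tr mP i.+1.
have [sP sQ] := (minimal_seq_size mP i, minimal_seq_size mP i.+1).
have [hP hQ] := (minimal_seq_height_le mP i, minimal_seq_height_le mP i.+1).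
have [vP vQ] := (minimal_seq_val_le tr mP i, minimal_seq_val_le tr mP i.+1).
set X := lnh (P i) in Mx dx xy hP *; set Y := lnh (P i.+1) in li xy yz hQ *.
set Z := lnh (P i.+2) in yz *.
have dY : X * d <= Y * d by rewrite ler_pM2r// ltW.
have X0 : 0 <= X by apply: lnh_ge0; apply: minimal_seq_neq0.
have ve : lnv (P i.+1) + X <= lnv (P i) + Y by lra.
have small : 2 * (kappa + (lnv (P i) + Y) + 1) + 1 < 0.
  have : 0 < (g - 8 / 5) * Y by apply: mulr_gt0; lra.
  have : 0 <= (1 / 100 - d) * Y by apply: mulr_ge0; lra.
  by lra.
have wle w : `|(wdg P i)%:~R : R| <= expR w -> 0 <= kappa + (lnv (P i) + Y) + 1 + w + 1.
  by move=> hw; apply: (res22_neq0_wedge sP sQ D0 hP hQ vP vQ (lexx _) ve hw small).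
have w0 : wdg P i != 0.
  apply/eqP => E; have := wle (- (kappa + (lnv (P i) + Y) + 3)).
  by rewrite E normr0 expR_ge0 => /(_ isT); lra.
split=> //.
  apply/andP; split.
    have := wle (ln `|(wdg P i)%:~R|); rewrite expR_ln_norm ?intr_eq0// => /(_ (lexx _)); nra.
  have [_ _] := wedge_tc_le hP hQ vP vQ (lexx _) ve.
  rewrite -wedge12_tc// -/(wdg P i) => hw.
  rewrite -ler_expR expR_ln_norm ?intr_eq0//; apply: le_trans hw _.
  by rewrite ler_expR; lra.
move=> det0; rewrite leNgt; apply/negP => lt.
move/eqP: det0; apply.
by apply: (det3_eq0 (e := lnv (P i) + Y + Z) sP sQ (minimal_seq_size mP i.+2) hP hQ
  (minimal_seq_height_le mP i.+2) vP vQ (minimal_seq_val_le tr mP i.+2)); rewrite -/Z; lra.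
Qed.

End Minimal.
End FibonacciSequence.

(* Here X, Y, Z are the log-heights of P_m, P_(m+1) and of the next member of
   the subsequence. *)
Lemma golden_step (R : realType) (h d X Y Z L : R) :
  h * h = h + 1 -> 8 / 5 < h -> h < 13 / 8 -> 0 < d -> d <= 1 / 100 -> 1 <= X ->
  L <= - (h + 1 - d) * Y -> (h - 2 * d) * X <= Y ->
  (h - 2 * d) * Z <= X + Y + d * X -> (h - 2 * d) * Y <= X + Y + d * X -> Y <= Z ->
  [/\ `|Z - h * X| <= 8 * d * X, L <= - (X + 2 * Z) + 40 * d * X & Z <= 2 * X].
Proof.
move=> g2 gl gu d0 d1 X1 lv gxy gz gy yz.
have dX : 0 <= d * X by apply: mulr_ge0; lra.
have XY : X <= Y.
  have : 0 <= (1 / 100 - d) * X by apply: mulr_ge0; lra.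
  have : 0 <= (h - 8 / 5) * X by apply: mulr_ge0; lra.
  by lra.
have Y2 : Y <= 9 / 5 * X.
  have : 0 <= (1 / 100 - d) * X by apply: mulr_ge0; lra.
  have : 0 <= (h - 8 / 5) * Y by apply: mulr_ge0; lra.
  have : 0 <= (1 / 100 - d) * Y by apply: mulr_ge0; lra.
  by lra.
have Z2 : Z <= 2 * X.
  have : 0 <= (1 / 100 - d) * X by apply: mulr_ge0; lra.
  have : 0 <= (h - 8 / 5) * Z by apply: mulr_ge0; lra.
  have : 0 <= (1 / 100 - d) * Z by apply: mulr_ge0; lra.
  by lra.
have dY : d * Y <= 9 / 5 * (d * X) by have := ler_wpM2l (ltW d0) Y2; lra.
have dZ : d * Z <= 2 * (d * X) by have := ler_wpM2l (ltW d0) Z2; lra.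
have A1 : (h - 1) * Y <= X + 23 / 5 * (d * X) by lra.
have A2 : Z <= h * X + 8 * (d * X).
  (* [h - 1] is the inverse of [h], so multiplying by it turns the bound for [h * Z] into one for
     [Z]. *)
  have : (h - 1) * (h * Z) <= (h - 1) * (X + Y + 5 * (d * X)).
    by apply: ler_wpM2l; lra.
  have -> : (h - 1) * (h * Z) = Z by rewrite mulrA mulrBl g2; ring.
  have : (h - 1) * (5 * (d * X)) <= (13 / 8 - 1) * (5 * (d * X)).
    by apply: ler_wpM2r; lra.
  by lra.
have A3 : h * X - 2 * (d * X) <= Y by lra.
split; last by [].
  by rewrite ler_norml; apply/andP; split; lra.
have B1 : (h + 1) * (Z - Y) <= (13 / 8 + 1) * (10 * (d * X)).
  by apply: ler_pM; lra.
have B2 : X - 2 * (d * X) <= (h - 1) * Z.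
  have : (h - 1) * (h * X - 2 * (d * X)) <= (h - 1) * Z by apply: ler_wpM2l; lra.
  have -> : (h - 1) * (h * X - 2 * (d * X)) = X - (h - 1) * (2 * (d * X)).
    by have := congr1 ( *%R^~ X) g2; lra.
  have : (h - 1) * (2 * (d * X)) <= 1 * (2 * (d * X)) by apply: ler_wpM2r; lra.
  by lra.
by lra.
Qed.

Section FibonacciSequenceExistence.
Variables (R : realType) (zeta : R).
Hypothesis tr : transcendental zeta.

Local Notation lnv := (lnv zeta).
Local Notation lnh := (@lnh R).
Local Notation g := (golden R).

Section Minimal.
Variable P : nat -> {poly int}.
Hypothesis mP : minimal_seq zeta P.

Local Notation x i := (lnh (P i)).
Local Notation lnw i := (ln `|(wdg P i)%:~R : R|).

(** Geometrically, P_(i+2) leaves the plane spanned by P_i and P_(i+1). *)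
Definition turning i := det3 (P i) (P i.+1) (P i.+2) != 0.

Variables (d : R) (N : nat).
Hypothesis asym : forall i, (N <= i)%N ->
  [/\ 1 <= x i /\ lnv (P i) <= - (g + 1 - d) * x i.+1, res22 (P i) (P i.+1) != 0,
      wdg P i != 0, (g - 2 * d) * x i.+1 <= lnw i <= x i + x i.+1 + d * x i
    & turning i -> (g - 2 * d) * x i.+1 <= x i.+2].

Lemma lnw_le i : (N <= i)%N -> ~~ turning i -> lnw i.+1 <= lnw i.
Proof.
move=> Ni; rewrite negbK => /eqP det0.
have [_ _ w0 _ _] := asym Ni; have [_ _ w1 _ _] := asym (leq_trans Ni (leqnSn i)).
rewrite ler_ln ?posrE ?normr_gt0 ?intr_eq0//.
by rewrite -!intr_norm ler_int (wdg_le mP).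
Qed.

(** Without a further turn [lnw] would stay bounded, but it is at least about g times the
    log-height. *)
Lemma next_turning i : d <= 1 / 100 -> (N <= i)%N -> exists j,
  [/\ (i < j)%N, turning j & forall k, (i < k < j)%N -> ~~ turning k].
Proof.
move=> d1 Ni.
have ex : exists j, (i < j)%N && turning j.
  apply: contrapT => nex.
  have noturn k : (i < k)%N -> ~~ turning k.
    by move=> ik; apply/negP => tk; apply: nex; exists k; rewrite ik.
  have bnd k : lnw (i.+1 + k)%N <= lnw i.+1.
    elim: k => [|k IH]; first by rewrite addn0.
    rewrite addnS; apply: le_trans (lnw_le _ _) IH.
      by rewrite (leq_trans Ni)// (leq_trans (leqnSn i))// leq_addr.
    by apply: noturn; rewrite ltnS leq_addr.
  have [K hK] := minimal_seq_lnh (lnw i.+1 + 1) mP.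
  have Nk : (N <= i.+1 + K)%N.
    by rewrite (leq_trans Ni)// (leq_trans (leqnSn i))// leq_addr.
  have [[x1 _] _ _ /andP[lo _] _] := asym Nk.
  have [[x2 _] _ _ _ _] := asym (leq_trans Nk (leqnSn _)).
  have := hK ((i.+1 + K).+1)%N; rewrite (leq_trans _ (leqnSn _)) ?leq_addl// => /(_ isT) big.
  have b := bnd K; have /andP[g1 g2] := golden_bounds R.
  have gd : 0 <= g - 2 * d - 1 by lra.
  have := mulr_ge0 gd (le_trans ler01 x2).
  by lra.
case: (ex_minnP ex) => j /andP[ij tj] minj; exists j; split=> // k /andP[ik kj].
by apply/negP => tk; have := minj k; rewrite ik tk leqNgt kj => /(_ isT).
Qed.

(** Between two turns the polynomials stay in one plane, and P_(i+1) is an integral combination of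
    P_j and P_(j+1) with nonzero coefficient at P_j. This carries the nonvanishing of the resultant
    over to P_(i+1) and P_(j+1), which need not be neighbours in the minimal sequence. *)
Lemma turning_step i j : (N <= i)%N -> turning i -> (i < j)%N ->
  (forall k, (i < k < j)%N -> ~~ turning k) ->
  [/\ lnw j <= lnw i.+1, res22 (P i.+1) (P j.+1) != 0 & x i.+2 <= x j.+1].
Proof.
move=> Ni ti ij between.
have Nn n : (i < n)%N -> (N <= n)%N by move=> h; rewrite (leq_trans Ni)// ltnW.
have chain k : (i.+1 + k <= j)%N -> lnw (i.+1 + k)%N <= lnw i.+1 /\
    exists a b : int, P i.+1 = a *: P (i.+1 + k)%N + b *: P ((i.+1 + k).+1)%N.
  elim: k => [|k IH] hk.
    by rewrite addn0; split=> //; exists 1, 0; rewrite scale1r scale0r addr0.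
  rewrite addnS in hk *; have [lek [a [b E]]] := IH (ltnW hk).
  have ik : (i < i.+1 + k)%N by rewrite ltnS leq_addr.
  have nt : ~~ turning (i.+1 + k)%N by apply: between; rewrite ik.
  split; first exact: le_trans (lnw_le (Nn _ ik) nt) lek.
  have [_ _ w1 _ _] := asym (Nn ((i.+1 + k).+1)%N (leq_trans ik (leqnSn _))).
  move: nt; rewrite negbK => /eqP det0.
  have [a' [b' E']] := minimal_seq_basis mP det0 w1.
  exists (a * a' + b), (a * b'); rewrite E {1}E' scalerDr !scalerA scalerDl.
  by rewrite addrAC.
have [lew [a [b E]]] : lnw j <= lnw i.+1 /\ exists a b : int, P i.+1 = a *: P j + b *: P j.+1.
  by have := chain (j - i.+1)%N; rewrite subnKC//; apply.
split=> //; last by apply: minimal_seq_lnh_le => //; rewrite ltnS.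
have [_ D0 _ _ _] := asym (Nn _ ij).
rewrite E res22_lin mulf_neq0// sqrf_eq0; apply/eqP => a0.
have b0 : b != 0.
  apply/eqP => b0; have := minimal_seq_neq0 mP i.+1.
  by rewrite E a0 b0 !scale0r addr0 eqxx.
have := height_scale (P j.+1) b0.
have -> : b *: P j.+1 = P i.+1 by rewrite E a0 scale0r add0r.
have : lnh (P i.+1) < lnh (P j.+1).
  by apply: (lt_le_trans (minimal_seq_lnh_lt mP _)); apply: minimal_seq_lnh_le.
rewrite ltr_ln ?posrE ?ltr0n ?height_gt0 ?(minimal_seq_neq0 mP)// ltr_nat ltnNge => /negP nle le.
exact: nle.
Qed.

(** Let X, Y, Z be the log-heights of P_(i+1), P_(i+2), P_(j+1). The turn at i gives g X <= Y up to
    errors. The two bounds for [lnw] at i+1 give g Y <= X + Y, and its monotonicity up to j gives g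
    Z <= X + Y. As g^2 = g + 1 and Y <= Z, both Y and Z are close to g X. *)
Lemma turning_estimates i j : 0 < d -> d <= 1 / 100 -> (N <= i)%N -> turning i -> (i < j)%N ->
  (forall k, (i < k < j)%N -> ~~ turning k) ->
  [/\ `|x j.+1 - g * x i.+1| <= 8 * d * x i.+1,
      lnv (P i.+1) <= - (x i.+1 + 2 * x j.+1) + 40 * d * x i.+1 &
      x j.+1 <= 2 * x i.+1].
Proof.
move=> d0 d1 Ni ti ij between.
have [wle _ yz] := turning_step Ni ti ij between.
have Ni1 : (N <= i.+1)%N by rewrite (leq_trans Ni).
have Nj : (N <= j)%N by rewrite (leq_trans Ni)// ltnW.
have [_ _ _ _ /(_ ti) gxy] := asym Ni.
have [[x1 lv] _ _ /andP[gy upw] _] := asym Ni1.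
have [_ _ _ /andP[gz _] _] := asym Nj.
have g2 := golden_sqr R; have /andP[gl gu] := golden_bounds R.
have {}gz : (g - 2 * d) * lnh (P j.+1) <= lnh (P i.+1) + lnh (P i.+2) + d * lnh (P i.+1).
  exact: le_trans gz (le_trans wle upw).
have {}gy := le_trans gy upw.
exact: golden_step g2 gl gu d0 d1 x1 lv gxy gz gy yz.
Qed.

End Minimal.

Lemma exists_fib_seq (d M : R) : 0 < d -> d <= 1 / 100 ->
  (forall eta, eta < g + 1 -> uniform_exponent zeta eta) ->
  exists Q, fib_seq zeta d M Q.
Proof.
move=> d0 d1 hu.
have g2 := golden_sqr R; have /andP[gl gu] := golden_bounds R.
have [P mP] : exists P : nat -> {poly int}, minimal_seq zeta P.
  apply: exists_minimal_seq => //; apply: (@uniform_exponent_small _ _ 1); first by [].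
  by apply: hu; lra.
(* The largest error constant in [turning_estimates] is 40; the recurrence needs less than 50 as
   well. *)
pose e := d / 50.
have [e0 e1] : 0 < e /\ e <= 1 / 100 by rewrite /e; lra.
have [N asym] := minimal_seq_asymptotics tr mP hu (Num.max 1 M) e0 e1.
have asym1 i : (N <= i)%N ->
  [/\ 1 <= lnh (P i) /\ lnv (P i) <= - (g + 1 - e) * lnh (P i.+1),
      res22 (P i) (P i.+1) != 0, wdg P i != 0,
      (g - 2 * e) * lnh (P i.+1) <= ln `|(wdg P i)%:~R : R| <=
        lnh (P i) + lnh (P i.+1) + e * lnh (P i)
    & turning P i -> (g - 2 * e) * lnh (P i.+1) <= lnh (P i.+2)].
  by move=> /asym[[+ ?] ? ? ? ?]; rewrite ge_max => /andP[].
pose T := {i : nat | (N <= i)%N && turning P i}.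
have nextT (s : T) : exists t : T, (sval s < sval t)%N /\
    forall k, (sval s < k < sval t)%N -> ~~ turning P k.
  have /andP[Ni ti] := svalP s.
  have [j [ij tj bet]] := next_turning mP asym1 e1 Ni.
  have Tj : (N <= j)%N && turning P j by rewrite tj (leq_trans Ni)// ltnW.
  by exists (exist _ j Tj).
have [f hf] := choice nextT.
have [i0 [Ni0 ti0 _]] := next_turning mP asym1 e1 (leqnn N).
have T0 : (N <= i0)%N && turning P i0 by rewrite ti0 ltnW.
pose s k := iter k f (exist _ i0 T0 : T).
pose Q k := P (sval (s k)).+1.
have Ns k : (N <= sval (s k))%N by have /andP[] := svalP (s k).
have ts k : turning P (sval (s k)) by have /andP[] := svalP (s k).
have est k : [/\ `|lnh (Q k.+1) - g * lnh (Q k)| <= 8 * e * lnh (Q k),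
      lnv (Q k) <= - (lnh (Q k) + 2 * lnh (Q k.+1)) + 40 * e * lnh (Q k),
      lnh (Q k.+1) <= 2 * lnh (Q k) & res22 (Q k) (Q k.+1) != 0].
  have [lt bet] := hf (s k).
  have [? ? ?] := turning_estimates mP asym1 e0 e1 (Ns k) (ts k) lt bet.
  by have [_ ? _] := turning_step mP asym1 (Ns k) (ts k) lt bet.
have Q0 k : 0 <= lnh (Q k) by apply: lnh_ge0; apply: minimal_seq_neq0 mP _.
exists Q; split=> k.
- exact: minimal_seq_neq0 mP _.
- exact: minimal_seq_size mP _.
- have [[+ _] _ _ _ _] := asym _ (leq_trans (Ns k) (leqnSn _)).
  by rewrite ge_max => /andP[].
- have [h _ _ _] := est k; apply: le_trans h _.
  by apply: ler_wpM2r => //; rewrite /e; lra.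
(* Z - Y - X = (Z - g Y) + (g - 1)(Y - g X), because g^2 = g + 1. *)
- have [h1 _ le1 _] := est k; have [h2 _ le2 _] := est k.+1.
  move: (lnh (Q k)) (lnh (Q k.+1)) (lnh (Q k.+2)) (Q0 k) h1 h2 le1 => X Y Z X0.
  rewrite !ler_norml => /andP[a1 a2] /andP[b1 b2] le1.
  have eY : e * Y <= 2 * (e * X) by have := ler_wpM2l (ltW e0) le1; lra.
  have eX : 0 <= e * X by apply: mulr_ge0; lra.
  have ge : 0 <= (2 - g) * (e * X) by apply: mulr_ge0; lra.
  have EX : d * X = 50 * (e * X) by rewrite /e; lra.
  have c1 : g * (Y - g * X) <= g * (8 * e * X) by apply: ler_wpM2l; lra.
  have c2 : g * (g * X - Y) <= g * (8 * e * X) by apply: ler_wpM2l; lra.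
  have gg : g * (g * X) = g * X + X by rewrite mulrA g2; ring.
  by rewrite EX; apply/andP; split; lra.
- have [_ h _ _] := est k; apply: le_trans h _; rewrite lerD2l.
  by apply: ler_wpM2r => //; rewrite /e; lra.
- by have [_ _ _ ?] := est k.
Qed.

End FibonacciSequenceExistence.

(** * Linear forms *)

Section LinearForms.
Variables (R : realType) (zeta : R).

Local Notation tc1 := (taylor1 zeta).
Local Notation kappa := (taylor_const zeta).
Local Notation lnv := (lnv zeta).
Local Notation lnh := (@lnh R).
Local Notation g := (golden R).

Lemma lnh_mul_le (A P : {poly int}) : (size A <= 2)%N -> (size P <= 3)%N ->
  A != 0 -> P != 0 -> (height (A * P))%:R <= expR (lnh A + lnh P + 1).
Proof.
move=> sA sP A0 P0.
have [c0 c1 c2 c3] := coef_mul_lin sA sP.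
have a i : `|coefR R A i| <= expR (lnh A) by rewrite (le_trans (coefR_le R A i))// height_lnh.
have p i : `|coefR R P i| <= expR (lnh P) by rewrite (le_trans (coefR_le R P i))// height_lnh.
have m i j : `|coefR R A i * coefR R P j| <= expR (lnh A + lnh P) by apply: le_expRM.
have [i hi] := height_ex (A * P).
have -> : (height (A * P))%:R = `|coefR R (A * P) i|.
  by rewrite hi /coefR -intr_norm -abszE -pmulrn.
have w (z : R) : `|z| <= expR (lnh A + lnh P) -> `|z| <= expR (lnh A + lnh P + 1).
  by move=> h; apply: le_expRW h _; lra.
case: i {hi} => [|[|[|[|i]]]].
- by rewrite /coefR c0 intrM; apply/w/m.
- by rewrite /coefR c1 intrD !intrM; apply: le_expRD; apply: m.
- by rewrite /coefR c2 intrD !intrM; apply: le_expRD; apply: m.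
- by rewrite /coefR c3 intrM; apply/w/m.
- by rewrite (@coefR_eq0 _ _ 4)// ?norm0_le_expR// (@size_mul_lin _ _ 1 2).
Qed.

Implicit Types (d M : R) (Q : nat -> {poly int}).

(** The last condition lets [d * lnh (Q k)] absorb every constant that occurs below. *)
Definition fib_param d M :=
  [/\ 0 < d, d <= 1 / 10 / 10 / 10, 1 <= M & 10 * kappa + 50 <= d * M].

Lemma fib_lin d M Q : fib_seq zeta d M Q -> fib_param d M -> forall k,
  [/\ 1 <= lnh (Q k),
      3 / 2 * lnh (Q k) <= lnh (Q k.+1) /\ lnh (Q k.+1) <= 17 / 10 * lnh (Q k),
      lnh (Q k) + lnh (Q k.+1) - d * lnh (Q k) <= lnh (Q k.+2) /\
        lnh (Q k.+2) <= lnh (Q k) + lnh (Q k.+1) + d * lnh (Q k),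
      10 * kappa + 50 <= d * lnh (Q k)
    & [/\ lnv (Q k) <= - (lnh (Q k) + 2 * lnh (Q k.+1)) + d * lnh (Q k),
        3 / 2 * (d * lnh (Q k)) <= d * lnh (Q k.+1) /\
          d * lnh (Q k.+1) <= 17 / 10 * (d * lnh (Q k)) &
        d * lnh (Q k) <= lnh (Q k) / 10 / 10 / 10]].
Proof.
move=> fQ [d0 d1 M1 dM] k; have := fs_big fQ k; have := fs_golden fQ k.
have := fs_fib fQ k; have := fs_val fQ k; have /andP[gl gu] := golden_bounds R.
move: (lnh (Q k)) (lnh (Q k.+1)) (lnh (Q k.+2)) (lnv (Q k)) => X Y Z L hL hZ hY MX.
move: hY hZ; rewrite !ler_norml => /andP[y1 y2] /andP[z1 z2].
have X1 : 1 <= X by apply: le_trans MX.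
have X0 : 0 <= X by apply: le_trans X1.
have g1 : 0 <= (g - 8 / 5) * X by rewrite mulr_ge0// subr_ge0 ltW.
have g2 : 0 <= (13 / 8 - g) * X by rewrite mulr_ge0// subr_ge0 ltW.
have dX : 0 <= (1 / 10 / 10 / 10 - d) * X by rewrite mulr_ge0// subr_ge0.
have dMX : d * M <= d * X by rewrite ler_pM2l.
have Y1 : 3 / 2 * X <= Y by clear -g1 y1 dX X0; lra.
have Y2 : Y <= 17 / 10 * X by clear -g2 y2 dX X0; lra.
have dY1 := ler_wpM2l (ltW d0) Y1; have dY2 := ler_wpM2l (ltW d0) Y2.
split=> //; first by clear -z1 z2; split; lra.
  by clear -dM dMX; lra.
by split=> //; [clear -dY1 dY2; split; lra|clear -dX; lra].
Qed.

Lemma fib_unbounded d M Q (B : R) : fib_seq zeta d M Q -> fib_param d M ->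
  exists k, B < lnh (Q k).
Proof.
move=> fQ par; have grow k : k%:R / 2 <= lnh (Q k).
  elim: k => [|k IH]; first by rewrite mul0r lnh_ge0// (fs_neq0 fQ).
  by rewrite -natr1; have [x1 [x2 _] _ _ _] := fib_lin fQ par k; lra.
have := archi_boundP (normr_ge0 (2 * B)); set n := Num.bound _ => hn.
by exists n; have := grow n; have := ler_norm (2 * B); lra.
Qed.

Lemma fib_locate d M Q (c h : R) : fib_seq zeta d M Q -> fib_param d M ->
  0 < c -> c * lnh (Q 1) <= h -> exists k, c * lnh (Q k.+1) <= h < c * lnh (Q k.+2).
Proof.
move=> fQ par c0 h1.
have ex : exists k, h < c * lnh (Q k.+2).
  have [k hk] := fib_unbounded (h / c) fQ par.
  exists k; rewrite ltr_pdivrMr// mulrC in hk; apply: lt_le_trans hk _.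
  rewrite ler_pM2l//; have [? [? _] _ _ _] := fib_lin fQ par k.
  by have [? [? _] _ _ _] := fib_lin fQ par k.+1; lra.
case: (ex_minnP ex) => -[|k] hk mink; first by exists 0%N; rewrite h1.
exists k.+1; rewrite hk andbT leNgt; apply/negP => lt.
by have := mink _ lt; rewrite ltnn.
Qed.

(** [C] is the coefficient of Q_(k+2) in the representation of a multiple of A Q_k through Q_(k+1)
    and Q_(k+2). It is nonzero, as otherwise A Q_k and Q_(k+1) would satisfy a relation excluded by
    the resultant of Q_k and Q_(k+1). The bound for its value exploits that the derivative of A Q_k
    at zeta is small: both of its terms contain a value. *)
Lemma linear_step d M Q (A : {poly int}) k : transcendental zeta ->
  fib_seq zeta d M Q -> fib_param d M -> A != 0 -> (size A <= 2)%N ->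
  exists C : {poly int}, [/\ C != 0, (size C <= 2)%N,
    forall e : R, lnv A + lnh (Q k.+1) <= e -> lnh A - lnh (Q k.+1) <= e ->
      lnh C <= e + 8 * (d * lnh (Q k)) &
    forall e : R, lnv A + lnh (Q k.+1) <= e ->
      lnh A - 2 * lnh (Q k) - 3 * lnh (Q k.+1) <= e ->
      lnv C <= e + 8 * (d * lnh (Q k))].
Proof.
move=> tr fQ par A0 sA.
have [[s0 s1] s2] := (fs_size fQ k, fs_size fQ k.+1, fs_size fQ k.+2).
have [[n0 n1] n2] := (fs_neq0 fQ k, fs_neq0 fQ k.+1, fs_neq0 fQ k.+2).
have D0 := fs_res fQ k.+1.
have AQ0 : A * Q k != 0 by rewrite mulf_neq0.
have sAQ : (size (A * Q k)%R <= 4)%N by rewrite (@size_mul_lin _ _ 1 2).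
have [B [C [sB sC E]]] := sylvester_solve s1 s2 sAQ.
have C0 : C != 0.
  apply/eqP => C0; move: E; rewrite C0 mul0r addr0 => E.
  have [] := @sylvester_inj (Q k) (Q k.+1) (res22 (Q k.+1) (Q k.+2) *: A) (- B).
  - exact: s0.
  - exact: s1.
  - by rewrite (leq_trans (size_scale_leq _ _)).
  - by rewrite size_polyN.
  - exact: (fs_res fQ k).
  - by rewrite -scalerAl E mulNr subrr.
  by move/eqP; rewrite scale_poly_eq0 (negbTE D0) (negbTE A0).
have k0 := taylor_const_ge0 zeta.
have [x0 [y0 y1] [z0 z1] c0 [l0 [f0 f1] t0]] := fib_lin fQ par k.
have [x0' [y0' _] [z0' _] _ [l1 [_ f1'] t0']] := fib_lin fQ par k.+1.
have [_ [y0'' _] _ _ [l2 _ t0'']] := fib_lin fQ par k.+2.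
have vAQ : lnv (A * Q k) = lnv A + lnv (Q k) by rewrite lnv_mul.
have [v1 v2] := (tc0_le tr (leq_trans s1 (leqnSn 3)) n1, tc0_le tr (leq_trans s2 (leqnSn 3)) n2).
have vS := tc0_le tr sAQ AQ0; rewrite vAQ in vS.
have hS := lnh_mul_le sA s0 A0 n0.
exists C; split=> // e e1 e2.
  rewrite -ler_expR lnhK//.
  apply: le_trans (sylvester_height_le (e := e + 3 * (d * lnh (Q k)) + d * lnh (Q k.+1) + 1)
    s1 s2 sB sC D0 E (height_lnh R n1) (height_lnh R n2) hS v1 v2 vS _ _ _) _.
  - by clear -l0 z1 e1 c0 k0 f0; lra.
  - by clear -l1 z0 e2 c0 k0; lra.
  - by clear -l2 y0'' y0' z0 t0 t0'' x0 y0 x0' e2 c0 k0 f0; lra.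
  - by rewrite ler_expR; clear -c0 k0 f1; lra.
pose t := Num.max (lnv A + lnh (Q k)) (lnh A + lnv (Q k)) + kappa + 1.
have ht : `|tc1 (A * Q k)| <= expR t.
  have [_ -> _ _] := taylor_mul zeta sA s0.
  have [_ a1 _ _] := taylor_le zeta (height_lnh R A0).
  have [_ q1 _ _] := taylor_le zeta (height_lnh R n0).
  rewrite /t; apply: le_expRD.
    apply: le_expRW (le_expRM (tc0_le tr (leq_trans sA _) A0) q1) _ => //.
    by rewrite [leLHS]addrCA addrC lerD2r le_max lexx.
  apply: le_expRW (le_expRM a1 (tc0_le tr (leq_trans s0 _) n0)) _ => //.
  by rewrite -addrA [leLHS]addrC lerD2r le_max lexx orbT.
have tle z : lnv A + lnh (Q k) <= z - 1 - kappa -> lnh A + lnv (Q k) <= z - 1 - kappa -> t <= z.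
  by move=> z1' z2; rewrite /t -lerBrDr -lerBrDr ge_max z1'.
rewrite -ler_expR lnvK ?(leq_trans sC)//.
apply: le_trans (sylvester_tc0_le (e := e + 3 * (d * lnh (Q k)) + d * lnh (Q k.+1) + 1)
  s1 s2 sB sC D0 E (height_lnh R n1) (height_lnh R n2) hS v1 v2 vS ht _ _ _ _) _.
- by clear -l0 z1 e1 c0 k0 f0; lra.
- by clear -l1 z0 e2 c0 k0 f0 f1 t0 x0 y0; lra.
- rewrite addrC -lerBrDr; apply: tle.
    by clear -l1 z0 e1 c0 k0 f0 x0 y0; lra.
  by clear -l1 l0 z0 e2 c0 k0 f0 x0 y0; lra.
- by clear -l1 l2 y0'' y0' z0 t0 t0'' f1 x0 y0 x0' e2 c0 k0 f0; lra.
- by rewrite ler_expR; clear -c0 k0 f1; lra.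
Qed.

End LinearForms.

Section LinearLowerBound.
Variables (R : realType) (zeta : R).

Local Notation kappa := (taylor_const zeta).
Local Notation lnv := (lnv zeta).
Local Notation lnh := (@lnh R).
Local Notation g := (golden R).

(** The nonzero [C] has height at least 1. For [A] of height below that of Q_(k+1), only the term
    with A(zeta) in the bound for [lnh C] can allow this. *)
Lemma linear_crude (d M : R) (Q : nat -> {poly int}) (A : {poly int}) k :
  transcendental zeta -> fib_seq zeta d M Q -> fib_param zeta d M ->
  A != 0 -> (size A <= 2)%N -> lnh A + 9 * (d * lnh (Q k)) <= lnh (Q k.+1) ->
  - lnh (Q k.+1) - 8 * (d * lnh (Q k)) <= lnv A.
Proof.
move=> tr fQ par A0 sA hA; rewrite leNgt; apply/negP => contra.
have [C [C0 sC hC _]] := linear_step k tr fQ par A0 sA.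
have [x1 _ _ c1 _] := fib_lin fQ par k; have k0 := taylor_const_ge0 zeta.
have := lnh_ge0 R C0.
have := hC (Num.max (lnv A + lnh (Q k.+1)) (lnh A - lnh (Q k.+1))).
rewrite !le_max !lexx orbT => /(_ isT isT); clear -hA contra c1 k0.
by case: (leP (lnv A + lnh (Q k.+1)) (lnh A - lnh (Q k.+1))) => _; lra.
Qed.

(* Descent: if A has height between those of Q_(k+1) and Q_(k+2), then the linear
   form C of [linear_step] is smaller by the factor H(Q_(k+1)), while
   H(C)|C(zeta)| is still about H(A)|A(zeta)|. *)
Lemma linear_descent (d M d' : R) (Q : nat -> {poly int}) :
  transcendental zeta -> fib_seq zeta d M Q -> fib_param zeta d M ->
  100 * d <= d' -> d' <= 1 -> forall A : {poly int}, A != 0 -> (size A <= 2)%N ->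
  - lnv A - lnh A <= d' * lnh A + 2 * lnh (Q 1).
Proof.
move=> tr fQ par dd' d'1 A; have [n] := ubnP (height A); elim: n A => // n IH A.
rewrite ltnS => hn A0 sA.
have [d0 d1 _ _] := par.
have d'0 : 0 <= d' by clear -d0 dd'; lra.
have hA := lnh_ge0 R A0; have d'h : 0 <= d' * lnh A by rewrite mulr_ge0.
have k0 := taylor_const_ge0 zeta.
case: (ltrP (lnh A) ((1 - 10 * d) * lnh (Q 1))) => [small|big].
  have [x0 [y0 _] _ c0 [_ [e0 _] t0]] := fib_lin fQ par 0.
  have crude := linear_crude (k := 0) tr fQ par A0 sA.
  have {}crude : - lnh (Q 1) - 8 * (d * lnh (Q 0)) <= lnv A.
    by apply: crude; clear -small e0 c0 k0; lra.
  by clear -crude d'h hA x0 y0 t0; lra.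
have [|k /andP[lo hi]] := fib_locate fQ par _ big; first by clear -d1; lra.
have [x0 [y0 y1] [z0 z1] c0 [_ [e0 e1] t0]] := fib_lin fQ par k.
have [_ _ _ _ [_ [f0 f1] _]] := fib_lin fQ par k.+1.
have [C [C0 sC hC vC]] := linear_step k tr fQ par A0 sA.
have crude := linear_crude (k := k.+1) tr fQ par A0 sA.
have x10 : 0 <= lnh (Q 1) by apply: lnh_ge0; apply: (fs_neq0 fQ).
case: (lerP (- lnv A - lnh A) 0) => [le0|rho]; first by clear -le0 x10 d'h; lra.
(* The crude bound makes A(zeta) large enough for the first of the two terms in the estimate of
   [lnv C] to dominate. *)
have {}crude : - lnh (Q k.+2) - 8 * (d * lnh (Q k.+1)) <= lnv A.
  by apply: crude; clear -hi e0 f0 c0 k0; lra.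
have {}vC : lnv C <= lnv A + lnh (Q k.+1) + 8 * (d * lnh (Q k)).
  by apply: vC => //; clear -crude hi z1 e0 e1 f0 c0 k0 t0 y0 x0; lra.
(* By [rho] and [lo], [lnv A] is below [- lnh A], and twice [lnh A] is at least 2 - 20 d times
   [lnh (Q k.+1)]; hence the error term with 20. *)
have {}hC : lnh C <= lnh A - lnh (Q k.+1) + 20 * (d * lnh (Q k.+1)) + 8 * (d * lnh (Q k)).
  by apply: hC; [clear -rho lo|clear -e0 c0 k0]; lra.
have v0 : 0 <= lnh (Q k.+1) by apply: lnh_ge0; apply: (fs_neq0 fQ).
have ltC : lnh C < lnh A by clear -hC e1 t0 y0 x0; lra.
have /(IH C)/(_ C0 sC) IHC : (height C < n)%N.
  apply: leq_trans hn; move: ltC.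
  by rewrite ltr_ln ?posrE ?ltr0n ?height_gt0// ltr_nat.
(* One descent step loses less than 50 d times [lnh (Q k.+1)], and the drop of [d' * lnh] by half of
   [d' * lnh (Q k.+1)] pays for it. This is the reason for [100 * d <= d']. *)
have dC : d' * lnh C <= d' * (lnh A - lnh (Q k.+1) / 2).
  by apply: ler_wpM2l => //; clear -hC e1 t0 y0 x0; lra.
have dv : 0 <= (d' - 100 * d) * lnh (Q k.+1) by rewrite mulr_ge0// subr_ge0.
by clear -IHC vC hC dC dv e0 c0 k0; lra.
Qed.

Definition linear_bound (d c : R) := forall A : {poly int},
  A != 0 -> (size A <= 2)%N -> - lnv A <= (1 + d) * lnh A + c.

Lemma fib_paramP (d c : R) : 0 < d -> d <= 1 / 10 / 10 / 10 -> exists M : R,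
  fib_param zeta d M /\ c <= d * M.
Proof.
move=> d0 d1; exists (Num.max 1 ((10 * kappa + 50 + `|c|) / d)).
set M := Num.max _ _.
have M1 : 1 <= M by rewrite le_max lexx.
have : (10 * kappa + 50 + `|c|) / d <= M by rewrite le_max lexx orbT.
rewrite ler_pdivrMr// mulrC => h.
have := ler_norm c; have := normr_ge0 c; have := taylor_const_ge0 zeta.
by split; [split|]; lra.
Qed.

(** [Q1] is the auxiliary sequence for the descent with error d / 100. Its constant is then fixed,
    and [M] and the final sequence are chosen so that it is at most [d * M]. *)
Lemma exists_fib_seq_linear (d : R) : transcendental zeta -> 0 < d -> d <= 1 / 10 / 10 / 10 ->
  (forall eta, eta < g + 1 -> uniform_exponent zeta eta) ->
  exists M Q, [/\ fib_seq zeta d M Q, fib_param zeta d M & linear_bound d (d * M)].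
Proof.
move=> tr d0 d1 hu; pose e := d / 100.
have [e0 e1] : 0 < e /\ e <= 1 / 10 / 10 / 10 by rewrite /e; lra.
have [M1 [par1 _]] := fib_paramP 0 e0 e1.
have [|Q1 fQ1] := @exists_fib_seq R zeta tr e M1 e0 _ hu; first by lra.
have [M [par hM]] := fib_paramP (2 * lnh (Q1 1%N)) d0 d1.
have [|Q fQ] := @exists_fib_seq R zeta tr d M d0 _ hu; first by lra.
exists M, Q; split=> // A A0 sA.
have := linear_descent (d' := d) tr fQ1 par1 _ _ A0 sA.
have -> : 100 * e <= d by rewrite /e; lra.
have -> : d <= 1 by lra.
by move=> /(_ isT isT); lra.
Qed.

End LinearLowerBound.

(** * Cubic polynomials *)

Lemma cubic_not_split (S A P : {poly int}) (n : int) : cubic_poly S -> n != 0 ->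
  (size A <= 2)%N -> (size P <= 3)%N -> n *: S = A * P -> False.
Proof.
move=> [[S0 Su irr] sS] n0 sA sP E.
have pr : zprimitive S = zprimitive A * zprimitive P.
  by rewrite -(zprimitiveZ S n0) E zprimitiveM.
have ES : S = (zcontents S *: zprimitive A) * zprimitive P.
  by rewrite -scalerAl -pr -zpolyEprim.
have small (B C : {poly int}) : S = B * C -> B \is a GRing.unit -> (size C < 4)%N -> False.
  move=> EB; rewrite poly_unitE => /andP[/eqP sB _] sC.
  have := leq_trans (size_polyMleq B C) _; move: sS; rewrite EB sB /= => -> /(_ _ (leqnn _)).
  by rewrite leqNgt sC.
have [u|u] := irr _ _ ES.
  by apply: small ES u _; rewrite size_zprimitive.
rewrite mulrC in ES; apply: small ES u _.
by rewrite (leq_ltn_trans (size_scale_leq _ _))// size_zprimitive (leq_ltn_trans sA).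
Qed.

Section CubicBounds.
Variables (R : realType) (zeta : R).
Local Notation tc0 := (taylor0 zeta).
Local Notation lnv := (lnv zeta).
Local Notation lnh := (@lnh R).
Local Notation g := (golden R).

Implicit Types (d M : R) (Q : nat -> {poly int}).

Lemma fib_seq_height_le d M Q k : fib_seq zeta d M Q -> (height (Q k))%:R <= expR (lnh (Q k)).
Proof. by move=> fQ; apply: height_lnh (fs_neq0 fQ k). Qed.

Lemma fib_seq_val_le d M Q k : transcendental zeta -> fib_seq zeta d M Q ->
  `|tc0 (Q k)| <= expR (lnv (Q k)).
Proof. by move=> tr fQ; rewrite tc0_le// ?(fs_neq0 fQ)// (leq_trans (fs_size fQ k)). Qed.

Lemma fib_res_le d M Q k : transcendental zeta -> fib_seq zeta d M Q ->
  fib_param zeta d M ->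
  `|(res22 (Q k) (Q k.+1))%:~R : R| <= expR (2 * (d * lnh (Q k))).
Proof.
move=> tr fQ par; have k0 := taylor_const_ge0 zeta.
have [x0 [y0 y1] [z0 z1] c0 [l0 [e0 e1] t0]] := fib_lin fQ par k.
have [_ _ _ _ [l1 _ _]] := fib_lin fQ par k.+1.
apply: le_expRW (res22_le (e := - lnh (Q k) - lnh (Q k.+1) + d * lnh (Q k))
  (fs_size fQ k) (fs_size fQ k.+1) (fib_seq_height_le k fQ) (fib_seq_height_le k.+1 fQ)
  (fib_seq_val_le k tr fQ) (fib_seq_val_le k.+1 tr fQ) _ _ _) _.
- by clear -l0; lra.
- by clear -l1 z0 x0 y0 e1 t0; lra.
- by clear -x0 y0 t0; lra.
- by clear -c0 k0; lra.
Qed.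

(** A smaller value would make the resultant of Q_k and Q_(k+1) less than 1; hence [fs_val] is
    sharp. *)
Lemma fib_val_ge d M Q k : transcendental zeta -> fib_seq zeta d M Q ->
  fib_param zeta d M ->
  - (lnh (Q k) + 2 * lnh (Q k.+1)) - d * lnh (Q k) <= lnv (Q k).
Proof.
move=> tr fQ par; rewrite leNgt; apply/negP => contra; have k0 := taylor_const_ge0 zeta.
have [x0 [y0 y1] [z0 z1] c0 [l0 [e0 e1] t0]] := fib_lin fQ par k.
have [_ _ _ _ [l1 _ _]] := fib_lin fQ par k.+1.
move/eqP: (fs_res fQ k); apply.
apply: (int_small_eq0 (res22_le (e := - lnh (Q k) - lnh (Q k.+1) - d * lnh (Q k))
  (fs_size fQ k) (fs_size fQ k.+1) (fib_seq_height_le k fQ) (fib_seq_height_le k.+1 fQ)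
  (fib_seq_val_le k tr fQ) (fib_seq_val_le k.+1 tr fQ) _ _ _)).
- by clear -contra; lra.
- by clear -l1 z0 x0 y0 e1 t0; lra.
- by clear -x0 y0 k0 c0; lra.
- by clear -c0 k0; lra.
Qed.

(** The ranges for [lnh S] are shifted by the factor [1 - 60 * d]: near the height of Q_(k+2) the
    term B Q_(k+1) would catch up with A Q_k. The price is paid at the lower end, where it enters
    the [200 * d]. *)
Lemma cubic_lower d M Q (S : {poly int}) : transcendental zeta ->
  fib_seq zeta d M Q -> fib_param zeta d M -> linear_bound zeta d (d * M) ->
  cubic_poly S -> (1 - 60 * d) * lnh (Q 1) <= lnh S ->
  - (3 + 200 * d) * lnh S <= lnv S.
Proof.
move=> tr fQ par lb cS big; have [[S0 _ _] sS] := cS.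
have [d0 d1 M1 _] := par; have k0 := taylor_const_ge0 zeta.
have [|k /andP[lo hi]] := fib_locate fQ par _ big; first by clear -d1; lra.
have hS := lnh_ge0 R S0.
(* When S(zeta) is below H(S)^-3, the terms of Cramer's rule that contain it do not exceed the
   bounds claimed for [A] and [B]. *)
case: (lerP (- 3 * lnh S) (lnv S)) => [le3|sm].
  have dS : 0 <= d * lnh S by rewrite mulr_ge0// ltW.
  by clear -le3 dS; lra.
have [x0 [y0 y1] [z0 z1] c0 [l0 [e0 e1] t0]] := fib_lin fQ par k.
have [_ _ _ _ [l1 [e0' e1'] _]] := fib_lin fQ par k.+1.
have sS4 := eq_leq sS.
have [s0 s1] := (fs_size fQ k, fs_size fQ k.+1).
have D0 := fs_res fQ k.
have [A [B [sA sB E]]] := sylvester_solve s0 s1 sS4.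
have A0 : A != 0.
  apply/eqP => A0; apply: (cubic_not_split cS D0 sB s1).
  by rewrite E A0 mul0r add0r.
have D0' : res22 (Q k.+1) (Q k) != 0 by rewrite res22C.
have E' : res22 (Q k.+1) (Q k) *: S = B * Q k.+1 + A * Q k by rewrite res22C E addrC.
have MX : d * M <= d * lnh (Q k) by rewrite ler_pM2l// (fs_big fQ).
have vQ := fib_val_ge k tr fQ par.
have dx : 0 <= d * lnh (Q k) by clear -c0 k0; lra.
have hA : lnh A <= lnh S - lnh (Q k) + 2 * (d * lnh (Q k)).
  rewrite -ler_expR lnhK//.
  apply: le_trans (sylvester_height_le (e := lnh S - lnh (Q k) + d * lnh (Q k))
   s1 s0 sB sA D0' E' (fib_seq_height_le k.+1 fQ) (fib_seq_height_le k fQ) (height_lnh R S0)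
   (fib_seq_val_le k.+1 tr fQ) (fib_seq_val_le k tr fQ) (tc0_le tr sS4 S0) _ _ _) _.
  - by clear -sm lo x0 y0 e1 t0; lra.
  - by clear -l1 z0 x0 y0 e1 t0; lra.
  - by clear -l0; lra.
  - by rewrite ler_expR; clear -c0 k0; lra.
have hB : (height B)%:R <= expR (lnh S - lnh (Q k.+1) + 2 * (d * lnh (Q k))).
  apply: le_trans (sylvester_height_le (e := lnh S - lnh (Q k.+1) + d * lnh (Q k))
   s0 s1 sA sB D0 E (fib_seq_height_le k fQ) (fib_seq_height_le k.+1 fQ) (height_lnh R S0)
   (fib_seq_val_le k tr fQ) (fib_seq_val_le k.+1 tr fQ) (tc0_le tr sS4 S0) _ _ _) _.
  - by clear -sm lo x0 y0 e1 t0; lra.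
  - by clear -l0; lra.
  - by clear -l1 z0 x0 y0 e1 t0; lra.
  - by rewrite ler_expR; clear -c0 k0; lra.
have dw : 0 <= d * lnh (Q k.+2) by clear -e0 e0' dx; lra.
have dA : d * lnh A <= d * (2 * lnh (Q k)).
  apply: ler_wpM2l; first exact: ltW.
  by clear -hA hi z1 y1 t0 x0 dw; lra.
(* The linear bound gives A(zeta) at least about H(Q_k) / H(S), and [fib_val_ge] bounds Q_k(zeta)
   from below; H(Q_k) cancels in the product. *)
pose T := - lnh S - 2 * lnh (Q k.+1) - 8 * (d * lnh (Q k)).
have T1 : T <= lnv A + lnv (Q k).
  by have vA := lb A A0 sA; rewrite /T; clear -vA hA dA MX vQ dx; lra.
have [vB _ _ _] := taylor_le zeta hB.
have T2 : `|tc0 B * tc0 (Q k.+1)| <= expR (T - 1).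
  apply: le_expRW (le_expRM vB (fib_seq_val_le k.+1 tr fQ)) _; rewrite /T.
  by clear -l1 hi z0 z1 e0 e0' e1 c0 k0; lra.
have T3 : expR T <= `|tc0 A * tc0 (Q k)|.
  have [<- _ _ _] := taylor_mul zeta sA s0.
  have AQ0 : A * Q k != 0 by rewrite mulf_neq0// (fs_neq0 fQ).
  rewrite -lnvK//; last by rewrite (@size_mul_lin _ _ 1 2).
  by rewrite lnv_mul// ler_expR.
have T4 : expR (T - 1) <= `|(res22 (Q k) (Q k.+1))%:~R * tc0 S|.
  have [<- _ _ _] := taylorZ zeta (res22 (Q k) (Q k.+1)) S.
  rewrite E; have [-> _ _ _] := taylorD zeta (A * Q k) (B * Q k.+1).
  have [-> _ _ _] := taylor_mul zeta sA s0; have [-> _ _ _] := taylor_mul zeta sB s1.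
  have := ler_normB (tc0 A * tc0 (Q k) + tc0 B * tc0 (Q k.+1)) (tc0 B * tc0 (Q k.+1)).
  rewrite addrK => tri.
  have eT : 2 * expR (T - 1) <= expR T.
    have -> : expR T = expR 1 * expR (T - 1) by rewrite -expRD addrC subrK.
    by rewrite ler_pM2r ?expR_gt0// (le_trans _ (expR_ge1Dx _)).
  by clear -T2 T3 tri eT; lra.
have T5 : T - 1 <= 2 * (d * lnh (Q k)) + lnv S.
  rewrite -ler_expR; apply: (le_trans T4).
  by apply: le_expRM; [exact: fib_res_le tr fQ par|exact: tc0_le].
have dS : d * ((1 - 60 * d) * lnh (Q k.+1)) <= d * lnh S by rewrite ler_pM2l.
have dd : 0 <= (1 / 10 / 10 / 10 - d) * (d * lnh (Q k.+1)).
  by apply: mulr_ge0; [rewrite subr_ge0|clear -e0 dx; lra].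
by rewrite /T in T5; clear -T5 lo dS dd e0 c0 k0; lra.
Qed.

Lemma cubic_gap d M Q (e : R) k : transcendental zeta -> fib_seq zeta d M Q ->
  fib_param zeta d M -> 0 < e -> e <= 1 -> 100 * d <= e ->
  ~ exists S : {poly int}, [/\ cubic_poly S, lnh S <= (1 - e / 10) * lnh (Q k.+1) &
      lnv S <= - (2 * g - 1 + e) * ((1 - e / 10) * lnh (Q k.+1))].
Proof.
move=> tr fQ par e0 e1 de [S [cS hS vS]]; have [[S0 _ _] sS] := cS.
have k0 := taylor_const_ge0 zeta.
have [x0 [y0 y1] [z0 z1] c0 [l0 [f0 f1] t0]] := fib_lin fQ par k.
have [_ _ _ _ [l1 _ _]] := fib_lin fQ par k.+1.
have sS4 := eq_leq sS.
have [s0 s1] := (fs_size fQ k, fs_size fQ k.+1).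
have D0 := fs_res fQ k.
have [A [B [sA sB E]]] := sylvester_solve s0 s1 sS4.
suff B0 : B = 0.
  by apply: (cubic_not_split cS D0 sA s0); rewrite E B0 mul0r addr0.
have v0 : 0 < lnh (Q k.+1) by clear -x0 y0; lra.
have dx : 0 <= d * lnh (Q k) by clear -c0 k0; lra.
have /andP[gl gu] := golden_bounds R; have g2 := golden_sqr R.
(* This is [fs_golden] multiplied by g - 1, the inverse of g. *)
have ux : lnh (Q k) <= (g - 1) * lnh (Q k.+1) + d * lnh (Q k).
  have := fs_golden fQ k; rewrite ler_norml => /andP[h _].
  have g1 : 0 <= g - 1 by clear -gl; lra.
  have := ler_wpM2l g1 h.
  have -> : (g - 1) * (lnh (Q k.+1) - g * lnh (Q k)) = (g - 1) * lnh (Q k.+1) - lnh (Q k).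
    by have := congr1 ( *%R^~ (lnh (Q k))) g2; clear; lra.
  have : 0 <= (2 - g) * (d * lnh (Q k)) by apply: mulr_ge0; [clear -gu; lra|].
  by clear; lra.
have ev : 0 <= (e - 100 * d) * lnh (Q k.+1) by rewrite mulr_ge0 ?subr_ge0// ltW.
have ev0 : 0 <= e * lnh (Q k.+1) by rewrite mulr_ge0// ltW.
have gev : 0 <= (13 / 8 - g) * (e * lnh (Q k.+1)) by rewrite mulr_ge0// subr_ge0 ltW.
have eev : 0 <= (1 - e) * (e * lnh (Q k.+1)) by rewrite mulr_ge0// subr_ge0.
(* The term of S(zeta) has exponent 2 (g - 1) + 1 - (2 g - 1 + e)(1 - e/10) relative to
   [lnh (Q k.+1)], and that of Q_k(zeta) has -e/10. The first is also below -e/10, as 2 g - 1 is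
   less than 9/4. *)
have : (height B)%:R <= expR (- (d * lnh (Q k))).
  apply: le_trans (sylvester_height_le (e := - (e / 10 * lnh (Q k.+1)) + 2 * (d * lnh (Q k)))
   s0 s1 sA sB D0 E (fib_seq_height_le k fQ) (fib_seq_height_le k.+1 fQ) (height_lnh R S0)
   (fib_seq_val_le k tr fQ) (fib_seq_val_le k.+1 tr fQ) (tc0_le tr sS4 S0) _ _ _) _.
  - by clear -vS ux gev eev ev0; lra.
  - by clear -l0 hS dx; lra.
  - by clear -l1 hS z0 x0 y0 f1 t0 dx; lra.
  - by rewrite ler_expR; clear -ev c0 k0 f0; lra.
apply: contraPP => /eqP B0; apply/negP; rewrite -ltNge.
apply: (@lt_le_trans _ _ 1); last by rewrite ler1n height_gt0.
by rewrite expR_lt1; clear -c0 k0; lra.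
Qed.

End CubicBounds.

(** * Cubics with small value and large derivative at zeta *)

Section CubicConstruction.
Variables (R : realType) (zeta : R).

Local Notation tc0 := (taylor0 zeta).
Local Notation tc1 := (taylor1 zeta).
Local Notation tc2 := (taylor2 zeta).
Local Notation kappa := (taylor_const zeta).
Local Notation lnv := (lnv zeta).
Local Notation lnh := (@lnh R).

Implicit Types (d M : R) (Q : nat -> {poly int}).

(** The derivative of Q_(k+1) at zeta is almost as large as the height. This is what later turns a
    small value of a cubic into a close root. *)
Lemma fib_tc1_ge d M Q k (c : R) : transcendental zeta ->
  fib_seq zeta d M Q -> fib_param zeta d M ->
  `|tc1 (Q k.+1)| <= expR c ->
  lnh (Q k.+1) - 2 * (d * lnh (Q k)) <= c.
Proof.
move=> tr fQ par hc; have k0 := taylor_const_ge0 zeta.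
have [x0 [y0 y1] [z0 z1] c0 [l0 [e0 e1] t0]] := fib_lin fQ par k.
have [_ _ _ _ [l1 _ _]] := fib_lin fQ par k.+1.
have lo := fib_val_ge k tr fQ par.
have := res22_neq0_tc1 (fs_size fQ k) (fs_size fQ k.+1) (fs_res fQ k) (fib_seq_height_le k fQ)
  (fib_seq_height_le k.+1 fQ) (fib_seq_val_le k tr fQ) (fib_seq_val_le k.+1 tr fQ) _ hc.
have -> : lnv (Q k.+1) + lnh (Q k) <= lnv (Q k) + lnh (Q k.+1).
  by clear -l1 lo z0 y0 x0 e1 t0; lra.
have -> : 2 * (kappa + lnv (Q k) + lnh (Q k.+1) + 1) + 1 < 0.
  by clear -l0 t0 x0 y0 c0 k0; lra.
have -> : 3 * kappa + lnv (Q k.+1) + 2 * lnh (Q k) + lnh (Q k.+1) + 3 < 0.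
  by clear -l1 z0 y0 x0 e1 t0 c0 k0; lra.
by move=> /(_ isT isT isT); clear -l0 c0 k0; lra.
Qed.

Lemma fib_wedge_neq0 d M Q k : transcendental zeta ->
  fib_seq zeta d M Q -> fib_param zeta d M ->
  wedge (Q k) (Q k.+1) 1 2 != 0.
Proof.
move=> tr fQ par; apply/eqP => W0; have k0 := taylor_const_ge0 zeta.
have [x0 [y0 y1] [z0 z1] c0 [l0 [e0 e1] dx]] := fib_lin fQ par k.
have [_ _ _ _ [l1 _ _]] := fib_lin fQ par k.+1.
pose e := - lnh (Q k) - lnh (Q k.+1) + d * lnh (Q k).
have := res22_neq0_wedge (e := e) (w := - (kappa + e + 3)) (fs_size fQ k) (fs_size fQ k.+1)
  (fs_res fQ k) (fib_seq_height_le k fQ) (fib_seq_height_le k.+1 fQ)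
  (fib_seq_val_le k tr fQ) (fib_seq_val_le k.+1 tr fQ).
rewrite W0 normr0 expR_ge0 /e.
have -> : lnv (Q k) + lnh (Q k.+1) <= - lnh (Q k) - lnh (Q k.+1) + d * lnh (Q k).
  by clear -l0; lra.
have -> : lnv (Q k.+1) + lnh (Q k) <= - lnh (Q k) - lnh (Q k.+1) + d * lnh (Q k).
  by clear -l1 z0 x0 y0 e1 dx; lra.
have -> : 2 * (kappa + (- lnh (Q k) - lnh (Q k.+1) + d * lnh (Q k)) + 1) + 1 < 0.
  by clear -x0 y0 dx c0 k0; lra.
by move=> /(_ isT isT isT isT); clear; lra.
Qed.

(* The linear polynomial obtained by eliminating T^2 between Q_k and Q_(k+1). *)
Lemma fib_linear_form d M Q k : transcendental zeta ->
  fib_seq zeta d M Q -> fib_param zeta d M ->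
  exists A : {poly int},
  [/\ size A = 2%N, lnh A <= lnh (Q k) + lnh (Q k.+1) + d * lnh (Q k) &
      lnv A <= - (lnh (Q k) + lnh (Q k.+1)) + 2 * (d * lnh (Q k))].
Proof.
move=> tr fQ par; have k0 := taylor_const_ge0 zeta; have W0 := fib_wedge_neq0 k tr fQ par.
pose A := (wedge (Q k) (Q k.+1) 0 2)%:P + (wedge (Q k) (Q k.+1) 1 2)%:P * 'X.
have sA : (size A <= 2)%N := size_lin _ _.
have A1 : A`_1 = wedge (Q k) (Q k.+1) 1 2 by rewrite coef_lin.
have A0 : A != 0 by apply: contraNneq W0 => A0; rewrite -A1 A0 coef0.
have [x0 [y0 y1] [z0 z1] c0 [l0 [e0 e1] dx]] := fib_lin fQ par k.
have [_ _ _ _ [l1 _ _]] := fib_lin fQ par k.+1.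
have := wedge_tc_le (e := - lnh (Q k) - lnh (Q k.+1) + d * lnh (Q k)) (fib_seq_height_le k fQ) (fib_seq_height_le k.+1 fQ)
  (fib_seq_val_le k tr fQ) (fib_seq_val_le k.+1 tr fQ).
have -> : lnv (Q k) + lnh (Q k.+1) <= - lnh (Q k) - lnh (Q k.+1) + d * lnh (Q k).
  by clear -l0; lra.
have -> : lnv (Q k.+1) + lnh (Q k) <= - lnh (Q k) - lnh (Q k.+1) + d * lnh (Q k).
  by clear -l1 z0 x0 y0 e1 dx; lra.
move=> /(_ isT isT)[_ w02 w12].
have t0 : tc0 A = tc0 (Q k) * tc2 (Q k.+1) - tc2 (Q k) * tc0 (Q k.+1).
  have [-> _ _ _] := taylor_lin zeta sA.
  have [-> _ -> _] := taylor_quad zeta (fs_size fQ k).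
  have [-> _ -> _] := taylor_quad zeta (fs_size fQ k.+1).
  by rewrite /coefR !coef_lin /wedge !(rmorphB, rmorphM) /=; ring.
have t1 : tc1 A = tc1 (Q k) * tc2 (Q k.+1) - tc2 (Q k) * tc1 (Q k.+1).
  have [_ -> _ _] := taylor_lin zeta sA.
  by rewrite /coefR A1 (wedge12_tc zeta (fs_size fQ k) (fs_size fQ k.+1)).
rewrite -t0 in w02; rewrite -t1 in w12.
exists A; split.
- apply/eqP; rewrite eqn_leq sA ltnNge; apply/negP => /leq_sizeP/(_ 1%N (leqnn _)).
  by rewrite A1; apply/eqP.
- rewrite -ler_expR lnhK//.
  apply: le_trans (lin_height_le sA _ w12) _; last by rewrite ler_expR; clear -c0 k0; lra.
  by apply: le_expRW w02 _; clear -dx x0 y0 k0; lra.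
- rewrite -ler_expR lnvK//; last by rewrite (leq_trans sA).
  by apply: le_expRW w02 _; clear -c0 k0; lra.
Qed.

Lemma height_add_le (P S : {poly int}) (e : R) : (height P)%:R <= expR e ->
  (height S)%:R <= expR e -> (height (P + S))%:R <= expR (e + 1).
Proof.
move=> hP hS; have [i hi] := height_ex (P + S).
have -> : (height (P + S))%:R = `|coefR R (P + S) i|.
  by rewrite hi /coefR -intr_norm -abszE -pmulrn.
rewrite /coefR coefD intrD; apply: le_expRD.
  exact: le_trans (coefR_le R P i) hP.
exact: le_trans (coefR_le R S i) hS.
Qed.

(** Otherwise Q_k would be linear, with a value far below what [linear_bound] permits. *)
Lemma fib_lead_neq0 d M Q k : fib_seq zeta d M Q -> fib_param zeta d M ->
  linear_bound zeta d (d * M) -> (Q k)`_2 != 0.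
Proof.
move=> fQ par lb; apply/eqP => q2.
have sQ : (size (Q k) <= 2)%N.
  apply/leq_sizeP => -[|[|[|j]]]// _.
  by rewrite nth_default// (leq_trans (fs_size fQ k)).
have [d0 d1 _ _] := par; have k0 := taylor_const_ge0 zeta.
have MX : d * M <= d * lnh (Q k) by rewrite ler_pM2l// (fs_big fQ).
have vQ := lb _ (fs_neq0 fQ k) sQ.
have [x0 [y0 y1] _ c0 [l0 _ dx]] := fib_lin fQ par k.
by clear -vQ MX x0 y0 l0 dx; lra.
Qed.

Lemma cubic_construction d M Q k : transcendental zeta ->
  fib_seq zeta d M Q -> fib_param zeta d M -> linear_bound zeta d (d * M) ->
  let q := lnh (Q k.+4) in
  exists S : {poly int}, [/\ size S = 4%N,
    forall L N : {poly int}, size L = 2%N -> size N = 3%N -> S <> L * N,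
    lnh S <= q + 3 * (d * q), lnv S <= - 3 * q + 3 * (d * q) &
    expR (q - 3 * (d * q)) <= `|tc1 S|].
Proof.
move=> tr fQ par lb q; have k0 := taylor_const_ge0 zeta; have [d0 d1 M1 _] := par.
(* The form is taken three indices back: its height, about H(Q_k) H(Q_(k+1)) and so about
   H(Q_(k+2)), is the required quotient of the heights of Q_(k+4) and Q_(k+3). *)
have [A [sA hA vA]] := fib_linear_form k tr fQ par.
have sA2 := eq_leq sA.
have A0 : A != 0 by rewrite -size_poly_eq0 sA.
have A1 : A`_1 != 0.
  by have := lead_coef_eq0 A; rewrite lead_coefE sA /= (negbTE A0) => ->.
pose S := A * Q k.+3 + Q k.+4.
have [s3 s4] := (fs_size fQ k.+3, fs_size fQ k.+4).
have [n3 n4] := (fs_neq0 fQ k.+3, fs_neq0 fQ k.+4).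
have D0 := fs_res fQ k.+3.
have sAQ : (size (A * Q k.+3)%R <= 4)%N by rewrite (@size_mul_lin _ _ 1 2).
have sS4 : (size S <= 4)%N.
  by rewrite (leq_trans (size_polyD _ _))// geq_max sAQ (leq_trans s4).
have S3 : S`_3 != 0.
  rewrite /S coefD; have [_ _ _ ->] := coef_mul_lin sA2 s3.
  by rewrite [(Q k.+4)`_3]nth_default// addr0 mulf_neq0// (fib_lead_neq0 _ fQ par lb).
have sS : size S = 4%N.
  apply/eqP; rewrite eqn_leq sS4 ltnNge; apply/negP => /leq_sizeP/(_ 3%N (leqnn _)).
  by apply/eqP.
have S0 : S != 0 by rewrite -size_poly_eq0 sS.
pose p := lnh (Q k.+3).
have [v4 v3 [qp qp'] big [pq uvq uvq' dq [uq pq2]]] : [/\ lnv (Q k.+4) <= - (7 / 2) * q,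
    lnv (Q k.+3) <= - (p + 2 * q) + d * p, 3 / 2 * p <= q /\ q <= 17 / 10 * p,
    10 * kappa + 50 <= d * p & [/\ d * p <= 2 / 3 * (d * q),
    q <= p + (lnh (Q k) + lnh (Q k.+1)) + d * q,
    p + (lnh (Q k) + lnh (Q k.+1)) <= q + d * q, d * q <= q / 10 / 10 / 10 & 2 * (d * lnh (Q k)) <= d * q /\
    p <= (lnh (Q k) + lnh (Q k.+1)) * 2]].
  have [a0 [a1 a1'] [a2 a2'] _ [_ [a5 a5'] _]] := fib_lin fQ par k.
  have [_ [b1 b1'] [b2 b2'] _ [_ [b5 b5'] _]] := fib_lin fQ par k.+1.
  have [_ [c1 c1'] [c2 c2'] _ [_ [c5 c5'] _]] := fib_lin fQ par k.+2.
  have [_ e1 _ e3 [e4 [e5 e5'] _]] := fib_lin fQ par k.+3.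
  have [f0 [f1 f1'] _ f3 [f4 [f5 f5'] f6]] := fib_lin fQ par k.+4.
  rewrite /q /p; split=> //; first by clear -f4 f1 f6 f0; lra.
  split=> //.
  - by clear -e5; lra.
  - by clear -c2' a2' c5 e5 b5 a5 e3 k0; lra.
  - by clear -c2 a2 c5 e5 b5 a5 e3 k0; lra.
  - split; first by clear -a5 b5 c5 e5 e3 k0; lra.
    by clear -b2' a2' a1 a0 a5' a5 b5 c5 e5 f6 c1' b1' a1' e1; lra.
have q0 : 0 <= d * q by clear -pq big k0; lra.
have hS : (height S)%:R <= expR (q + 3 * (d * q)).
  apply: le_trans (height_add_le (e := q + 2 * (d * q)) _ _) _.
  - apply: le_trans (lnh_mul_le R sA2 s3 A0 n3) _; rewrite ler_expR -/p.
    by clear -hA uvq' uq big pq k0; lra.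
  - by apply: le_trans (fib_seq_height_le k.+4 fQ) _; rewrite ler_expR -/q; clear -q0; lra.
  - by rewrite ler_expR; clear -big pq k0; lra.
have t0Q i := fib_seq_val_le i tr fQ.
have vS : lnv S <= - 3 * q + 3 * (d * q).
  rewrite -ler_expR lnvK// /S; have [-> _ _ _] := taylorD zeta (A * Q k.+3) (Q k.+4).
  have [-> _ _ _] := taylor_mul zeta sA2 s3.
  apply: le_expRW (_ : - 3 * q + (8 / 3) * (d * q) + 1 <= _); last by clear -big pq k0; lra.
  apply: le_expRD.
    apply: le_expRW (le_expRM (tc0_le tr (leq_trans sA2 _) A0) (t0Q k.+3)) _ => //.
    by clear -vA v3 uvq uq pq; lra.
  by apply: le_expRW (t0Q k.+4) _; clear -v4 q0 dq; lra.
exists S; split=> //.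
- move=> L N sL sN ES.
  have L0 : L != 0 by rewrite -size_poly_eq0 sL.
  have N0 : N != 0 by rewrite -size_poly_eq0 sN.
  have [sL2 sN3] := (eq_leq sL, eq_leq sN).
  have LN0 : L * N != 0 by rewrite mulf_neq0.
  have hLN : lnh L + lnh N <= q + 3 * (d * q) + 2.
    apply: le_trans (lnh_mul R sL2 sN3 LN0) _; rewrite lerD2r -ES.
    by rewrite -ler_expR lnhK.
  have [hL hN] := (lnh_ge0 R L0, lnh_ge0 R N0).
  have vLN : lnv S = lnv L + lnv N by rewrite ES lnv_mul.
  have vL := lb _ L0 sL2.
  have MX : d * M <= d * p by rewrite ler_pM2l// (fs_big fQ).
  have dL : d * lnh L <= d * (2 * q) by rewrite ler_pM2l//; clear -hLN hN dq big pq k0; lra.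
  (* By the bound for linear forms L(zeta) is not much smaller than 1 / H(L), so [N] inherits enough
     smallness from [S] to make the determinant less than 1. *)
  have det0 : det3 N (Q k.+3) (Q k.+4) = 0.
    apply: (det3_eq0 (e := - q / 10) sN3 s3 s4 (height_lnh R N0) (fib_seq_height_le _ fQ)
      (fib_seq_height_le _ fQ) (tc0_le tr (leq_trans sN3 (leqnSn 3)) N0) (t0Q _) (t0Q _));
      rewrite -/p -/q.
    - by clear -vLN vS vL hLN hN MX dL pq qp dq big k0; lra.
    - by clear -v3 hLN hL pq qp' dq big k0; lra.
    - by clear -v4 hLN hL pq qp dq big k0; lra.
    - by clear -dq big pq k0; lra.
  have comb := det3_combine sN3 s3 s4 det0.
  set n := wedge (Q k.+3) _ 1 2 in comb; set al := wedge N _ 1 2 in comb.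
  set be := wedge _ N 1 2 in comb.
  (* Two representations of n S through Q_(k+3) and Q_(k+4) must agree. At Q_(k+4) this says that
     the constant n equals be L with [L] of degree 1, so [be] and n vanish. *)
  have : (n *: A - al *: L) * Q k.+3 + (n%:P - be *: L) * Q k.+4 = 0.
    have : n *: S = L * (al *: Q k.+3 + be *: Q k.+4) by rewrite -comb ES -scalerAr.
    by rewrite /S -!mul_polyC => E; rewrite -[RHS](subrr (n%:P * (A * Q k.+3 + Q k.+4))) {2}E; ring.
  have szl (a : int) (P : {poly int}) : (size P <= 2)%N -> (size (a *: P)%R <= 2)%N.
    by move=> sP; rewrite (leq_trans (size_scale_leq _ _)).
  move/(sylvester_inj s3 s4 _ _ D0) => [||_ E].
  - by rewrite (leq_trans (size_polyD _ _))// geq_max size_polyN !szl.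
  - by rewrite (leq_trans (size_polyD _ _))// geq_max size_polyN szl// (leq_trans (size_polyC_leq1 _)).
  have L1 : L`_1 != 0.
    by have := lead_coef_eq0 L; rewrite lead_coefE sL /= (negbTE L0) => ->.
  have be0 : be = 0.
    apply/eqP; have /eqP := congr1 (fun P : {poly int} => P`_1) E.
    by rewrite coefB coefC coefZ coef0 /= sub0r oppr_eq0 mulf_eq0 (negbTE L1) orbF.
  have /eqP := fib_wedge_neq0 k.+3 tr fQ par; apply; rewrite -/n.
  by have := congr1 (fun P : {poly int} => P`_0) E; rewrite be0 scale0r subr0 coefC coef0.
- by rewrite -ler_expR lnhK.
- rewrite leNgt; apply/negP => lt.
  have [_ a1 _ _] := taylor_le zeta (height_lnh R A0).
  have [_ q1 _ _] := taylor_le zeta (fib_seq_height_le k.+3 fQ).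
  have sm : `|tc1 (A * Q k.+3)| <= expR (q - 3 * (d * q)).
    have [_ -> _ _] := taylor_mul zeta sA2 s3.
    apply: le_expRW (_ : q - 4 * (d * q) + 1 <= _); last by clear -big pq k0; lra.
    apply: le_expRD.
      apply: le_expRW (le_expRM (tc0_le tr (leq_trans sA2 _) A0) q1) _ => //.
      by rewrite -/p; clear -vA uq pq2 qp dq big pq k0; lra.
    by apply: le_expRW (le_expRM a1 (t0Q k.+3)) _; clear -hA v3 uvq' uq pq dq big k0 qp' q0; lra.
  have : `|tc1 (Q k.+4)| <= expR (q - 3 * (d * q) + 1).
    have -> : tc1 (Q k.+4) = tc1 S - tc1 (A * Q k.+3).
      by rewrite /S; have [_ -> _ _] := taylorD zeta (A * Q k.+3) (Q k.+4); rewrite addrC addKr.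
    by apply: le_expRB => //; apply: ltW.
  by move/(fib_tc1_ge tr fQ par); rewrite -/p -/q; clear -big pq k0; lra.
Qed.

End CubicConstruction.

(** * Algebraic numbers *)

Section ComplexRoots.
Variables (R : realType) (zeta : R).
Implicit Types (P : {poly int}) (alpha : R[i]).

Local Notation tc0 := (taylor0 zeta).
Local Notation tc1 := (taylor1 zeta).
Local Notation tc2 := (taylor2 zeta).
Local Notation tc3 := (@taylor3 R).
Local Notation kappa := (taylor_const zeta).
Local Notation lnh := (@lnh R).
Local Notation toC := (real_complex R).
Local Notation normc := ComplexField.Normc.normc.

Lemma normc_ge0 alpha : 0 <= normc alpha.
Proof. by case: alpha => a b; apply: sqrtr_ge0. Qed.

Lemma normc_real (r : R) : normc (toC r) = `|r|.
Proof. by rewrite /normc /= expr0n addr0 sqrtr_sqr. Qed.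

Lemma coefR_toC P i : toC (coefR R P i) = (P`_i)%:~R.
Proof. by rewrite /coefR rmorph_int. Qed.

Lemma evalZ_taylor P alpha : (size P <= 4)%N -> let t := alpha - toC zeta in
  evalZ P alpha = toC (tc0 P) + toC (tc1 P) * t + toC (tc2 P) * t ^+ 2 + toC (tc3 P) * t ^+ 3.
Proof.
move=> sP t; rewrite /evalZ (@horner_coef_wide _ 4); last first.
  by rewrite (leq_trans (size_poly _ _)).
rewrite !big_ord_recl big_ord0 /= !coef_map /bump /=.
rewrite /taylor0 /taylor1 /taylor2 /taylor3 !(rmorphD, rmorphM, rmorphXn) /= !coefR_toC.
by rewrite /t; ring.
Qed.

Lemma root_close P alpha : P != 0 -> (size P <= 4)%N -> evalZ P alpha = 0 ->
  cdist zeta alpha <= 1 -> `|tc0 P| <= cdist zeta alpha * expR (kappa + lnh P + 2).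
Proof.
move=> P0 sP ev dist1.
have [_ t1 t2 t3] := taylor_le zeta (height_lnh R P0).
set t := toC zeta - alpha.
have E : toC (tc0 P) = t * (toC (tc1 P) - t * toC (tc2 P) + t ^+ 2 * toC (tc3 P)).
  have := evalZ_taylor alpha sP; rewrite ev /= -/(- t) => /esym/eqP.
  rewrite -!addrA addr_eq0 => /eqP ->; rewrite /t; ring.
rewrite -normc_real E ComplexField.Normc.normcM ler_wpM2l ?normc_ge0//.
have nt : normc t <= 1 by [].
have tle (z : R[i]) (e : R) : normc z <= expR e -> normc (t * z) <= expR e.
  by move=> h; rewrite ComplexField.Normc.normcM (le_trans _ h)// ler_piMl// normc_ge0.
have addle (z w : R[i]) (e : R) : normc z <= expR e -> normc w <= expR e ->
    normc (z + w) <= expR (e + 1).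
  move=> hz hw; apply: le_trans (le_normcD _ _) _.
  have := @le_expRD R (normc z) (normc w) e.
  rewrite !ger0_norm ?addr_ge0 ?normc_ge0//; exact.
have nr (r e : R) : `|r| <= expR e -> normc (toC r) <= expR e by rewrite normc_real.
apply: le_trans (addle _ _ (kappa + lnh P + 1) _ _) _; last by rewrite ler_expR; lra.
  apply: addle; first exact: nr.
  by rewrite -mulrN -rmorphN; apply: tle; apply: nr; rewrite normrN.
rewrite expr2 -mulrA; apply: (@le_trans _ _ (expR (kappa + lnh P))); last by rewrite ler_expR; lra.
exact: (tle _ _ (tle _ _ (nr _ _ t3))).
Qed.

(** P'(zeta) / P(zeta) is the sum of 1 / (zeta - a) over the three roots, and the nearest root gives
    the largest term. The proof multiplies out the denominators. *)
Lemma root_exists P : size P = 4%N -> exists2 alpha, evalZ P alpha = 0 &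
  cdist zeta alpha * `|tc1 P| <= 3 * `|tc0 P|.
Proof.
move=> sP.
pose p : {poly R[i]} := map_poly intr P.
have sp : size p = 4%N.
  rewrite size_map_poly_id0 ?sP// intr_eq0 lead_coef_eq0.
  by rewrite -size_poly_eq0 sP.
have [r Er] := closed_field_poly_normal p.
have l0 : lead_coef p != 0 by rewrite lead_coef_eq0 -size_poly_eq0 sp.
have sr : size r = 3%N.
  by move: sp; rewrite Er size_scale// size_prod_XsubC => -[].
have [a ar amin] : exists2 y, y \in r & forall z, z \in r -> cdist zeta y <= cdist zeta z.
  by case: r sr {Er} => // z r _; apply: seq_minimum (mem_head z r).
have pr : perm_eq r (a :: rem a r) by apply: perm_to_rem.
have srem : size (rem a r) = 2%N by rewrite size_rem// sr.
case: (rem a r) srem pr => // b [//|c [|//]] _ pr.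
have Ep : p = lead_coef p *: (('X - a%:P) * (('X - b%:P) * ('X - c%:P))).
  by rewrite [LHS]Er (perm_big _ pr) /= !big_cons big_nil mulr1.
have bmin : cdist zeta a <= cdist zeta b by apply: amin; rewrite (perm_mem pr) !inE eqxx orbT.
have cmin : cdist zeta a <= cdist zeta c by apply: amin; rewrite (perm_mem pr) !inE eqxx !orbT.
exists a; first by rewrite /evalZ -/p Ep hornerZ hornerM hornerXsubC subrr mul0r mulr0.
pose l := lead_coef p.
pose A := toC zeta - a; pose B := toC zeta - b; pose C := toC zeta - c.
have E0 : toC (tc0 P) = l * (A * (B * C)).
  have := evalZ_taylor (toC zeta) (eq_leq sP); rewrite /= subrr !expr0n !mulr0 !addr0 => <-.
  by rewrite /evalZ -/p Ep !hornerE.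
have E1 : toC (tc1 P) = l * (B * C + A * C + A * B).
  have -> : toC (tc1 P) = (p^`()).[toC zeta].
    rewrite (@horner_coef_wide _ 3); last first.
      by rewrite -ltnS -sp lt_size_deriv// -size_poly_eq0 sp.
    rewrite !big_ord_recl big_ord0 /= !coef_deriv !coef_map /bump /=.
    rewrite /taylor1 !(rmorphD, rmorphM, rmorphXn) /= !coefR_toC.
    by ring.
  rewrite Ep derivZ !derivM !derivXsubC !mul1r mulr1 hornerZ.
  by rewrite !(hornerXsubC, hornerM, hornerD) /A /B /C /l; ring.
have nA := normc_ge0 A; have nB := normc_ge0 B; have nC := normc_ge0 C.
have nl := normc_ge0 l.
rewrite -!normc_real E0 E1 !ComplexField.Normc.normcM.
rewrite /cdist -/A.
have hB : normc A <= normc B by []; have hC : normc A <= normc C by [].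
have : normc (B * C + A * C + A * B) <= normc B * normc C + normc A * normc C + normc A * normc B.
  apply: le_trans (le_normcD _ _) _; rewrite -!ComplexField.Normc.normcM lerD2r.
  exact: le_normcD.
move: (normc A) (normc B) (normc C) (normc l) (normc _) nA nB nC nl hB hC.
move=> x y z w s x0 y0 z0 w0 xy xz sl.
rewrite mulrCA [leRHS]mulrCA; apply: ler_wpM2l => //.
apply: le_trans (ler_wpM2l x0 sl) _.
have := ler_wpM2l (mulr_ge0 x0 y0) xz; have := ler_wpM2l (mulr_ge0 x0 z0) xy.
by lra.
Qed.

Lemma finite_roots P : P != 0 -> finite_set [set alpha : R[i] | evalZ P alpha = 0].
Proof.
move=> P0; pose p : {poly R[i]} := map_poly intr P.
have p0 : lead_coef p != 0.
  by rewrite lead_coef_eq0 map_poly_eq0_id0 ?intr_eq0 ?lead_coef_eq0.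
have [r Er] := closed_field_poly_normal p.
apply: (@sub_finite_set _ _ [set` r]); last exact: finite_seq.
move=> alpha /= /eqP; rewrite /evalZ -/p Er hornerZ mulf_eq0 (negbTE p0) /=.
by rewrite -[_ == 0]/(root _ _) root_prod_XsubC.
Qed.

Lemma cubic_numberP alpha : cubic_number alpha ->
  [/\ cubic_poly (minpolyZ alpha), evalZ (minpolyZ alpha) alpha = 0 &
      alg_height alpha = height (minpolyZ alpha)].
Proof.
move=> [alg deg]; have [irr _ ev] := minpolyZ_exists alg.
split=> //; split=> //; move: deg; rewrite /alg_degree.
by case: (size _) => // n /= ->.
Qed.

Lemma minpolyZ_cubic alpha P : cubic_poly P -> zcontents P = 1 -> evalZ P alpha = 0 ->
  cubic_number alpha /\ alg_height alpha = height P.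
Proof.
move=> [irr sP] c1 ev.
have P0 : P != 0 by rewrite -size_poly_eq0 sP.
have alg : algebraic alpha.
  exists (map_poly intr P).
    by rewrite map_poly_eq0_id0 ?intr_eq0 ?lead_coef_eq0.
  rewrite /root -map_poly_comp (_ : map_poly _ P = map_poly intr P) ?[_.[_]]ev//.
  by apply: eq_map_poly => z /=; rewrite ratr_int.
have E : minpolyZ alpha = P by apply: minpolyZ_unique (minpolyZ_exists alg) _; split.
by split; [split=> //; rewrite /alg_degree E sP|rewrite /alg_height E].
Qed.

End ComplexRoots.

(** * The three statements in logarithmic form *)

Section ExtremalNumbers.
Variables (R : realType) (zeta : R).
Hypothesis ex : extremal zeta.

Local Notation tc0 := (taylor0 zeta).
Local Notation tc1 := (taylor1 zeta).
Local Notation lnv := (lnv zeta).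
Local Notation lnh := (@lnh R).
Local Notation g := (golden R).

Let tr : transcendental zeta := ex.1.

Lemma extremal_fib_seq (d : R) : 0 < d -> d <= 1 / 10 / 10 / 10 ->
  exists M Q, [/\ fib_seq zeta d M Q, fib_param zeta d M & linear_bound zeta d (d * M)].
Proof.
move=> d0 d1; apply: (exists_fib_seq_linear tr d0 d1) => eta heta.
apply: (what2_uniform_exponent ex.2); move: heta; rewrite /golden; lra.
Qed.

Lemma cubic_approx_finite (e c : R) : 0 < e -> e <= 1 ->
  finite_set [set S : {poly int} | cubic_poly S /\ lnv S <= - (3 + e) * lnh S + c].
Proof.
move=> e0 e1; pose d := e / 10 / 10 / 10.
have [||M [Q [fQ par lb]]] := @extremal_fib_seq d; [by rewrite /d; lra|by rewrite /d; lra|].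
pose H := Num.max ((1 - 60 * d) * lnh (Q 1%N)) (2 * c / e).
apply: sub_finite_set (finite_height 4 (Num.bound (expR H))) => S /= [cS vS].
have [[S0 _ _] sS] := cS; split; first by rewrite sS.
rewrite -(ler_nat R) -lnhK//; apply: le_trans (ltW (archi_boundP (expR_ge0 _))).
rewrite ler_expR leNgt gt_max; apply/negP => /andP[h1 h2].
have := cubic_lower tr fQ par lb cS (ltW h1).
rewrite ltr_pdivrMr// in h2.
have : 0 <= e * lnh S by rewrite mulr_ge0 ?lnh_ge0// ltW.
by rewrite /d; lra.
Qed.

Lemma cubic_gap_large (e c M0 : R) : 0 < e -> e <= 1 -> exists X : R,
  [/\ M0 < X, 1 <= X & forall S : {poly int}, cubic_poly S -> (height S)%:R <= X ->
    lnv S <= - (Num.sqrt 5 + e) * ln X + c -> False].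
Proof.
(* Half of [e] is used for the gap; the other half absorbs [c]. *)
move=> e0 e1; pose f := e / 2; pose d := f / 10 / 10 / 10.
have [||M [Q [fQ par lb]]] := @extremal_fib_seq d; [by rewrite /d /f; lra|by rewrite /d /f; lra|].
have [k hk] := fib_unbounded (4 * (`|M0| + `|c| / f)) fQ par.
have [x1 [xk _] _ _ _] := fib_lin fQ par k.
pose y := (1 - f / 10) * lnh (Q k.+1).
have cf0 : 0 <= `|c| / f by rewrite divr_ge0// /f; lra.
have m0 : 0 <= `|M0| := normr_ge0 _.
have y1 : `|M0| + `|c| / f <= y.
  have : 0 <= (1 - f) * lnh (Q k.+1) by apply: mulr_ge0; rewrite /f; lra.
  by rewrite /y; lra.
have y2 : `|c| <= f * y.
  have : `|c| / f <= y by lra.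
  by rewrite ler_pdivrMr 1?mulrC// /f; lra.
exists (expR y); split.
- apply: lt_le_trans (expR_ge1Dx y); have := ler_norm M0; lra.
- by apply: le_trans (expR_ge1Dx y); lra.
move=> S cS hS vS; have [[S0 _ _] sS] := cS.
have f0 : 0 < f by rewrite /f; lra.
have f1 : f <= 1 by rewrite /f; lra.
have df : 100 * d <= f by rewrite /d; lra.
apply: (cubic_gap (k := k) tr fQ par f0 f1 df); exists S; split=> //.
  by rewrite -ler_expR lnhK.
rewrite expRK in vS; apply: le_trans vS _; rewrite -/y.
have -> : 2 * g - 1 = Num.sqrt 5 by rewrite /golden; lra.
have := ler_norm c; rewrite /f in y2 *; lra.
Qed.

Lemma lnv_lower_bounded n : exists b : R, forall S : {poly int},
  S != 0 -> (size S <= 4)%N -> (height S <= n)%N -> b <= lnv S.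
Proof.
have /finite_seqP[s Es] := finite_height 4 n.
have mem (S : {poly int}) : (size S <= 4)%N -> (height S <= n)%N -> S \in s.
  move=> h1 h2; have : [set` s] S by rewrite -Es.
  by [].
(* This only makes the list nonempty; the default value of [ln] at 0 can at most lower the
   minimum. *)
have s0 : (0 : {poly int}) \in s.
  by apply: mem; rewrite ?size_poly0//; have /eqP -> : height 0 == 0%N by rewrite height_eq0.
have [P _ hP] := seq_minimum (fun S => lnv S) s0.
by exists (lnv P) => S _ sS hS; apply: hP; apply: mem.
Qed.

Lemma cubic_irreducible (S : {poly int}) : size S = 4%N ->
  (forall L N : {poly int}, size L = 2%N -> size N = 3%N -> S <> L * N) ->
  cubic_poly (zprimitive S).
Proof.
move=> sS nf; have S0 : S != 0 by rewrite -size_poly_eq0 sS.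
have c1 : zcontents (zprimitive S) = 1 by rewrite zcontents_primitive S0.
have sz : size (zprimitive S) = 4%N by rewrite size_zprimitive.
split=> //; split; first by rewrite -size_poly_eq0 sz.
  by rewrite poly_unitE sz.
move=> A B E; have [uA uB] := zc_unit c1 E.
have AB0 : A * B != 0 by rewrite -E -size_poly_eq0 sz.
have [A0 B0] : A != 0 /\ B != 0 by move: AB0; rewrite mulf_eq0 negb_or => /andP.
have nz : zcontents S != 0 by rewrite zcontents_eq0.
have ES : S = A * (zcontents S *: B) by rewrite -scalerAr -E -zpolyEprim.
have ES' : S = B * (zcontents S *: A) by rewrite -scalerAr mulrC -E -zpolyEprim.
have szZ (P : {poly int}) : size (zcontents S *: P) = size P by apply: size_scale.
have sAB : ((size A + size B).-1 = 4)%N by rewrite -size_mul// -E.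
have : (0 < size A)%N by rewrite size_poly_gt0.
have : (0 < size B)%N by rewrite size_poly_gt0.
move=> B1 A1.
have [h|[[h h']|[[h h']|h]]] : size A = 1%N \/ size A = 2%N /\ size B = 3%N \/
    size B = 2%N /\ size A = 3%N \/ size B = 1%N.
  move: (size A) (size B) sAB A1 B1 => [|[|[|[|m]]]] [|[|[|[|n]]]]//; rewrite ?addSn ?addnS /=; lia.
- by left; apply: unitZ.
- by exfalso; apply: (nf A (zcontents S *: B)); rewrite ?szZ.
- by exfalso; apply: (nf B (zcontents S *: A)); rewrite ?szZ.
- by right; apply: unitZ.
Qed.

Lemma cubic_exists (e M0 : R) : 0 < e -> e <= 1 -> exists S : {poly int}, exists alpha : R[i],
  [/\ cubic_poly S, zcontents S = 1 /\ evalZ S alpha = 0, M0 < (height S)%:R,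
      lnv S <= (- 3 + e) * lnh S & cdist zeta alpha <= expR ((- 4 + e) * lnh S)].
Proof.
move=> e0 e1; pose d := e / 10 / 10 / 10.
have d0 : 0 < d by rewrite /d; lra.
have [|M [Q [fQ par lb]]] := extremal_fib_seq d0; first by rewrite /d; lra.
have [b hb] := lnv_lower_bounded (Num.bound M0).
have [k hk] := fib_unbounded (Num.max `|b| 1) fQ par.
move: hk; rewrite gt_max => /andP[bk k1].
have [T [sT nf hT vT t1]] := cubic_construction k tr fQ par lb.
set q := lnh (Q k.+4) in hT vT t1.
have [dq qk] : 50 <= d * q /\ lnh (Q k) <= q.
  have [? [? ?] _ _ _] := fib_lin fQ par k; have [? [? ?] _ _ _] := fib_lin fQ par k.+1.
  have [? [? ?] _ _ _] := fib_lin fQ par k.+2; have [? [? ?] _ _ _] := fib_lin fQ par k.+3.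
  have [? _ _ ? _] := fib_lin fQ par k.+4; have k0 := taylor_const_ge0 zeta.
  by rewrite /q; split; lra.
have q0 : 0 < q by lra.
have T0 : T != 0 by rewrite -size_poly_eq0 sT.
pose S := zprimitive T; pose n := zcontents T.
have ET : T = n *: S := zpolyEprim T.
have n0 : n != 0 by rewrite zcontents_eq0.
have n1 : 1 <= `|n%:~R : R| := int_norm_ge1 R n0.
have S0 : S != 0 by rewrite zprimitive_eq0.
have sS : size S = 4%N by rewrite size_zprimitive.
have cS : cubic_poly S := cubic_irreducible sT nf.
have hS : lnh S <= q + 3 * (d * q).
  apply: le_trans hT; rewrite ler_ln ?posrE ?ltr0n ?height_gt0// ler_nat.
  by rewrite ET height_scale.
have hS0 := lnh_ge0 R S0.
have vTS : `|tc0 T| = `|n%:~R| * `|tc0 S|.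
  by rewrite ET; have [-> _ _ _] := taylorZ zeta n S; rewrite normrM.
have vS : lnv S <= - 3 * q + 3 * (d * q).
  apply: le_trans vT; rewrite -ler_expR !lnvK ?sS ?sT//.
  by rewrite vTS ler_peMl.
have [alpha ev dist] := root_exists zeta sT.
have evS : evalZ S alpha = 0.
  move/eqP: ev; rewrite {1}ET -mul_polyC evalZM mulf_eq0 => /orP[|/eqP//].
  by rewrite /evalZ map_polyC hornerC intr_eq0 (negbTE n0).
have dS : (d * q) * 3 <= e * q / 10 by rewrite /d; have := mulr_gt0 e0 q0; lra.
(* Passing to the primitive part may lower the height, but the exponents are negative, so this only
   weakens what has to be shown. *)
have eh : (- 3 + e) * (q + 3 * (d * q)) <= (- 3 + e) * lnh S.
  by rewrite ler_nM2l//; lra.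
have eh' : (- 4 + e) * (q + 3 * (d * q)) <= (- 4 + e) * lnh S.
  by rewrite ler_nM2l//; lra.
have edq : 0 <= e * (3 * (d * q)) by apply: mulr_ge0; lra.
exists S, alpha; split=> //.
- by split=> //; rewrite zcontents_primitive T0.
(* If the height were bounded by [M0], the value would be at least [expR b]; it is smaller, since
   [q] exceeds |b|. *)
- rewrite ltNge; apply/negP => le.
  have eq : e * q <= 1 * q by apply: ler_wpM2r; lra.
  suff hbS : b <= lnv S by have := ler_norm (- b); rewrite normrN; lra.
  apply: hb => //; first by rewrite sS.
  rewrite -(ler_nat R) (le_trans le)//; have [M00|M00] := leP 0 M0.
    exact/ltW/archi_boundP.
  by apply: le_trans (ltW M00) _.
- by lra.
- have tT : 0 < `|tc1 T| := lt_le_trans (expR_gt0 _) t1.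
  (* The distance is estimated through [T], for which the lower bound of the derivative is
     available; [S] has the same roots. *)
  rewrite -(ler_pM2r tT); apply: (le_trans dist).
  apply: le_trans (ler_wpM2l (expR_ge0 _) t1).
  rewrite -expRD -lnvK ?sT//.
  have e3 : 3 <= expR (2 : R) by have := expR_ge1Dx (2 : R); lra.
  apply: le_trans (ler_wpM2r (expR_ge0 _) e3) _.
  rewrite -expRD ler_expR; lra.
Qed.

End ExtremalNumbers.

Lemma powR_height (R : realType) (P : {poly int}) (r : R) : P != 0 ->
  (height P)%:R `^ r = expR (r * lnh R P).
Proof. by move=> P0; rewrite mulrC expRM lnhK. Qed.

Lemma evalZ_lnv (R : realType) (zeta e : R) (P : {poly int}) : transcendental zeta ->
  P != 0 -> (size P <= 4)%N -> (`|evalZ P zeta| <= expR e) = (lnv zeta P <= e).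
Proof. by move=> tr P0 sP; rewrite evalZ_tc0// -lnvK// ler_expR. Qed.

Theorem theorem2p2 (R : realType) (zeta eps : R)
    (hzeta : extremal zeta) (heps : 0 < eps) :
  [/\
    (* (i) *)
    finite_set [set Q : {poly int} | cubic_poly Q /\
      `|evalZ Q zeta| <= (height Q)%:R `^ (- 3 - eps)] /\
    finite_set [set alpha : R[i] | cubic_number alpha /\
      cdist zeta alpha <= (alg_height alpha)%:R `^ (- 4 - eps)],
    (* (ii) *)
    (forall M : R, exists Q : {poly int},
      [/\ cubic_poly Q, M < (height Q)%:R &
          `|evalZ Q zeta| <= (height Q)%:R `^ (- 3 + eps)]) /\
    (forall M : R, exists alpha : R[i],
      [/\ cubic_number alpha, M < (alg_height alpha)%:R &
          cdist zeta alpha <= (alg_height alpha)%:R `^ (- 4 + eps)])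
  & (* (iii) *)
    (forall M : R, exists2 X : R, M < X &
      ~ exists Q : {poly int},
        [/\ cubic_poly Q, (height Q)%:R <= X &
            `|evalZ Q zeta| <= X `^ (- Num.sqrt 5 - eps)]) /\
    (forall M : R, exists2 X : R, M < X &
      ~ exists alpha : R[i],
        [/\ cubic_number alpha, (alg_height alpha)%:R <= X &
            cdist zeta alpha <=
              (alg_height alpha)%:R^-1 * X `^ (- Num.sqrt 5 - eps)])].
Proof.
have tr := hzeta.1.
(* All three statements become stronger as [eps] decreases. *)
pose e := Num.min eps 1.
have e0 : 0 < e by rewrite lt_min heps ltr01.
have e1 : e <= 1 by rewrite ge_min lexx orbT.
have ee : e <= eps by rewrite ge_min lexx.
have cubP (Q : {poly int}) : cubic_poly Q -> [/\ Q != 0, (size Q <= 4)%N & 0 <= lnh R Q].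
  by move=> [[Q0 _ _] ->]; split=> //; apply: lnh_ge0.
pose c := taylor_const zeta + 2.
(* Passing from [alpha] to its minimal polynomial costs the factor H(Q) and a constant. The constant
   is the reason for the parameter [c] in [cubic_approx_finite] and [cubic_gap_large]. *)
have close alpha Q r : cubic_poly Q -> evalZ Q alpha = 0 -> r <= 0 ->
    cdist zeta alpha <= expR r -> lnv zeta Q <= r + lnh R Q + c.
  move=> /cubP[Q0 sQ _] ev r0 le.
  have le1 : cdist zeta alpha <= 1 by apply: le_trans le _; rewrite expR_le1.
  have h := root_close Q0 sQ ev le1.
  rewrite -ler_expR lnvK//; apply: le_trans h _.
  by rewrite (le_trans (ler_wpM2r (expR_ge0 _) le))// -expRD ler_expR /c; lra.
split; split.
- apply: sub_finite_set (cubic_approx_finite hzeta 0 e0 e1) => Q /= [cQ].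
  have [Q0 sQ hQ] := cubP _ cQ; rewrite powR_height// evalZ_lnv// => vQ; split=> //.
  by have := ler_wpM2r hQ ee; lra.
- have fin := cubic_approx_finite hzeta c e0 e1.
  apply: (@sub_finite_set _ _ (\bigcup_(Q in [set Q : {poly int} | cubic_poly Q /\
      lnv zeta Q <= - (3 + e) * lnh R Q + c]) [set alpha : R[i] | evalZ Q alpha = 0])).
    move=> alpha /= [/cubic_numberP[cQ ev ->]]; set Q := minpolyZ alpha in cQ ev *.
    have [Q0 sQ hQ] := cubP _ cQ; rewrite powR_height// => dist; exists Q => //=; split=> //.
    have eh := ler_wpM2r hQ ee; have eh' := mulr_ge0 (ltW e0) hQ.
    have := close _ _ _ cQ ev _ dist.
    have -> : (- 4 - eps) * lnh R Q <= 0 by lra.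
    by move=> /(_ isT); lra.
  apply: bigcup_finite => // Q /= [/cubP[Q0 _ _] _].
  exact: finite_roots.
- move=> M; have [Q [alpha [cQ _ hQ vQ _]]] := cubic_exists hzeta M e0 e1.
  have [Q0 sQ h0] := cubP _ cQ; exists Q; split=> //.
  rewrite powR_height// evalZ_lnv//; apply: le_trans vQ _.
  by rewrite ler_wpM2r// lerD2l.
- move=> M; have [Q [alpha [cQ [c1 ev] hQ _ dist]]] := cubic_exists hzeta M e0 e1.
  have [Q0 sQ h0] := cubP _ cQ; have [ca ha] := minpolyZ_cubic cQ c1 ev.
  exists alpha; rewrite ha; split=> //; rewrite powR_height//; apply: le_trans dist _.
  by rewrite ler_expR ler_wpM2r// lerD2l.
- move=> M; have [X [MX X1 hX]] := cubic_gap_large hzeta 0 M e0 e1.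
  exists X => // -[Q [cQ hQ]]; have [Q0 sQ _] := cubP _ cQ.
  have lX := ln_ge0 X1.
  rewrite -[X in X `^ _]lnK ?posrE ?(lt_le_trans ltr01)// -expRM evalZ_lnv// => vQ.
  apply: (hX Q cQ hQ); have := ler_wpM2r lX ee; lra.
- move=> M; have [X [MX X1 hX]] := cubic_gap_large hzeta c M e0 e1.
  exists X => // -[alpha [/cubic_numberP[cQ ev ->]]]; set Q := minpolyZ alpha in cQ ev *.
  have [Q0 sQ h0] := cubP _ cQ; move=> hQ.
  have lX := ln_ge0 X1.
  rewrite -[X in X `^ _]lnK ?posrE ?(lt_le_trans ltr01)// -expRM -(lnhK R Q0) -expRN -expRD => dist.
  have eh := ler_wpM2r lX ee; have eh' := mulr_ge0 (ltW e0) lX.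
  have s5 := mulr_ge0 (sqrtr_ge0 (5 : R)) lX.
  have := close _ _ _ cQ ev _ dist.
  have -> : - lnh R Q + ln X * (- Num.sqrt 5 - eps) <= 0 by lra.
  by move=> /(_ isT) vQ; apply: (hX Q cQ hQ); lra.
Qed.
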